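(* Let $L$ be an $\mathcal{O}$-lattice in the hermitian space $(V,\Phi)$ over $E$ and let $m=\operatorname{rank}_E(V)$. If $E/K$ is ramified, $m$ is even and $L\cong H(s_1)\perp H(s_2)\perp\dots\perp H(s_{m/2})$ for some integers $s_1,\dots,s_{m/2}$ with $s_i\equiv e \pmod 2$ for all $1\le i\le m/2$, then $\mathcal{E}(L)=\mathcal{E}_1$. In all other cases, $\mathcal{E}(L)=\mathcal{E}_0$.
   Context: Local setting. $K$ is a field of characteristic different from $2$, complete with respect to a surjective discrete valuation $\operatorname{ord}\colon K\to\mathbb{Z}\cup\{\infty\}$ with finite residue field; $\mathfrak{o}$ is its valuation ring and $\mathfrak{p}$ the maximal ideal of $\mathfrak{o}$. $E=K[X]/(X^2-a)$ is an étale $K$-algebra of dimension $2$ (either a quadratic field extension of $K$ or $E\cong K\oplus K$), and $\overline{\phantom{x}}\colon E\to E$ is the $K$-linear automorphism of $E$ with fixed field $K$. Put $\operatorname{Nr}(\alpha)=\alpha\overline{\alpha}$ and $\operatorname{Tr}(\alpha)=\alpha+\overline{\alpha}$. Let $\mathcal{O}=\{\alpha\in E : \operatorname{Tr}(\alpha)\in\mathfrak{o},\ \operatorname{Nr}(\alpha)\in\mathfrak{o}\}$ be the integral closure of $\mathfrak{o}$ in $E$. Let $\mathfrak{D}$ be the different of $\mathcal{O}$ over $\mathfrak{o}$, i.e. the inverse of the fractional ideal $\mathfrak{D}^{-1}=\{\alpha\in E:\operatorname{Tr}(\alpha\mathcal{O})\subseteq\mathfrak{o}\}$. If $E\cong K\oplus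 K$ put $\mathfrak{P}=\mathfrak{p}\mathcal{O}$; otherwise $\mathfrak{P}$ is the maximal ideal of $\mathcal{O}$. Then $\mathfrak{D}=\mathfrak{P}^e$ for an integer $e\ge 0$, which defines $e$. ''$E/K$ is ramified'' means that $E$ is a field and $\mathfrak{p}\mathcal{O}=\mathfrak{P}^2$. Hermitian spaces and lattices. $(V,\Phi)$ is a hermitian space over $E$: $V\neq 0$ is a finitely generated free $E$-module and $\Phi\colon V\times V\to E$ is non-degenerate, $E$-linear in the first argument, and satisfies $\Phi(w,v)=\overline{\Phi(v,w)}$. An $\mathcal{O}$-lattice in $V$ is a finitely generated $\mathcal{O}$-submodule of $V$ containing a $K$-basis of $V$. The unitary group $\mathrm{U}(V,\Phi)$ consists of all $\varphi\in\mathrm{GL}(V)$ with $\Phi(\varphi(x),\varphi(y))=\Phi(x,y)$ for all $x,y\in V$, and $\operatorname{Aut}(L)=\{\varphi\in\mathrm{U}(V,\Phi):\varphi(L)=L\}$. $\cong$ denotes isometry of hermitian lattices and $\perp$ denotes orthogonal sum. If $E/K$ is ramified, fix a prime element $\pi$ of $\mathcal{O}$; for $i\in\mathbb{Z}$, $H(i)$ denotes the free hermitian $\mathcal{O}$-lattice of rank $2$ with Gram matrix $\begin{pmatrix}0&\pi^i\\ \overline{\pi}^i&0\end{pmatrix}$ (its isometry class does not depend on the choice of $\pi$). Put $\mathcal{E}_0=\{u\in\mathcal{O}^*: u\overline{u}=1\}$, $\mathcal{E}_1=\{u\,\overline{u}^{-1}: u\in\mathcal{O}^*\}\subseteq\mathcal{E}_0$,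 and $\mathcal{E}(L)=\{\det(\varphi):\varphi\in\operatorname{Aut}(L)\}$, a subgroup of $\mathcal{E}_0$. *)

(* Defs.v *)
From HB Require Import structures.
From mathcomp Require Import all_boot all_order all_algebra all_field.
From mathcomp Require Import boolp classical_sets cardinality.

Set Implicit Arguments.
Unset Strict Implicit.
Unset Printing Implicit Defensive.

Import Order.TTheory GRing.Theory Num.Theory.
Import VectorInternalTheory.

Local Open Scope classical_set_scope.
Local Open Scope ring_scope.

Section LocalField.

Variables (K : fieldType) (ord : K -> int).

(* The value oo at 0 is not represented: [ord 0] is a junk integer, and [ord]
   only matters at nonzero elements. *)
Definition surjective_discrete_valuation : Prop :=
  [/\ forall x y, x != 0 -> y != 0 -> ord (x * y) = ord x + ord y,
      forall x y, x != 0 -> y != 0 -> x + y != 0 ->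
        Order.min (ord x) (ord y) <= ord (x + y)
    & forall n : int, exists2 x, x != 0 & ord x = n].

Definition ord_ge (n : int) : set K := [set x | x = 0 \/ n <= ord x].

Definition valuation_ring : set K := ord_ge 0.
Definition valuation_ideal : set K := ord_ge 1.

Definition valuation_complete : Prop :=
  forall u : nat -> K,
    (forall n : int, exists N : nat, forall i j : nat,
       (N <= i)%N -> (N <= j)%N -> ord_ge n (u i - u j)) ->
  exists l : K, forall n : int, exists N : nat, forall i : nat,
    (N <= i)%N -> ord_ge n (u i - l).

(* The set of residue classes x + p, for x in the valuation ring. *)
Definition residue_field : set (set K) :=
  [set [set y | valuation_ideal (y - x)] | x in valuation_ring].

End LocalField.

Notation quad_alg a := {poly %/ ('X^2 - a%:P)}.

Section QuadraticAlgebra.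

Variables (K : fieldType) (ord : K -> int) (E : comUnitAlgType K).

Definition is_field : Prop := forall x : E, x != 0 -> x \is a GRing.unit.

Definition is_split : Prop :=
  exists f : {lrmorphism E -> (K^o * K^o)%type}, bijective f.

Definition is_conjugation (bar : {lrmorphism E -> E}) : Prop :=
  bijective bar /\ (forall x : E, bar x = x <-> exists k : K, x = k%:A).

Variable bar : {lrmorphism E -> E}.

Definition Nr (x : E) : E := x * bar x.
Definition Tr (x : E) : E := x + bar x.

(* [Nr] and [Tr] take values in K, viewed inside E. *)
Definition base_ring : set E := [set k%:A | k in valuation_ring ord].

Definition calO : set E := [set x | base_ring (Tr x) /\ base_ring (Nr x)].

Definition calO_units : set E := [set u | calO u /\ exists2 v, calO v & u * v = 1].

Definition ideal_mul (I J : set E) : set E :=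
  [set z | exists s : seq (E * E),
     (forall t, t \in s -> I t.1 /\ J t.2) /\ z = \sum_(t <- s) t.1 * t.2].

Fixpoint ideal_pow (I : set E) (n : nat) : set E :=
  if n is n'.+1 then ideal_mul I (ideal_pow I n') else calO.

Definition ideal_inv (I : set E) : set E :=
  [set x | forall y, I y -> calO (x * y)].

Definition is_ideal (I : set E) : Prop :=
  [/\ I `<=` calO, I 0, (forall x y, I x -> I y -> I (x + y))
    & (forall x y, calO x -> I y -> I (x * y))].

Definition is_maximal_ideal (I : set E) : Prop :=
  [/\ is_ideal I, I <> calO
    & forall J, is_ideal J -> I `<=` J -> J = I \/ J = calO].

Definition pO : set E := ideal_mul [set k%:A | k in valuation_ideal ord] calO.

Definition is_frakP (P : set E) : Prop :=
  (is_split -> P = pO) /\ (~ is_split -> is_maximal_ideal P).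

Definition codifferent : set E :=
  [set x | forall y, calO y -> base_ring (Tr (x * y))].

Definition different : set E := ideal_inv codifferent.

Definition ramified (P : set E) : Prop := is_field /\ pO = ideal_pow P 2.

Definition is_prime_element (P : set E) (pi : E) : Prop :=
  P = [set pi * x | x in calO].

Definition calE0 : set E := [set u | calO_units u /\ u * bar u = 1].
Definition calE1 : set E := [set u / bar u | u in calO_units].

Section Lattices.

Variable V : vectType E.

Definition nondegenerate_form (Phi : V -> V -> E) : Prop :=
  forall v, (forall w, Phi v w = 0) -> v = 0.

Definition is_lattice (L : set V) : Prop :=
  (exists n (g : 'I_n -> V),
     L = [set \sum_(i < n) c i *: g i | c in [set c : 'I_n -> E | forall i, calO (c i)]]) /\
  (exists n (b : 'I_n -> V), (forall i, L (b i)) /\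
     forall v, exists! c : {ffun 'I_n -> K}, v = \sum_(i < n) (c i)%:A *: b i).

Definition isometric_lattices (W : vectType E) (Phi : V -> V -> E) (L : set V)
    (Psi : W -> W -> E) (M : set W) : Prop :=
  exists f : 'Hom(V, W),
    [/\ bijective f, forall x y, Psi (f x) (f y) = Phi x y & f @` L = M].

Definition unitary_group (Phi : V -> V -> E) : set 'End(V) :=
  [set f : 'End(V) | bijective f /\ forall x y, Phi (f x) (f y) = Phi x y].

Definition lattice_aut (Phi : V -> V -> E) (L : set V) : set 'End(V) :=
  [set f : 'End(V) | unitary_group Phi f /\ f @` L = L].

(* [f2mx f] is the matrix of [f] in the coordinates given by the vectType
   structure; its determinant does not depend on that choice. *)
Definition calE (Phi : V -> V -> E) (L : set V) : set E :=
  [set \det (f2mx f) | f in lattice_aut Phi L].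

(* Orthogonal sums of families of lattices with the same underlying module. *)
Definition perp_form (I : finType) (Phi : I -> V -> V -> E)
    (x y : {ffun I -> V}) : E :=
  \sum_i Phi i (x i) (y i).

Definition perp_lattice (I : finType) (L : I -> set V) : set {ffun I -> V} :=
  [set x | forall i, L i (x i)].

End Lattices.

(* The form for which the standard basis has Gram matrix [G]. *)
Definition gram_form n (G : 'M[E]_n) (x y : 'rV[E]_n) : E :=
  \sum_i \sum_j x 0 i * G i j * bar (y 0 j).

Definition std_lattice n : set 'rV[E]_n := [set x | forall j, calO (x 0 j)].

Definition H_gram (pi : E) (i : int) : 'M[E]_2 :=
  \matrix_(r, c) if r == c then 0 else if r == 0 then pi ^ i else bar pi ^ i.

Definition H_form (pi : E) (i : int) := gram_form (H_gram pi i).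
Definition H_lattice : set 'rV[E]_2 := @std_lattice 2.

Definition sum_of_H (pi : E) (e : nat) (V : vectType E)
    (Phi : V -> V -> E) (L : set V) : Prop :=
  ~~ odd (dim V) /\
  exists s : 'I_(dim V)./2 -> int,
    (forall i, (s i = e%:Z %[mod 2])%Z) /\
    isometric_lattices Phi L
      (perp_form (fun i => H_form pi (s i))) (perp_lattice (fun=> H_lattice)).

End QuadraticAlgebra.

(* Main.v *)
(** For z in V and sg in E with Tr(sg) = Phi(z, z), the map
    v |-> v - Phi(v, z) sg^-1 z is an isometry of determinant - bar sg / sg, and
    it preserves L as soon as z is in L and sg divides Phi(L, z).

    If E/K is not ramified, the codifferent is O, hence a z in L with Phi(z, z) of
    minimal order has Phi(L, z) in Phi(z, z) O, and every u in E_0 is the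
    determinant of the isometry multiplying z by u.

    Let E/K be ramified with prime element pi and eta = pi - bar pi, a generator of
    the different.  The class of - bar sg / sg in E_0 / E_1 (of order 2) is the
    parity of ord sg - e.  If some z in L with k = ord_K Phi(z, z) has
    Phi(L, z) in P^(2k-e+1), then all sg with ord sg = 2k-e+1 are available up to
    scaling by K, so that the whole of E_0 \ E_1, hence E_0, consists of
    determinants.  Otherwise Phi(z, z) always lies in the different times the ideal
    Phi(L, z); this forces the scale P^i of L to satisfy i = e mod 2, Hensel's
    lemma splits off a plane H(i), and by induction L is a sum of such planes.
    Conversely, in such a sum an automorphism is carried to the identity by
    reflections with ord sg = s_i = e mod 2, whose determinants lie in E_1, fixing
    the hyperbolic pairs one after the other in order of increasing s_i. *)

From HB Require Import structures.
Require Import Defs.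
From mathcomp Require Import all_boot all_order all_algebra all_field.
From mathcomp Require Import boolp classical_sets cardinality.
From mathcomp Require Import perm ring zify.

Set Implicit Arguments.
Unset Strict Implicit.
Unset Printing Implicit Defensive.

Import Order.TTheory GRing.Theory Num.Theory.
Import VectorInternalTheory.

Local Open Scope classical_set_scope.
Local Open Scope ring_scope.

(** * Discrete valuations *)

(** The constants come from the ramified trace. It maps P^(2j-e) into p^j, so that an element whose
    trace has order k has order at most 2k-e+1, and K-multiples of pi / eta attain this bound: hence
    the exponent 2k-e+1 for sg. The parity comes from Hilbert 90: an element of E_0 is x / bar x,
    where scaling x by K changes nothing and scaling it by a unit of O changes the quotient by E_1,
    so that only the parity of ord x matters; as eta is skew, - bar sg / sg equals bar y / y for y =
    sg / eta.

    Residue characteristic 2 shapes the proof: 2 may fail to be invertible in o, lattices need not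
    have orthogonal bases, and norms and traces have to be estimated separately. For inert E, square
    roots in the finite residue field replace division by 2 in the proof that the codifferent is O.

    That determinants lie in E_0 is more than having norm 1: in K + K norm 1 does not imply
    integrality. There the powers of a determinant, being determinants too, have bounded
    denominators, which forces integrality. *)

Lemma int_parity (m : int) : exists j, m = j *+ 2 \/ m = j *+ 2 + 1.
Proof.
have := divz_eq m 2; have := modz_ge0 m (isT : 2 != 0 :> int).
have := ltz_pmod m (isT : 0 < 2 :> int).
set r := (m %% 2)%Z; set j := (m %/ 2)%Z => r2 r0 mE; exists j.
by have [r1|r1] := eqVneq r 1; [right | left]; lia.
Qed.

Section Valuation.

Variables (K : fieldType) (ord : K -> int).
Hypothesis ord_val : surjective_discrete_valuation ord.

Lemma ordM x y : x != 0 -> y != 0 -> ord (x * y) = ord x + ord y.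
Proof. by case: ord_val => h _ _; apply: h. Qed.

Lemma ord_one : ord 1 = 0.
Proof.
have n1 : (1 : K) != 0 by exact: oner_neq0.
by have := ordM n1 n1; rewrite mulr1; lia.
Qed.

Lemma ordV x : x != 0 -> ord x^-1 = - ord x.
Proof.
move=> x0; have := ordM x0 (invr_neq0 x0); rewrite divff // ord_one; lia.
Qed.

Lemma ordN x : ord (- x) = ord x.
Proof.
have [->|x0] := eqVneq x 0; first by rewrite oppr0.
have n1 : (-1 : K) != 0 by rewrite oppr_eq0 oner_neq0.
have := ordM n1 n1; rewrite mulrNN mulr1 ord_one => h.
by rewrite -mulN1r ordM //; lia.
Qed.

Lemma ord_geP n x : x != 0 -> ord_ge ord n x <-> n <= ord x.
Proof.
move=> x0; split; last by right.
by case=> // h; rewrite h eqxx in x0.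
Qed.

Lemma ord_geW m n x : n <= m -> ord_ge ord m x -> ord_ge ord n x.
Proof. by move=> mn [->|h]; [left | right; apply: le_trans h]. Qed.

Lemma ord_geN n x : ord_ge ord n x -> ord_ge ord n (- x).
Proof. by case=> [->|h]; [left; rewrite oppr0 | right; rewrite ordN]. Qed.

Lemma ord_geD n x y : ord_ge ord n x -> ord_ge ord n y -> ord_ge ord n (x + y).
Proof.
case=> [->|hx]; first by rewrite add0r.
case=> [->|hy]; first by rewrite addr0; right.
have [->|x0] := eqVneq x 0; first by rewrite add0r; right.
have [->|y0] := eqVneq y 0; first by rewrite addr0; right.
have [->|xy0] := eqVneq (x + y) 0; first by left.
right; case: ord_val => _ /(_ _ _ x0 y0 xy0) h _; apply: le_trans h.
by rewrite le_min hx hy.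
Qed.

Lemma ord_geB n x y : ord_ge ord n x -> ord_ge ord n y -> ord_ge ord n (x - y).
Proof. by move=> hx hy; apply: ord_geD => //; apply: ord_geN. Qed.

Lemma ord_geM m n x y :
  ord_ge ord m x -> ord_ge ord n y -> ord_ge ord (m + n) (x * y).
Proof.
case=> [->|hx]; first by rewrite mul0r; left.
case=> [->|hy]; first by rewrite mulr0; left.
have [->|x0] := eqVneq x 0; first by rewrite mul0r; left.
have [->|y0] := eqVneq y 0; first by rewrite mulr0; left.
by right; rewrite ordM // lerD.
Qed.

Lemma ord_geMr n x y : ord_ge ord 0 x -> ord_ge ord n y -> ord_ge ord n (x * y).
Proof. by rewrite -{2}(add0r n); apply: ord_geM. Qed.

Lemma ord_geX n x : ord_ge ord 0 x -> ord_ge ord 0 (x ^+ n).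
Proof.
move=> hx; elim: n => [|n IH]; first by right; rewrite expr0 ord_one.
by rewrite exprS; apply: ord_geMr.
Qed.

Lemma ord_ge_nat n : ord_ge ord 0 n%:R.
Proof.
elim: n => [|n IH]; first by left.
by rewrite -natr1; apply: ord_geD => //; right; rewrite ord_one.
Qed.

Lemma ord_ge_sum n (I : Type) (r : seq I) (P : pred I) (F : I -> K) :
  (forall i, P i -> ord_ge ord n (F i)) -> ord_ge ord n (\sum_(i <- r | P i) F i).
Proof.
by move=> h; elim/big_ind: _ => //; [left | apply: ord_geD].
Qed.

Lemma ord_ge_all x : (forall n : int, ord_ge ord n x) -> x = 0.
Proof.
move=> h; apply/eqP; apply: contraT => x0.
by have /(ord_geP _ x0) := h (ord x + 1); lia.
Qed.

Lemma ordD_lt n x y : x != 0 -> ord x < n -> ord_ge ord n y ->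
  x + y != 0 /\ ord (x + y) = ord x.
Proof.
move=> x0 xn hy.
have xy0 : x + y != 0.
  rewrite addr_eq0; apply/eqP => xy.
  have /(ord_geP _ x0) : ord_ge ord n x by rewrite xy; apply: ord_geN.
  lia.
have /(ord_geP _ xy0) h1 : ord_ge ord (ord x) (x + y).
  by apply: ord_geD; [right | apply: ord_geW hy; lia].
split=> //; apply/eqP; rewrite eq_le h1 andbT leNgt; apply/negP => h2.
suff /(ord_geP _ x0) : ord_ge ord (ord x + 1) x by lia.
have : ord_ge ord (ord x + 1) (x + y - y).
  by apply: ord_geB; [right; lia | apply: ord_geW hy; lia].
by rewrite addrK.
Qed.

Lemma ord_surj (n : int) : exists2 x, x != 0 & ord x = n.
Proof. by case: ord_val. Qed.

Lemma ord_sqr x : x != 0 -> ord (x ^+ 2) = ord x *+ 2.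
Proof. by move=> x0; rewrite expr2 ordM // mulr2n. Qed.

Lemma ord_gtV x : x != 0 -> ~ ord_ge ord 0 x -> ord_ge ord 1 x^-1.
Proof.
move=> x0 h; apply/ord_geP; rewrite ?invr_eq0 // ordV //.
have : ~ (0 <= ord x) by move=> h'; apply: h; right.
lia.
Qed.

Hypothesis K_complete : valuation_complete ord.

(** The root is the limit of the iterates of t |-> - a - c t^2, a contraction of o because c lies in
    p and t - t' divides t^2 - t'^2. The derivative 1 + 2 c t is a unit in every residue
    characteristic. *)
Lemma quadratic_hensel a c : ord_ge ord 0 a -> ord_ge ord 1 c ->
  exists2 t, ord_ge ord 0 t & a + t + c * t ^+ 2 = 0.
Proof.
move=> a_int c_max.
have c_int : ord_ge ord 0 c by apply: ord_geW c_max.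
pose t := fix t n := if n is n'.+1 then - a - c * t n' ^+ 2 else 0.
have tS n : t n.+1 = - a - c * t n ^+ 2 by [].
have t_int n : ord_ge ord 0 (t n).
  elim: n => [|n IH] /=; first by left.
  by apply: ord_geB; [apply: ord_geN | apply: ord_geMr => //; apply: ord_geX].
have t_step n : ord_ge ord n%:Z (t n.+1 - t n).
  elim: n => [|n IH]; first by apply: ord_geB.
  have -> : t n.+2 - t n.+1 = - (c * ((t n.+1 - t n) * (t n.+1 + t n))).
    by rewrite (tS n.+1) (tS n); ring.
  apply: ord_geN; rewrite (_ : n.+1%:Z = 1 + (n%:Z + 0)); last by lia.
  by apply: ord_geM => //; apply: ord_geM => //; apply: ord_geD.
have t_cauchy n k : ord_ge ord n%:Z (t (n + k)%N - t n).
  elim: k => [|k IH]; first by rewrite addn0 subrr; left.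
  rewrite addnS (_ : _ - _ = (t (n + k).+1 - t (n + k)%N) + (t (n + k)%N - t n)).
    by apply: ord_geD => //; apply: ord_geW (t_step _); lia.
  by ring.
have [n|l l_lim] := @K_complete t.
  exists `|n|%N => i j hi hj.
  rewrite -(subnKC hi) -(subnKC hj).
  have h k : ord_ge ord n (t (`|n| + k)%N - t `|n|%N).
    by apply: ord_geW (t_cauchy _ _); lia.
  rewrite (_ : t _ - t _ = (t (`|n| + (i - `|n|))%N - t `|n|%N)
     - (t (`|n| + (j - `|n|))%N - t `|n|%N)); last by ring.
  by apply: ord_geB.
have l_int : ord_ge ord 0 l.
  have [N hN] := l_lim 0.
  rewrite -(subKr (t N) l); apply: ord_geB => //; exact: hN.
exists l => //; apply: ord_ge_all => n.
have [N hN] := l_lim n.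
pose i := (N + `|n|)%N.
have -> : a + l + c * l ^+ 2 =
    - (t i.+1 - t i) - (t i - l) * (1 + c * (l + t i)).
  by rewrite tS; ring.
apply: ord_geB.
  by apply: ord_geN; apply: ord_geW (t_step _); rewrite /i; lia.
rewrite mulrC; apply: ord_geMr; last by apply: hN; rewrite leq_addr.
apply: ord_geD; first by right; rewrite ord_one.
by apply: ord_geMr => //; apply: ord_geD.
Qed.

End Valuation.

Arguments ord_geP {K ord n x} _.

(** * Trace, norm and integral closure *)

Definition iota_alg (K : fieldType) (E : comUnitAlgType K) : {rmorphism K -> E} :=
  in_alg E.

(** What the proof retains of the étale algebra: the involution, its fixed ring K, and an invertible
    skew element, which for the algebra of the theorem is the class of X. Multiplication by the skew
    element turns trace zero into nonzero trace. *)
Record quadratic_setting (K : fieldType) (ord : K -> int) (E : comUnitAlgType K)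
    (bar : {lrmorphism E -> E}) : Prop := QuadraticSetting {
  two_neq0 : (2 : K) != 0;
  setting_val : surjective_discrete_valuation ord;
  setting_complete : valuation_complete ord;
  setting_residue : finite_set (residue_field ord);
  barK : involutive bar;
  bar_fix : forall x, bar x = x -> exists k, x = iota_alg E k;
  skew_unit : exists2 d, d \is a GRing.unit & bar d = - d }.

Section TraceNorm.

Variables (K : fieldType) (ord : K -> int) (E : comUnitAlgType K).
Variable bar : {lrmorphism E -> E}.

Local Notation iota := (iota_alg E).

(* The trace and norm of Defs take values in [E]; these are the corresponding
   elements of [K]. *)
Definition trK (x : E) : K := xget 0 [set k | iota k = Tr bar x].
Definition nrK (x : E) : K := xget 0 [set k | iota k = Nr bar x].

Hypothesis S : quadratic_setting ord bar.

Let vK := setting_val S.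
Let bK := barK S.

Lemma barD x y : bar (x + y) = bar x + bar y. Proof. exact: rmorphD. Qed.
Lemma barB x y : bar (x - y) = bar x - bar y. Proof. exact: rmorphB. Qed.
Lemma barN x : bar (- x) = - bar x. Proof. exact: rmorphN. Qed.
Lemma barM x y : bar (x * y) = bar x * bar y. Proof. exact: rmorphM. Qed.
Lemma bar1 : bar 1 = 1. Proof. exact: rmorph1. Qed.
Lemma bar_inv x : x \is a GRing.unit -> bar x^-1 = (bar x)^-1.
Proof. exact: rmorphV. Qed.
Lemma bar0 : bar 0 = 0. Proof. exact: rmorph0. Qed.
Lemma iota_algD k l : iota (k + l) = iota k + iota l. Proof. exact: rmorphD. Qed.
Lemma iota_algB k l : iota (k - l) = iota k - iota l. Proof. exact: rmorphB. Qed.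
Lemma iota_algN k : iota (- k) = - iota k. Proof. exact: rmorphN. Qed.
Lemma iota_algM k l : iota (k * l) = iota k * iota l. Proof. exact: rmorphM. Qed.
Lemma iota_algX k n : iota (k ^+ n) = iota k ^+ n. Proof. exact: rmorphXn. Qed.
Lemma iota_algMn k n : iota (k *+ n) = iota k *+ n. Proof. exact: rmorphMn. Qed.
Lemma iota_alg1 : iota 1 = 1. Proof. exact: rmorph1. Qed.
Lemma iota_alg0 : iota 0 = 0. Proof. exact: rmorph0. Qed.

Lemma iota_inj : injective iota.
Proof. exact: fmorph_inj. Qed.

Lemma bar_iota k : bar (iota k) = iota k.
Proof. exact: rmorph_alg. Qed.

Lemma trKE x : iota (trK x) = x + bar x.
Proof.
have [k kE] : exists k, Tr bar x = iota k.
  by apply: bar_fix S _ _; rewrite /Tr barD bK addrC.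
by have /= := @xgetPex _ 0 [set k | iota k = Tr bar x] (ex_intro _ k (esym kE)).
Qed.

Lemma nrKE x : iota (nrK x) = x * bar x.
Proof.
have [k kE] : exists k, Nr bar x = iota k.
  by apply: bar_fix S _ _; rewrite /Nr barM bK mulrC.
by have /= := @xgetPex _ 0 [set k | iota k = Nr bar x] (ex_intro _ k (esym kE)).
Qed.

Lemma trKD x y : trK (x + y) = trK x + trK y.
Proof. by apply: iota_inj; rewrite iota_algD !trKE barD; ring. Qed.

Lemma trKZ k x : trK (iota k * x) = k * trK x.
Proof. by apply: iota_inj; rewrite iota_algM !trKE barM bar_iota; ring. Qed.

Lemma trKN x : trK (- x) = - trK x.
Proof. by apply: iota_inj; rewrite iota_algN !trKE barN; ring. Qed.

Lemma trKB x y : trK (x - y) = trK x - trK y.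
Proof. by rewrite trKD trKN. Qed.

Lemma trK_bar x : trK (bar x) = trK x.
Proof. by apply: iota_inj; rewrite !trKE bK addrC. Qed.

Lemma trK_iota k : trK (iota k) = k *+ 2.
Proof. by apply: iota_inj; rewrite trKE bar_iota iota_algMn mulr2n. Qed.

Lemma trK0 : trK 0 = 0.
Proof. by apply: iota_inj; rewrite trKE bar0 iota_alg0 addr0. Qed.

Lemma nrKM x y : nrK (x * y) = nrK x * nrK y.
Proof. by apply: iota_inj; rewrite iota_algM !nrKE barM; ring. Qed.

Lemma nrK_bar x : nrK (bar x) = nrK x.
Proof. by apply: iota_inj; rewrite !nrKE bK mulrC. Qed.

Lemma nrK_iota k : nrK (iota k) = k ^+ 2.
Proof. by apply: iota_inj; rewrite nrKE bar_iota iota_algX. Qed.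

Lemma nrKN x : nrK (- x) = nrK x.
Proof. by apply: iota_inj; rewrite !nrKE barN mulrNN. Qed.

Lemma nrK1 : nrK 1 = 1.
Proof. by apply: iota_inj; rewrite nrKE bar1 iota_alg1 mulr1. Qed.

Lemma nrK0 : nrK 0 = 0.
Proof. by apply: iota_inj; rewrite nrKE bar0 iota_alg0 mulr0. Qed.

Lemma nrKD x y : nrK (x + y) = nrK x + nrK y + trK (x * bar y).
Proof.
by apply: iota_inj; rewrite !iota_algD !nrKE trKE barM barD bK; ring.
Qed.

Lemma trK_sqr x : trK (x ^+ 2) = trK x ^+ 2 - nrK x *+ 2.
Proof.
apply: iota_inj.
by rewrite iota_algB iota_algX iota_algMn !trKE nrKE expr2 barM; ring.
Qed.

Lemma iota_neq0 k : k != 0 -> iota k \is a GRing.unit.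
Proof. by move=> k0; apply: rmorph_unit; rewrite unitfE. Qed.

Lemma nrK_unit x : (x \is a GRing.unit) = (nrK x != 0).
Proof.
apply/idP/idP => [ux|n0].
  apply/eqP => n0; have : nrK (x * x^-1) = 0 by rewrite nrKM n0 mul0r.
  by rewrite divrr // nrK1 => /eqP; rewrite oner_eq0.
have := iota_neq0 n0; rewrite nrKE unitrM_comm; last exact: mulrC.
by case/andP.
Qed.

Lemma nrKV x : x \is a GRing.unit -> nrK x^-1 = (nrK x)^-1.
Proof.
move=> ux; have n0 : nrK x != 0 by rewrite -nrK_unit.
by apply: (mulfI n0); rewrite -nrKM divrr // nrK1 divff.
Qed.

Lemma bar_unit x : (bar x \is a GRing.unit) = (x \is a GRing.unit).
Proof. by rewrite !nrK_unit nrK_bar. Qed.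

Lemma calOP x :
  calO ord bar x <-> ord_ge ord 0 (trK x) /\ ord_ge ord 0 (nrK x).
Proof.
split=> [[[k hk kE] [l hl lE]] | [ht hn]].
  split.
    have -> : trK x = k by apply: iota_inj; rewrite trKE; exact: esym kE.
    exact: hk.
  have -> : nrK x = l by apply: iota_inj; rewrite nrKE; exact: esym lE.
  exact: hl.
by split; [exists (trK x) => //; apply: trKE | exists (nrK x) => //; apply: nrKE].
Qed.

Lemma calO_bar x : calO ord bar x -> calO ord bar (bar x).
Proof. by rewrite !calOP trK_bar nrK_bar. Qed.

Lemma calO_iota k : ord_ge ord 0 k -> calO ord bar (iota k).
Proof.
move=> hk; rewrite calOP trK_iota nrK_iota; split; last exact: ord_geX.
by rewrite mulr2n; apply: ord_geD.
Qed.

Lemma calO_iotaP k : calO ord bar (iota k) -> ord_ge ord 0 k.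
Proof.
rewrite calOP nrK_iota => -[_ h]; have [->|k0] := eqVneq k 0; first by left.
right; have /ord_geP := h; rewrite sqrf_eq0 ord_sqr // => /(_ k0); lia.
Qed.

Lemma base_ringP k : base_ring ord (iota k) <-> ord_ge ord 0 k.
Proof.
split=> [[l hl /iota_inj <- //]|hk]; by exists k.
Qed.

(** For x = 1 + u one has u bar(x) = u + u bar(u) = x. The exception u = -1 is served by the skew
    unit. *)
Lemma hilbert90 : is_field E -> forall u, u * bar u = 1 ->
  exists2 x, x \is a GRing.unit & u = x / bar x.
Proof.
move=> fE u u1; have [d ud dN] := skew_unit S.
have [um1|n0] := eqVneq (1 + u) 0.
  exists d => //; rewrite dN invrN mulrN divrr //.
  by apply/eqP; rewrite -addr_eq0 addrC um1.
exists (1 + u); first exact: fE.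
apply: (mulIr (x := bar (1 + u))); first by rewrite bar_unit; apply: fE.
rewrite divrK; last by rewrite bar_unit; apply: fE.
by rewrite barD bar1 mulrDr mulr1 u1 addrC.
Qed.

(** * The case where E is not a field *)

Section Split.

Hypothesis nfield : ~ is_field E.

(** A nonzero non-unit x has norm 0, and x / Tr(x) is the idempotent if Tr(x) is nonzero. If Tr(x) =
    0, then x is skew and Tr(x d) = 2 x d is nonzero, so x d serves instead. *)
Lemma split_idempotent : exists2 ep, ep + bar ep = 1 & ep * bar ep = 0.
Proof.
have [x [x0 nx]] : exists x : E, x != 0 /\ nrK x = 0.
  move/existsNP: nfield => [x /not_implyP[x0 nux]]; exists x; split=> //.
  by apply/eqP; apply: contra_notT nux; rewrite nrK_unit.
have main y : trK y != 0 -> nrK y = 0 ->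
    exists2 ep, ep + bar ep = 1 & ep * bar ep = 0.
  move=> t0 n0; exists (iota (trK y)^-1 * y).
    by rewrite barM bar_iota -mulrDr -trKE -iota_algM mulVf // iota_alg1.
  transitivity (iota (trK y)^-1 ^+ 2 * (y * bar y)).
    by rewrite barM bar_iota; ring.
  by rewrite -nrKE n0 iota_alg0 mulr0.
have [t0|] := eqVneq (trK x) 0; last by move=> t0; apply: main t0 nx.
have [d ud dN] := skew_unit S.
apply: (main (x * d)); last by rewrite nrKM nx mul0r.
have bx : bar x = - x by apply/eqP; rewrite -addr_eq0 addrC -trKE t0 iota_alg0.
apply/eqP => td0; move/eqP: x0; apply.
have : iota (trK (x * d)) = iota 2 * x * d.
  by rewrite trKE barM bx dN rmorph_nat; ring.
rewrite td0 iota_alg0 => h; apply: (mulIr ud); rewrite mul0r.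
by apply: (mulrI (iota_neq0 (two_neq0 S))); rewrite mulrA -h mulr0.
Qed.

(** Integral closedness of o, for a quadratic polynomial with both roots known: a negative order of
    a would be shared by b, as the sum is integral, and then the product could not be integral. *)
Lemma int_factors a b : ord_ge ord 0 (a + b) -> ord_ge ord 0 (a * b) ->
  ord_ge ord 0 a.
Proof.
move=> hs hp; have [->|a0] := eqVneq a 0; first by left.
right; rewrite leNgt; apply/negP => al.
have b0 : b != 0 /\ ord b = ord a.
  have Na0 : - a != 0 by rewrite oppr_eq0.
  have Nal : ord (- a) < 0 by rewrite (ordN vK).
  have [] := ordD_lt vK Na0 Nal hs.
  by rewrite addKr (ordN vK).
case: b0 => b0 bl.
move/(ord_geP (mulf_neq0 a0 b0)): hp; rewrite (ordM vK) // bl; lia.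
Qed.

(** The maps x |-> [trK (x * ep)] and x |-> [trK (x * bar ep)] are the two projections of E = K + K;
    trace and norm are their sum and product, so O becomes o + o. *)
Lemma calO_split_char : exists ep : E, calO ord bar ep /\
  [/\ forall x y, trK (x * y * ep) = trK (x * ep) * trK (y * ep)
    & forall x, calO ord bar x <->
       ord_ge ord 0 (trK (x * ep)) /\ ord_ge ord 0 (trK (x * bar ep))].
Proof.
have [ep epD epM] := split_idempotent.
have ep2 : ep * ep = ep.
  by rewrite -[RHS]mulr1 -epD mulrDr epM addr0.
have bepD : bar ep = 1 - ep by rewrite -epD addrC addKr.
have chiE x : x * ep = iota (trK (x * ep)) * ep.
  rewrite trKE barM bepD mulrDl -!mulrA ep2 (mulrC (1 - ep)) -bepD epM.
  by rewrite mulr0 addr0.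
have ep0 : ep != 0.
  apply/eqP => h; move: epD; rewrite h bar0 addr0 => /esym/eqP.
  by rewrite oner_eq0.
have cancel_ep k l : iota k * ep = iota l * ep -> k = l.
  move=> h; apply/eqP; rewrite -subr_eq0; apply: contraT => kl0.
  suff : ep = 0 by move/eqP; rewrite (negPf ep0).
  by apply: (mulrI (iota_neq0 kl0)); rewrite mulr0 iota_algB mulrBl h subrr.
have chiM x y : trK (x * y * ep) = trK (x * ep) * trK (y * ep).
  apply: cancel_ep; rewrite -chiE iota_algM.
  transitivity ((iota (trK (x * ep)) * ep) * (iota (trK (y * ep)) * ep)).
    by rewrite -(chiE x) -(chiE y) mulrACA ep2.
  by rewrite mulrACA ep2.
have chi_bar x : trK (bar x * ep) = trK (x * bar ep).
  by rewrite -[RHS]trK_bar barM bK.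
have chiD x : trK x = trK (x * ep) + trK (x * bar ep).
  by rewrite -trKD -mulrDr epD mulr1.
have chiN x : nrK x = trK (x * ep) * trK (x * bar ep).
  by apply: cancel_ep; rewrite -chi_bar -chiM -chiE -nrKE.
have chiO x : calO ord bar x <->
       ord_ge ord 0 (trK (x * ep)) /\ ord_ge ord 0 (trK (x * bar ep)).
  rewrite calOP chiD chiN; split=> -[h1 h2]; last first.
    by split; [apply: ord_geD | apply: ord_geMr].
  split; first exact: int_factors h1 h2.
  by apply: (@int_factors _ (trK (x * ep))); [rewrite addrC | rewrite mulrC].
exists ep; split; last by split.
rewrite calOP; split; last by left; apply: iota_inj; rewrite nrKE epM iota_alg0.
have -> : trK ep = 1 by apply: iota_inj; rewrite trKE epD iota_alg1.
by right; rewrite (ord_one vK).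
Qed.

Lemma calOM_split x y : calO ord bar x -> calO ord bar y -> calO ord bar (x * y).
Proof.
have [ep [_ [chiM chiO]]] := calO_split_char.
rewrite !chiO => -[x1 x2] [y1 y2]; rewrite chiM; split; first exact: ord_geMr.
have e z : trK (z * bar ep) = trK (bar z * ep) by rewrite -trK_bar barM bK.
rewrite e barM chiM; apply: ord_geMr => //; by rewrite -e.
Qed.

(** Tested on [ep] and [bar ep], which lie in O, the trace returns the two coordinates of x. *)
Lemma codifferent_split x : codifferent ord bar x -> calO ord bar x.
Proof.
have [ep [ep_int [_ chiO]]] := calO_split_char.
move=> h; apply/chiO; split.
  by apply/base_ringP; rewrite trKE; apply: h.
by apply/base_ringP; rewrite trKE; apply: h; apply: calO_bar.
Qed.

End Split.

(** * The case where E is a field: integrality read off the norm *)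

Section Field.

Hypothesis fieldE : is_field E.

Lemma field_neq0 (x : E) : (x \is a GRing.unit) = (x != 0).
Proof.
apply/idP/idP => [ux|]; last exact: fieldE.
by apply: contraTneq ux => ->; rewrite unitr0.
Qed.

Lemma nrK_eq0 x : (nrK x == 0) = (x == 0).
Proof. by apply/negb_inj; rewrite -nrK_unit field_neq0. Qed.

Lemma field_mul_eq0 (x y : E) : x * y = 0 -> x = 0 \/ y = 0.
Proof.
move=> xy; have [->|x0] := eqVneq x 0; [by left | right].
by apply: (mulrI (fieldE x0)); rewrite xy mulr0.
Qed.

(* If the trace [t] of [x] were not integral, then Hensel's lemma would give
   a root in [K] of the minimal polynomial X^2 - t X + n. *)
Lemma calO_field x : calO ord bar x <-> ord_ge ord 0 (nrK x).
Proof.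
rewrite calOP; split=> [[]//|hn]; split=> //; apply: contrapT => ht.
set n := nrK x in hn *; set t := trK x in ht *.
have t0 : t != 0 by apply: contra_not_neq ht => ->; left.
have tV := ord_gtV vK t0 ht.
have c_max : ord_ge ord 1 (- (n * t^-1 ^+ 2)).
  apply: ord_geN => //; apply: ord_geMr => //; rewrite expr2.
  by apply: (ord_geW (m := 1 + 1)) => //; apply: ord_geM.
have a_int : ord_ge ord 0 (-1 : K) by right; rewrite (ordN vK) (ord_one vK).
have [s _ sE] := quadratic_hensel vK (setting_complete S) a_int c_max.
(* The substitution X = n s / t turns X^2 - t X + n into - n (- 1 + s - (n / t^2) s^2), whose second
   factor has the shape required by [quadratic_hensel]. *)
pose r := n * s * t^-1.
have rE : r ^+ 2 - t * r + n = 0.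
  have -> : r ^+ 2 - t * r + n = - n * (-1 + s + - (n * t^-1 ^+ 2) * s ^+ 2).
    by rewrite /r; field.
  by rewrite sE mulr0.
have /field_mul_eq0 xr : (iota r - x) * (iota r - bar x) = 0.
  transitivity (iota r ^+ 2 - (x + bar x) * iota r + x * bar x); first by ring.
  by rewrite -trKE -nrKE -iota_algX -iota_algM -iota_algB -iota_algD rE iota_alg0.
have {xr} xE : x = iota r.
  case: xr => /eqP; rewrite subr_eq0 => /eqP // h.
  by rewrite -[LHS]bK -h bar_iota.
apply: ht; rewrite /t xE trK_iota mulr2n.
move: hn; rewrite /n xE nrK_iota => hn.
suff hr : ord_ge ord 0 r by apply: ord_geD.
have [->|r0] := eqVneq r 0; first by left.
right; move/ord_geP: hn; rewrite sqrf_eq0 (ord_sqr vK) // => /(_ r0); lia.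
Qed.

End Field.

Lemma calOM x y : calO ord bar x -> calO ord bar y -> calO ord bar (x * y).
Proof.
have [fE|nfE] := pselect (is_field E); last exact: calOM_split.
by rewrite !(calO_field fE) nrKM; apply: ord_geMr.
Qed.

(** Since Nr(x + y) = Nr(x) + Nr(y) + Tr(x bar y), closure under sums follows from closure under
    products. *)
Lemma calOD x y : calO ord bar x -> calO ord bar y -> calO ord bar (x + y).
Proof.
move=> hx hy; have /calOP[h _] := calOM hx (calO_bar hy).
move/calOP: hx => [hx1 hx2]; move/calOP: hy => [hy1 hy2].
rewrite calOP trKD nrKD; split; first exact: ord_geD.
by apply: ord_geD => //; apply: ord_geD.
Qed.

Lemma calON x : calO ord bar x -> calO ord bar (- x).
Proof. by rewrite !calOP trKN nrKN => -[h1 h2]; split=> //; apply: ord_geN. Qed.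

Lemma calO0 : calO ord bar 0.
Proof. by rewrite calOP trK0 nrK0; split; left. Qed.

Lemma calO1 : calO ord bar 1.
Proof. by rewrite -iota_alg1; apply: calO_iota; right; rewrite (ord_one vK). Qed.

Lemma calO_sum (I : Type) (r : seq I) (P : pred I) (F : I -> E) :
  (forall i, P i -> calO ord bar (F i)) ->
  calO ord bar (\sum_(i <- r | P i) F i).
Proof. by move=> h; elim/big_ind: _ => //; [exact: calO0 | exact: calOD]. Qed.

Lemma scale_calO x : exists c, [/\ c != 0, ord_ge ord 0 c & calO ord bar (iota c * x)].
Proof.
have ex_int k : exists c, [/\ c != 0, ord_ge ord 0 c & ord_ge ord 0 (c * k)].
  have [c c0 cE] := ord_surj vK `|ord k|.
  exists c; split=> //; first by right; rewrite cE; lia.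
  have [->|k0] := eqVneq k 0; first by rewrite mulr0; left.
  by right; rewrite (ordM vK) // cE; lia.
have [b [b0 bint hb]] := ex_int (trK x); have [c [c0 cint hc]] := ex_int (nrK x).
exists (b * c); split; rewrite ?mulf_neq0 //; first exact: ord_geMr.
rewrite calOP trKZ nrKM nrK_iota; split.
  by rewrite mulrAC mulrC; apply: ord_geMr.
have -> : (b * c) ^+ 2 * nrK x = b ^+ 2 * c * (c * nrK x) by ring.
by do 2?apply: ord_geMr => //; apply: ord_geX.
Qed.

Lemma scale_calO_seq (s : seq E) : exists c, [/\ c != 0, ord_ge ord 0 c &
  forall x, x \in s -> calO ord bar (iota c * x)].
Proof.
elim: s => [|x s [c [c0 cint hc]]].
  by exists 1; split=> //; [exact: oner_neq0 | right; rewrite (ord_one vK)].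
have [b [b0 bint hb]] := scale_calO x.
exists (b * c); split; rewrite ?mulf_neq0 //; first exact: ord_geMr.
move=> y; rewrite inE iota_algM => /orP[/eqP ->|/hc hy].
  by rewrite mulrAC mulrC; apply: calOM hb; apply: calO_iota.
by rewrite -mulrA; apply: calOM hy; apply: calO_iota.
Qed.

Lemma norm1_calO_units u : u * bar u = 1 -> calO ord bar u -> calO_units ord bar u.
Proof. by move=> u1 hu; split=> //; exists (bar u) => //; apply: calO_bar. Qed.

(* T_n = Tr(u^n) satisfies T_{2n} = T_n^2 - 2, so a negative valuation of
   Tr(u) doubles at each step. *)
Lemma bounded_powers_calO u (M : int) : u * bar u = 1 ->
  (forall n, ord_ge ord M (trK (u ^+ n))) -> calO ord bar u.
Proof.
move=> u1 hM; have nu : nrK u = 1 by apply: iota_inj; rewrite nrKE u1 iota_alg1.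
rewrite calOP nu; split; last by right; rewrite (ord_one vK).
have [->|t0] := eqVneq (trK u) 0; first by left.
right; rewrite leNgt; apply/negP => tneg.
have step j : trK (u ^+ (2 ^ j)) != 0 /\ ord (trK (u ^+ (2 ^ j))) <= - j%:Z - 1.
  elim: j => [|j [T0 Tj]]; first by rewrite expr1; split=> //; lia.
  rewrite expnSr exprM trK_sqr.
  have T20 := expf_neq0 2 T0.
  have T2 := ord_sqr vK T0.
  have nX : nrK (u ^+ (2 ^ j)) = 1.
    by elim: (2 ^ j)%N => [|m IH]; rewrite ?expr0 ?nrK1 // exprS nrKM nu IH mulr1.
  have lt0 : ord (trK (u ^+ (2 ^ j)) ^+ 2) < 0 by rewrite T2; lia.
  have h2 : ord_ge ord 0 (- (nrK (u ^+ (2 ^ j)) *+ 2)).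
    by apply: ord_geN => //; rewrite nX; apply: ord_ge_nat.
  have [H1 H2] := ordD_lt vK T20 lt0 h2.
  by split=> //; rewrite H2 T2; lia.
have [T0 Tj] := step `|M|%N.
by have /(ord_geP T0) := hM (2 ^ `|M|)%N; lia.
Qed.

End TraceNorm.

(** * Square roots in a finite residue field of characteristic 2 *)

Section ResidueSquares.

Variables (K : fieldType) (ord : K -> int).
Hypothesis ord_val : surjective_discrete_valuation ord.
Hypothesis two_small : ord_ge ord 1 (2 : K).

Lemma ord_ge_sqr1 x : ord_ge ord 1 (x ^+ 2) -> ord_ge ord 1 x.
Proof.
have [->|x0] := eqVneq x 0; first by left.
move/ord_geP; rewrite sqrf_eq0 (ord_sqr ord_val) // => /(_ x0) h; right; lia.
Qed.

Lemma frobenius_inj x y n : ord_ge ord 0 x -> ord_ge ord 0 y ->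
  ord_ge ord 1 (x ^+ (2 ^ n) - y ^+ (2 ^ n)) -> ord_ge ord 1 (x - y).
Proof.
elim: n x y => [|n IH] x y hx hy //.
rewrite expnS !exprM => /IH h.
have {}h : ord_ge ord 1 (x ^+ 2 - y ^+ 2) by apply: h; apply: ord_geX.
apply: ord_ge_sqr1.
have -> : (x - y) ^+ 2 = (x ^+ 2 - y ^+ 2) - (y * (x - y)) * 2 by ring.
apply: ord_geB => //; apply: ord_geMr => //; apply: ord_geMr => //.
exact: ord_geB.
Qed.

(** By finiteness two of the iterated squares r^(2^i) and r^(2^j), i < j, agree modulo p. Squaring
    is injective modulo p, so r^(2^(j-i)) agrees with r, and r^(2^(j-i-1)) is a square root. *)
Lemma residue_sqrt r : finite_set (residue_field ord) -> ord_ge ord 0 r ->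
  exists2 s, ord_ge ord 0 s & ord_ge ord 1 (s ^+ 2 - r).
Proof.
move=> fin hr.
pose f n := [set y | valuation_ideal ord (y - r ^+ (2 ^ n))].
have [i [j [ij fij]]] : exists i j, (i < j)%N /\ f i = f j.
  apply: contrapT => H; apply: infinite_nat.
  have -> : [set: nat] = f @^-1` residue_field ord.
    by apply/esym/seteqP; split=> // n _; exists (r ^+ (2 ^ n)) => //; apply: ord_geX.
  apply: finite_preimage fin => i j _ _ fij; apply: contrapT => /eqP nij.
  apply: H; move: nij; rewrite neq_ltn => /orP[] ij; first by exists i, j.
  by exists j, i.
have : f j (r ^+ (2 ^ j)) by rewrite /f /= subrr; left.
rewrite -fij -(subnK (ltnW ij)) expnD exprM => h.
exists (r ^+ (2 ^ (j - i).-1)); first exact: ord_geX.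
have hs : ord_ge ord 1 (r ^+ (2 ^ (j - i)) - r).
  by apply: frobenius_inj h => //; apply: ord_geX.
by rewrite -exprM -expnSr prednK // subn_gt0.
Qed.

End ResidueSquares.

(** * The valuation of a field E, and the codifferent of an inert extension *)

Section FieldCase.

Variables (K : fieldType) (ord : K -> int) (E : comUnitAlgType K).
Variable bar : {lrmorphism E -> E}.

(* The valuation ord o Nr: it is normalized on [E] exactly when [E] is ramified,
   and twice the normalized valuation when [E] is inert. *)
Definition ordE (x : E) : int := ord (nrK bar x).
Definition ordE_ge (n : int) (x : E) : Prop := ord_ge ord n (nrK bar x).

Hypothesis S : quadratic_setting ord bar.
Hypothesis fieldE : is_field E.

Let vK := setting_val S.

Local Notation iota := (iota_alg E).
Local Notation w := ordE.
Local Notation wge := ordE_ge.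
Local Notation trK := (trK bar).
Local Notation nrK := (nrK bar).

Lemma nrK_neq0 x : x != 0 -> nrK x != 0.
Proof. by rewrite (nrK_eq0 S fieldE). Qed.

Lemma mulE_neq0 (x y : E) : x != 0 -> y != 0 -> x * y != 0.
Proof.
move=> x0 y0; apply/eqP => /(field_mul_eq0 fieldE)[] /eqP.
  by rewrite (negPf x0).
by rewrite (negPf y0).
Qed.

Lemma invE_neq0 (x : E) : x != 0 -> x^-1 != 0.
Proof. by rewrite -!(field_neq0 fieldE) unitrV. Qed.

Lemma barE_neq0 (x : E) : x != 0 -> bar x != 0.
Proof. by rewrite -!(nrK_eq0 S fieldE) (nrK_bar S). Qed.

Lemma iota_eq0 k : (iota k == 0) = (k == 0).
Proof. exact: fmorph_eq0. Qed.

Lemma ordEM x y : x != 0 -> y != 0 -> w (x * y) = w x + w y.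
Proof. by move=> x0 y0; rewrite /w (nrKM S) (ordM vK) // nrK_neq0. Qed.

Lemma ordEV x : x != 0 -> w x^-1 = - w x.
Proof.
by move=> x0; rewrite /w (nrKV S) ?(ordV vK) ?nrK_neq0 //; apply: fieldE.
Qed.

Lemma ordE_bar x : w (bar x) = w x.
Proof. by rewrite /w (nrK_bar S). Qed.

Lemma ordEN x : w (- x) = w x.
Proof. by rewrite /w (nrKN S). Qed.

Lemma ordE_iota k : k != 0 -> w (iota k) = ord k *+ 2.
Proof. by move=> k0; rewrite /w (nrK_iota S) (ord_sqr vK). Qed.

Lemma ordE_one : w 1 = 0.
Proof. by rewrite /w (nrK1 S) (ord_one vK). Qed.

Lemma ordE_geP n x : x != 0 -> wge n x <-> n <= w x.
Proof. by move=> /nrK_neq0 x0; apply: ord_geP. Qed.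

Lemma ordE_ge0 n : wge n 0.
Proof. by left; rewrite (nrK0 S). Qed.

Lemma ordE_geW m n x : n <= m -> wge m x -> wge n x.
Proof. exact: ord_geW. Qed.

Lemma ordE_geM m n x y : wge m x -> wge n y -> wge (m + n) (x * y).
Proof. by rewrite /wge (nrKM S); apply: ord_geM. Qed.

Lemma ordE_ge_bar n x : wge n x -> wge n (bar x).
Proof. by rewrite /wge (nrK_bar S). Qed.

Lemma ordE_geN n x : wge n x -> wge n (- x).
Proof. by rewrite /wge (nrKN S). Qed.

Lemma ordE_ge_iota n k : ord_ge ord n k -> wge (n *+ 2) (iota k).
Proof. by rewrite /wge (nrK_iota S) expr2 mulr2n; move=> h; apply: ord_geM. Qed.

Lemma calO_ordE x : calO ord bar x <-> wge 0 x.
Proof. exact: calO_field S fieldE x. Qed.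

(** Division by the summand of smaller order reduces the ultrametric inequality to 1 + y / x being
    in O, i.e. to O being closed under addition. *)
Lemma ordE_geD n x y : wge n x -> wge n y -> wge n (x + y).
Proof.
wlog xy : x y / y = 0 \/ (x != 0 /\ y != 0 /\ w x <= w y) => [wl|].
  have [->|x0] := eqVneq x 0; first by rewrite add0r.
  have [->|y0] := eqVneq y 0; first by rewrite addr0.
  have [h|/ltW h] := leP (w x) (w y) => hx hy; first by apply: wl => //; right.
  by rewrite addrC; apply: wl => //; right.
case: xy => [->|[x0 [y0 h]]]; first by rewrite addr0.
move=> hx _; have -> : x + y = x * (1 + y / x).
  by rewrite mulrDr mulr1 mulrCA divrr ?mulr1 //; apply: fieldE.
rewrite -[n]addr0; apply: ordE_geM => //; apply/calO_ordE.
apply: calOD S _ _ _ _; first exact: calO1 S.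
have x'0 := invE_neq0 x0.
apply/calO_ordE/ordE_geP; first exact: mulE_neq0.
by rewrite ordEM // ordEV //; lia.
Qed.

Lemma ordE_geB n x y : wge n x -> wge n y -> wge n (x - y).
Proof. by move=> hx hy; apply: ordE_geD => //; apply: ordE_geN. Qed.

Lemma ordED_lt n x y : x != 0 -> w x < n -> wge n y ->
  x + y != 0 /\ w (x + y) = w x.
Proof.
move=> x0 xn hy.
have xy0 : x + y != 0.
  rewrite addr_eq0; apply/eqP => xy.
  have /(ordE_geP _ x0) : wge n x by rewrite xy; apply: ordE_geN.
  lia.
have /(ordE_geP _ xy0) h1 : wge (w x) (x + y).
  by apply: ordE_geD; [apply/ordE_geP | apply: ordE_geW hy; lia].
split=> //; apply/eqP; rewrite eq_le h1 andbT leNgt; apply/negP => h2.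
suff /(ordE_geP _ x0) : wge (w x + 1) x by lia.
have : wge (w x + 1) (x + y - y).
  apply: ordE_geB; last by apply: ordE_geW hy; lia.
  by apply/ordE_geP => //; lia.
by rewrite addrK.
Qed.

Lemma ordE_surj_even (j : int) : exists c, [/\ c != 0, ord c = j & w (iota c) = j *+ 2].
Proof.
have [c c0 cj] := ord_surj vK j; exists c; split=> //.
by rewrite ordE_iota // cj.
Qed.

Section Inert.

Hypothesis even_ordE : forall x, x != 0 -> exists j, w x = j *+ 2.

(* Otherwise 2 lies in p, so the residue field being perfect gives
   O = o + p O, which is impossible as [x |-> Tr (x d)] is bounded on O. *)
Lemma inert_trace_unit :
  exists2 t, calO ord bar t & trK t != 0 /\ ord (trK t) = 0.
Proof.
apply: contrapT => H.
have tr_small t : calO ord bar t -> ord_ge ord 1 (trK t).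
  move=> ht; have [->|t0] := eqVneq (trK t) 0; first by left.
  right; have /(calOP S)[/(ord_geP t0) h _] := ht.
  suff : ord (trK t) <> 0 by lia.
  by move=> h0; apply: H; exists t.
have two_small : ord_ge ord 1 (2 : K).
  by have := tr_small 1 (calO1 S); rewrite -(iota_alg1 E) (trK_iota S).
have [p p0 p1] := ord_surj vK 1.
have [d ud dN] := skew_unit S.
have trd : trK d = 0 by apply: (iota_inj (E := E)); rewrite (trKE S) dN subrr (iota_alg0 E).
have dn0 : nrK d != 0 by rewrite -(nrK_unit S).
(* Take s with s^2 = Nr(x) modulo p. Then Nr(x - s) = s^2 + Nr(x) - s Tr(x) lies in p, because 2 and
   all traces from O do; orders being even, x - s is p times an element of O. Subtracting s does not
   affect Tr(x d), as Tr(d) = 0. *)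
have step x : calO ord bar x -> exists2 y, calO ord bar y & trK (x * d) = p * trK (y * d).
  move=> hx; have /(calOP S)[_ hn] := hx.
  have [s hs sE] := residue_sqrt vK two_small (setting_residue S) hn.
  have small : ord_ge ord 1 (nrK (x - iota s)).
    have -> : nrK (x - iota s) = (s ^+ 2 - nrK x) + nrK x * 2 - s * trK x.
      rewrite (nrKD S) (nrKN S) (nrK_iota S) (barN) (bar_iota).
      have -> : x * - iota s = - (iota s * x) by ring.
      by rewrite (trKN S) (trKZ S); ring.
    apply: (ord_geB vK); last by apply: ord_geMr => //; apply: tr_small.
    by apply: ord_geD => //; apply: ord_geMr.
  exists (iota p^-1 * (x - iota s)).
    have [z0|z0] := eqVneq (x - iota s) 0; first by rewrite z0 mulr0; apply: calO0 S.
    apply/calO_ordE/ordE_geP; first by rewrite mulE_neq0 // iota_eq0 invr_eq0.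
    rewrite ordEM ?iota_eq0 ?invr_eq0 // ordE_iota ?invr_eq0 // (ordV vK) // p1.
    have [j jE] := even_ordE z0.
    have /(ordE_geP _ z0) : wge 1 (x - iota s) := small.
    by lia.
  rewrite -mulrA (trKZ S) mulrA divff // mul1r mulrBl (trKB S) (trKZ S) trd.
  by rewrite mulr0 subr0.
have [c [c0 _ hc]] := scale_calO S d.
have [x0 hx0 mu0] : exists2 x, calO ord bar x & trK (x * d) != 0.
  exists (iota c * d) => //; rewrite -mulrA (trKZ S) mulf_neq0 //.
  have -> : trK (d * d) = - (2 * nrK d).
    apply: (iota_inj (E := E)); rewrite (trKE S) barM dN iota_algN iota_algM (nrKE S) dN.
    by rewrite rmorph_nat; ring.
  by rewrite oppr_eq0 mulf_neq0 //; apply: two_neq0 S.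
have iter n : exists2 x, calO ord bar x & trK (x0 * d) = p ^+ n * trK (x * d).
  elim: n => [|n [x hx xE]]; first by exists x0; rewrite // mul1r.
  have [y hy yE] := step x hx; exists y => //.
  by rewrite xE yE exprSr mulrA.
have cmu x : calO ord bar x -> ord_ge ord 0 (c * trK (x * d)).
  move=> hx; have /(calOP S)[+ _] := calOM S hc hx.
  by rewrite -mulrA (mulrC d) (trKZ S).
have hp (n : nat) : ord_ge ord n%:Z (c * trK (x0 * d)).
  have [x hx ->] := iter n; rewrite mulrCA -[n%:Z]addr0.
  apply: (ord_geM vK); last exact: cmu.
  clear x hx.
  elim: n => [|n IH]; first by rewrite expr0; right; rewrite (ord_one vK).
  rewrite exprS; have -> : n.+1%:Z = 1 + n%:Z by lia.
  by apply: (ord_geM vK) => //; right; rewrite p1.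
have/eqP : c * trK (x0 * d) = 0.
  by apply: (ord_ge_all (ord := ord)) => n; apply: ord_geW (hp `|n|%N); lia.
by rewrite mulf_eq0 (negPf c0) (negPf mu0).
Qed.

(** By evenness some c in K has the order of x, so c t / x lies in O when t is integral with unit
    trace. Tested on it, x gives c Tr(t), which has the order of c. *)
Lemma codifferent_inert x : codifferent ord bar x -> calO ord bar x.
Proof.
move=> hx; have [x0|x0] := eqVneq x 0; first by rewrite x0; apply: calO0 S.
have [t ht [t0 tE]] := inert_trace_unit.
have [j jE] := even_ordE x0.
apply/calO_ordE/ordE_geP => //; rewrite jE.
have [c [c0 cj cw]] := ordE_surj_even j.
have ic0 : iota c != 0 by rewrite iota_eq0.
have x'0 := invE_neq0 x0.
have hy : calO ord bar (iota c * x^-1 * t).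
  apply: calOM S _ _ _ ht.
  by apply/calO_ordE/ordE_geP; rewrite ?mulE_neq0 // ordEM // ordEV // cw jE; lia.
have := hx _ hy; rewrite /Tr -(trKE S) base_ringP.
have -> : x * (iota c * x^-1 * t) = iota c * t.
  by rewrite mulrA mulrCA divrr ?mulr1 //; apply: fieldE.
rewrite (trKZ S) => /ord_geP; rewrite mulf_neq0 // (ordM vK) // tE cj => /(_ isT).
lia.
Qed.

End Inert.

End FieldCase.

(** * Ideals of O and ramification *)

Section Ideals.

Variables (K : fieldType) (ord : K -> int) (E : comUnitAlgType K).
Variable bar : {lrmorphism E -> E}.
Hypothesis S : quadratic_setting ord bar.
Hypothesis fieldE : is_field E.

Let vK := setting_val S.

Local Notation iota := (iota_alg E).
Local Notation w := (ordE ord bar).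
Local Notation wge := (ordE_ge ord bar).
Local Notation trK := (trK bar).
Local Notation nrK := (nrK bar).
Local Notation iota0 := (iota_eq0 E).

Lemma field_not_split : ~ is_split E.
Proof.
case=> f fbij; case: (fbij) => g gK fK.
have f0 x : f x = 0 -> x = 0 by move=> h; apply: (bij_inj fbij); rewrite h rmorph0.
pose x := g (1, 0); pose y := g (0, 1).
have /(field_mul_eq0 fieldE)[] : x * y = 0.
- by apply: f0; rewrite rmorphM /= !fK; congr pair; rewrite /= ?mulr0 ?mul0r.
- by move/(congr1 f); rewrite fK rmorph0 => -[] /eqP; rewrite oner_eq0.
- by move/(congr1 f); rewrite fK rmorph0 => -[] /eqP; rewrite oner_eq0.
Qed.

Lemma calO_unitsP u : calO_units ord bar u <-> u != 0 /\ w u = 0.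
Proof.
split=> [[hu [v hv uv]] | [u0 wu]].
  have u0 : u != 0.
    by apply/eqP => h; move/eqP: uv; rewrite h mul0r eq_sym oner_eq0.
  have v0 : v != 0.
    by apply/eqP => h; move/eqP: uv; rewrite h mulr0 eq_sym oner_eq0.
  move/(calO_ordE S fieldE)/(ordE_geP S fieldE _ u0): hu.
  move/(calO_ordE S fieldE)/(ordE_geP S fieldE _ v0): hv.
  have := ordEM S fieldE u0 v0; rewrite uv (ordE_one S); split=> //; lia.
split; first by apply/(calO_ordE S fieldE)/ordE_geP => //; rewrite wu.
exists u^-1; last by rewrite divrr //; apply: fieldE.
apply/(calO_ordE S fieldE)/ordE_geP => //; first exact: invE_neq0.
by rewrite (ordEV S) // wu oppr0.
Qed.

(** Elements of order 0 are units of O, so a proper ideal only has elements of positive order. This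
    includes the inert case, where positive order means order at least 2. *)
Lemma frakP_ordE P : is_maximal_ideal ord bar P -> P = [set x | wge 1 x].
Proof.
move=> [[PO P0 PD PM] Pprop Pmax].
have one_ge1 : ~ wge 1 1.
  by move/(ordE_geP S fieldE); rewrite (ordE_one S) oner_neq0 => /(_ isT).
have Mid : is_ideal ord bar [set x | wge 1 x].
  split; first by move=> x hx; apply/(calO_ordE S fieldE); apply: ordE_geW hx.
  - exact: ordE_ge0 S 1.
  - by move=> x y; apply: ordE_geD.
  - by move=> x y /(calO_ordE S fieldE) hx hy; rewrite -[1]add0r; apply: (ordE_geM S).
have PMsub : P `<=` [set x | wge 1 x].
  move=> x Px; have /(calO_ordE S fieldE) hx := PO _ Px.
  have [x0|x0] := eqVneq x 0; first by rewrite x0; apply: ordE_ge0 S 1.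
  apply/(ordE_geP S fieldE) => //; move/(ordE_geP S fieldE _ x0): hx => hx.
  suff : w x <> 0 by lia.
  move=> wx; apply: Pprop; apply/seteqP; split=> // y hy.
  have [_ [v hv xv]] : calO_units ord bar x by apply/calO_unitsP.
  by rewrite -[y]mulr1 -xv mulrCA mulrC; apply: PM => //; apply: calOM S _ _ _ _.
case: (Pmax _ Mid PMsub) => [-> //|h].
by case: one_ge1; have := calO1 S; rewrite -h.
Qed.

Lemma pO_ordE : pO ord bar = [set x | wge 2 x].
Proof.
apply/seteqP; split=> x.
  case=> s [hs ->]; rewrite big_seq.
  elim/big_ind: _ => [|y z|t /hs[[k hk <-] /(calO_ordE S fieldE) hO]].
  - exact: ordE_ge0 S 2.
  - exact: ordE_geD.
  rewrite [X in ordE_ge _ _ X](_ : 2 = 1 *+ 2 + 0) //.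
  by apply: (ordE_geM S) => //; apply: (ordE_ge_iota S).
move=> hx; have [c [c0 c1 cw]] := ordE_surj_even S 1.
exists [:: (iota c, iota c^-1 * x)]; split; last first.
  by rewrite big_seq1 /= mulrA -iota_algM divff // (iota_alg1 E) mul1r.
move=> t; rewrite inE => /eqP -> /=; split.
  by exists c => //; right; rewrite c1.
have [->|x0] := eqVneq x 0; first by rewrite mulr0; apply: calO0 S.
apply/(calO_ordE S fieldE)/(ordE_geP S fieldE).
  by rewrite (mulE_neq0 fieldE) // ?iota0 ?invr_eq0.
rewrite (ordEM S) ?iota0 ?invr_eq0 // (ordE_iota S) ?invr_eq0 // (ordV vK) // c1.
by move/(ordE_geP S fieldE _ x0): hx; lia.
Qed.

Lemma ideal_pow_ordE pi n : pi != 0 -> w pi = 1 ->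
  ideal_pow ord bar [set x | wge 1 x] n = [set x | wge n%:Z x].
Proof.
move=> pi0 wpi; elim: n => [|n IH] /=.
  by apply/seteqP; split=> x /(calO_ordE S fieldE).
rewrite IH; apply/seteqP; split=> x.
  case=> s [hs ->]; rewrite big_seq.
  elim/big_ind: _ => [|y z|t /hs[h1 h2]].
  - exact: ordE_ge0 S n.+1%:Z.
  - exact: ordE_geD.
  by have := ordE_geM S h1 h2; apply: ordE_geW; lia.
move=> hx; exists [:: (pi, pi^-1 * x)]; split; last first.
  by rewrite big_seq1 /= mulrA divrr ?mul1r //; apply: fieldE.
move=> t; rewrite inE => /eqP -> /=; split.
  by apply/(ordE_geP S fieldE) => //; rewrite wpi.
have [->|x0] := eqVneq x 0; first by rewrite mulr0; apply: ordE_ge0 S n.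
have pi'0 := invE_neq0 fieldE pi0.
apply/(ordE_geP S fieldE); first exact: mulE_neq0.
rewrite (ordEM S) // (ordEV S) // wpi.
by move/(ordE_geP S fieldE _ x0): hx; lia.
Qed.

(** If no element has order 1, then all of P has order at least 2, so P^2 has order at least 4 and
    misses the prime elements of o, which have order 2. *)
Lemma ramifiedP P : is_frakP ord bar P ->
  ramified ord bar P <-> exists2 x, x != 0 & w x = 1.
Proof.
move=> [_ /(_ field_not_split)/frakP_ordE ->].
split=> [[_ pP2]|[pi pi0 wpi]]; last first.
  by split=> //; rewrite (ideal_pow_ordE _ pi0 wpi) pO_ordE.
apply: contrapT => H.
have even x : x != 0 -> wge 1 x -> wge 2 x.
  move=> x0 /(ordE_geP S fieldE _ x0) h; apply/(ordE_geP S fieldE) => //.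
  suff : w x <> 1 by lia.
  by move=> wx; apply: H; exists x.
have even0 x : wge 1 x -> wge 2 x.
  by have [->|x0] := eqVneq x 0; [move=> _; apply: ordE_ge0 S 2 | apply: even].
have [c [c0 c1 cw]] := ordE_surj_even S 1.
have ic0 : iota c != 0 by rewrite iota0.
have : pO ord bar (iota c) by rewrite pO_ordE; apply/(ordE_geP S fieldE) => //; rewrite cw.
rewrite pP2 => -[s [hs cE]].
suff /(ordE_geP S fieldE _ ic0) : wge 4 (iota c) by rewrite cw.
rewrite cE big_seq; elim/big_ind: _ => [|y z|t /hs[h1 [r [hr ->]]]].
- exact: ordE_ge0 S 4.
- exact: ordE_geD.
rewrite [X in ordE_ge _ _ X](_ : 4 = 2 + 2) //; apply: (ordE_geM S); first exact: even0.
apply: even0; rewrite big_seq; elim/big_ind: _ => [|y z|q /hr[h3 h4]].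
- exact: ordE_ge0 S 1.
- exact: ordE_geD.
rewrite [X in ordE_ge _ _ X](_ : 1 = 1 + 0) //; apply: (ordE_geM S) => //.
exact/(calO_ordE S fieldE).
Qed.

Lemma ordE_even_or_ramified :
  (forall x, x != 0 -> exists j, w x = j *+ 2) \/ exists2 x, x != 0 & w x = 1.
Proof.
have [h|h] := pselect (exists2 x, x != 0 & w x = 1); [by right | left].
move=> x x0; have [q [wE|wE]] := int_parity (w x); first by exists q.
case: h; have [c [c0 cj cw]] := ordE_surj_even S (- q).
exists (iota c * x); first by rewrite (mulE_neq0 fieldE) // iota0.
by rewrite (ordEM S) ?iota0 // cw; lia.
Qed.

End Ideals.

(** * Trace, different and the groups E_0 and E_1 in the ramified case *)

Section Ramified.

Variables (K : fieldType) (ord : K -> int) (E : comUnitAlgType K).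
Variable bar : {lrmorphism E -> E}.
Hypothesis S : quadratic_setting ord bar.
Hypothesis fieldE : is_field E.

Let vK := setting_val S.
Let bK := barK S.

Local Notation iota := (iota_alg E).
Local Notation w := (ordE ord bar).
Local Notation wge := (ordE_ge ord bar).
Local Notation trK := (trK bar).
Local Notation nrK := (nrK bar).
Local Notation iota0 := (iota_eq0 E).

Variable pi : E.
Hypothesis pi0 : pi != 0.
Hypothesis w_pi : w pi = 1.

(* [o + o pi] is the whole of O, so [eta] generates the different. *)
Local Notation eta := (pi - bar pi).

Lemma eta_neq0 : eta != 0.
Proof.
apply/eqP => /eqP; rewrite subr_eq0 => /eqP /esym /(bar_fix S)[k kE].
have k0 : k != 0 by rewrite -iota0 -kE.
by move: w_pi; rewrite kE (ordE_iota S) //; lia.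
Qed.

Let eta_unit : eta \is a GRing.unit := fieldE eta_neq0.

Lemma bar_eta : bar eta = - eta.
Proof. by rewrite barB bK opprB. Qed.

Lemma barV x : x != 0 -> bar x^-1 = (bar x)^-1.
Proof. by move=> x0; rewrite rmorphV //; apply: fieldE. Qed.

(** For x = u + v pi one has x - bar x = v eta; so [trK (x / eta)] is the coordinate v of x along
    [pi] in the K-basis 1, [pi]. *)
Lemma trK_div_eta x : iota (trK (x / eta)) * eta = x - bar x.
Proof.
rewrite (trKE S) barM barV ?eta_neq0 // bar_eta invrN mulrN -mulrBl divrK //.
Qed.

Lemma pi_coords x : exists u, x = iota u + iota (trK (x / eta)) * pi.
Proof.
have [|u uE] := bar_fix S (x := x - iota (trK (x / eta)) * pi).
  rewrite barB barM (bar_iota bar); apply/eqP; rewrite -subr_eq0; apply/eqP.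
  transitivity (iota (trK (x / eta)) * eta - (x - bar x)); first by ring.
  by rewrite trK_div_eta subrr.
by exists u; rewrite -uE subrK.
Qed.

Lemma trK_pi_eta : trK (pi / eta) = 1.
Proof.
apply: (iota_inj (E := E)); apply: (mulIr eta_unit).
by rewrite trK_div_eta (iota_alg1 E) mul1r.
Qed.

(** The order of u is even and that of v pi is odd, so leading terms cannot cancel. *)
Lemma coords_ge n u v : wge n (iota u + iota v * pi) ->
  wge n (iota u) /\ wge n (iota v * pi).
Proof.
have [->|u0] := eqVneq u 0.
  by rewrite (iota_alg0 E) add0r; split=> //; apply: ordE_ge0 S n.
have [->|v0] := eqVneq v 0.
  by rewrite (iota_alg0 E) mul0r addr0; split=> //; apply: ordE_ge0 S n.
have iu0 : iota u != 0 by rewrite iota0.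
have vp0 : iota v * pi != 0 by rewrite (mulE_neq0 fieldE) // iota0.
have wu := ordE_iota S u0.
have wv : w (iota v * pi) = ord v *+ 2 + 1.
  by rewrite (ordEM S) ?iota0 // w_pi (ordE_iota S).
move=> h; have [lt|ge] := ltP (w (iota u)) (w (iota v * pi)).
  have [s0 sE] := ordED_lt S fieldE iu0 lt
     ((ordE_geP S fieldE _ vp0).2 (lexx _)).
  by move/(ordE_geP S fieldE _ s0): h; rewrite sE => h; split; apply/(ordE_geP S fieldE) => //; lia.
have lt : w (iota v * pi) < w (iota u) by lia.
have [s0 sE] := ordED_lt S fieldE vp0 lt ((ordE_geP S fieldE _ iu0).2 (lexx _)).
rewrite addrC in s0 sE.
by move/(ordE_geP S fieldE _ s0): h; rewrite sE => h; split; apply/(ordE_geP S fieldE) => //; lia.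
Qed.

Lemma trK_eta_int x : wge 0 x -> ord_ge ord 0 (trK (x / eta)).
Proof.
have [u] := pi_coords x; set v := trK _ => ->.
move=> /coords_ge[_]; have [->|v0] := eqVneq v 0; first by left.
move/(ordE_geP S fieldE); rewrite (mulE_neq0 fieldE) ?iota0 // => /(_ isT).
rewrite (ordEM S) ?iota0 // w_pi (ordE_iota S) // => h; right; lia.
Qed.

(** After division by an element of K of order j, this is integrality of the trace on eta^-1 O. *)
Lemma trK_ge j x : wge (j *+ 2 - w eta) x -> ord_ge ord j (trK x).
Proof.
move=> hx; have [c [c0 cj cw]] := ordE_surj_even S j.
have -> : x = iota c * ((iota c^-1 * x * eta) / eta).
  by rewrite mulrK // mulrA -iota_algM divff // (iota_alg1 E) mul1r.
rewrite (trKZ S) -[j]addr0; apply: (ord_geM vK); first by right; rewrite cj.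
apply: trK_eta_int; have -> : 0 = - j *+ 2 + (j *+ 2 - w eta) + w eta by lia.
apply: (ordE_geM S); last by apply/(ordE_geP S fieldE); rewrite ?eta_neq0.
apply: (ordE_geM S) => //; apply: (ordE_ge_iota S); right.
by rewrite (ordV vK) // cj.
Qed.

(* The element of trace [k] whose order is the largest possible. *)
Lemma trK_solve k : trK (iota k * (pi / eta)) = k.
Proof. by rewrite (trKZ S) trK_pi_eta mulr1. Qed.

Lemma ordE_solve k : k != 0 ->
  iota k * (pi / eta) != 0 /\ w (iota k * (pi / eta)) = ord k *+ 2 + 1 - w eta.
Proof.
move=> k0; have eta'0 := invE_neq0 fieldE eta_neq0.
have pe0 : pi / eta != 0 by rewrite (mulE_neq0 fieldE).
split; first by rewrite (mulE_neq0 fieldE) // iota0.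
rewrite (ordEM S) ?iota0 // (ordEM S) // (ordEV S) ?eta_neq0 // w_pi.
by rewrite (ordE_iota S) //; lia.
Qed.

(** It is enough to test on 1 and pi: if x eta = u + v pi, then Tr(x) = v and Tr(x pi) = u + v
    Tr(pi), so both coordinates of x eta are integral. *)
Lemma codifferent_ordE : codifferent ord bar = [set x | wge (- w eta) x].
Proof.
have ae0 := eta_neq0.
apply/seteqP; split=> x hx; last first.
  move=> y /(calO_ordE S fieldE) hy; rewrite /Tr -(trKE S); apply/base_ringP.
  by apply: trK_ge; rewrite mul0rn add0r -[- _]addr0; apply: (ordE_geM S).
have tr_int y : calO ord bar y -> ord_ge ord 0 (trK (x * y)).
  by move=> hy; apply/(base_ringP ord E); rewrite (trKE S); apply: hx.
have [u xE] := pi_coords (x * eta).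
set v := trK _ in xE.
have vE : v = trK x by rewrite /v mulrK.
have hv : ord_ge ord 0 v by rewrite vE -[x]mulr1; apply: tr_int; apply: calO1 S.
have pi_int : calO ord bar pi.
  by apply/(calO_ordE S fieldE)/(ordE_geP S fieldE) => //; rewrite w_pi.
have tpi : ord_ge ord 0 (trK pi) by have /(calOP S)[] := pi_int.
have npi : ord_ge ord 0 (nrK pi) by have /(calOP S)[] := pi_int.
have trE : trK (x * pi) = u + v * trK pi.
  apply: (iota_inj (E := E)); apply: (mulIr eta_unit).
  transitivity (x * pi * eta - bar (x * pi * eta)).
    by rewrite -(trK_div_eta (x * pi * eta)) mulrK.
  have -> : x * pi * eta = iota (u + v * trK pi) * pi - iota (v * nrK pi).
    rewrite mulrAC xE iota_algD !iota_algM (trKE S) (nrKE S); ring.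
  by rewrite barB barM !(bar_iota bar); ring.
have hu : ord_ge ord 0 u.
  have -> : u = trK (x * pi) - v * trK pi by rewrite trE addrK.
  by apply: (ord_geB vK); [apply: tr_int | apply: ord_geMr].
have hxe : wge 0 (x * eta).
  rewrite xE; apply: (ordE_geD S fieldE); first exact: (ordE_ge_iota S hu).
  rewrite -[0]addr0; apply: (ordE_geM S); first exact: (ordE_ge_iota S hv).
  exact/(calO_ordE S fieldE).
have := ordE_geM S hxe ((ordE_geP S fieldE (- w eta) (invE_neq0 fieldE ae0)).2 _).
by rewrite mulrK // add0r; apply; rewrite (ordEV S).
Qed.

Lemma different_ordE : different ord bar = [set x | wge (w eta) x].
Proof.
have ae0 := eta_neq0; have ae'0 := invE_neq0 fieldE ae0.
rewrite /different codifferent_ordE; apply/seteqP; split=> x hx.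
  have /hx/(calO_ordE S fieldE) h : wge (- w eta) eta^-1.
    by apply/(ordE_geP S fieldE) => //; rewrite (ordEV S).
  have := ordE_geM S h ((ordE_geP S fieldE (w eta) ae0).2 (lexx _)).
  by rewrite divrK // add0r.
move=> y hy; apply/(calO_ordE S fieldE).
by have := ordE_geM S hx hy; rewrite subrr.
Qed.

Lemma different_exponent P e : is_maximal_ideal ord bar P ->
  different ord bar = ideal_pow ord bar P e -> w eta = e%:Z.
Proof.
move=> /(frakP_ordE S fieldE) ->.
rewrite (ideal_pow_ordE S fieldE e pi0 w_pi) different_ordE => DE.
have /(ordE_geP S fieldE _ eta_neq0) h1 : [set x | wge e%:Z x] eta.
  by rewrite -DE; apply/(ordE_geP S fieldE) => //; rewrite eta_neq0.
have pie0 : pi ^+ e != 0 by rewrite -(field_neq0 fieldE) unitrX //; apply: fieldE.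
have wpie : w (pi ^+ e) = e%:Z.
  elim: (e) => [|n IH]; first by rewrite expr0 (ordE_one S).
  have pin0 : pi ^+ n != 0 by rewrite -(field_neq0 fieldE) unitrX //; apply: fieldE.
  by rewrite exprS (ordEM S) // w_pi IH; lia.
have /(ordE_geP S fieldE _ pie0) h2 : [set x | wge (w eta) x] (pi ^+ e).
  by rewrite DE; apply/(ordE_geP S fieldE) => //; rewrite wpie.
by lia.
Qed.

(** The parity of the order of sg allows a skew z = c eta of the same order, with c in K. Then u =
    bar sg / z is a unit, and bar z = - z gives u / bar u = - bar sg / sg. *)
Lemma reflection_det_calE1 sg j : sg != 0 -> w sg = w eta + j *+ 2 ->
  calE1 ord bar (- (bar sg / sg)).
Proof.
move=> sg0 wsg; have [c [c0 cj cw]] := ordE_surj_even S j.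
have ic0 : iota c != 0 by rewrite iota0.
have ce0 : iota c * eta != 0 by rewrite (mulE_neq0 fieldE) // eta_neq0.
have bsg0 := barE_neq0 S fieldE sg0.
have ce'0 := invE_neq0 fieldE ce0.
have u0 : bar sg / (iota c * eta) != 0 by rewrite (mulE_neq0 fieldE).
exists (bar sg / (iota c * eta)).
  apply/(calO_unitsP S fieldE); split=> //.
  rewrite (ordEM S) // (ordEV S) // (ordE_bar S) wsg (ordEM S) ?eta_neq0 // cw.
  by lia.
set z := iota c * eta in ce0 *.
have bz : bar z = - z by rewrite barM (bar_iota bar) bar_eta mulrN.
have uz : z \is a GRing.unit by apply: fieldE.
have us : sg \is a GRing.unit by apply: fieldE.
clearbody z; rewrite barM bK barV // bz invrN mulrN invrN mulrN; congr (- _).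
by rewrite invrM ?unitrV // invrK mulrA divrK.
Qed.

Lemma calE1_reflection_det x j : calE1 ord bar x ->
  exists sg, [/\ sg != 0, w sg = w eta + j *+ 2 & - (bar sg / sg) = x].
Proof.
move=> [u /(calO_unitsP S fieldE)[u0 wu] <-].
have [c [c0 cj cw]] := ordE_surj_even S j.
have ic0 : iota c != 0 by rewrite iota0.
have bu0 := barE_neq0 S fieldE u0.
have ce0 : iota c * eta != 0 by rewrite (mulE_neq0 fieldE) // eta_neq0.
exists (iota c * eta * bar u); split; first by rewrite (mulE_neq0 fieldE).
  by rewrite (ordEM S) // (ordEM S) ?eta_neq0 // cw (ordE_bar S) wu; lia.
rewrite barM barM bK (bar_iota bar) bar_eta mulrN mulNr mulNr opprK.
set z := iota c * eta.
have uz : z \is a GRing.unit by apply: fieldE.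
have ub : bar u \is a GRing.unit by apply: fieldE.
by clearbody z; rewrite invrM // mulrA mulrAC (mulrC z u) mulrK.
Qed.

Lemma calE1M x y : calE1 ord bar x -> calE1 ord bar y -> calE1 ord bar (x * y).
Proof.
move=> [u /(calO_unitsP S fieldE)[u0 wu] <-] [v /(calO_unitsP S fieldE)[v0 wv] <-].
have bu0 := barE_neq0 S fieldE u0; have bv0 := barE_neq0 S fieldE v0.
exists (u * v).
  apply/(calO_unitsP S fieldE); split; first by rewrite (mulE_neq0 fieldE).
  by rewrite (ordEM S) // wu wv.
by rewrite barM invrM ?(field_neq0 fieldE) //; ring.
Qed.

Lemma calE1V x : calE1 ord bar x -> calE1 ord bar x^-1.
Proof.
move=> [u /(calO_unitsP S fieldE)[u0 wu] <-].
have bu0 := barE_neq0 S fieldE u0.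
exists (bar u).
  by apply/(calO_unitsP S fieldE); rewrite (ordE_bar S).
by rewrite bK invrM ?unitrV ?(field_neq0 fieldE) // invrK.
Qed.

Lemma calE1_one : calE1 ord bar 1.
Proof.
exists 1; last by rewrite bar1 divr1.
by apply/(calO_unitsP S fieldE); rewrite oner_neq0 (ordE_one S).
Qed.

(* Rescaling by [K] does not change [- bar sg / sg], but changes the trace at
   will as soon as it is nonzero, i.e. when [x] is not in [K]. *)
Lemma odd_reflection_det x j k : x != 0 -> w x = j *+ 2 + 1 -> k != 0 ->
  exists sg, [/\ sg != 0, trK sg = k, w sg = ord k *+ 2 - w eta + 1
    & - (bar sg / sg) = x / bar x].
Proof.
move=> x0 wx k0; have ae0 := eta_neq0.
have [u xE] := pi_coords x; set v := trK (x / eta) in xE.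
have v0 : v != 0.
  apply/eqP => v0; move: xE; rewrite v0 (iota_alg0 E) mul0r addr0 => xE.
  have u0 : u != 0 by rewrite -iota0 -xE.
  by move: wx; rewrite xE (ordE_iota S) //; lia.
(* The order of x being odd, it is that of v pi: the even-order term u lies strictly deeper. *)
have wv : w x = ord v *+ 2 + 1.
  have [hu hv] : wge (w x) (iota u) /\ wge (w x) (iota v * pi).
    by apply: coords_ge; rewrite -xE; apply/(ordE_geP S fieldE).
  have vp0 : iota v * pi != 0 by rewrite (mulE_neq0 fieldE) // iota0.
  have wvp : w (iota v * pi) = ord v *+ 2 + 1.
    by rewrite (ordEM S) ?iota0 // w_pi (ordE_iota S).
  move/(ordE_geP S fieldE _ vp0): hv; rewrite wvp => hv.
  suff : ~ (w x + 1 <= ord v *+ 2 + 1) by lia.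
  move=> h; have /(ordE_geP S fieldE _ x0) : wge (w x + 1) x; last by lia.
  rewrite [X in ordE_ge _ _ _ X]xE; apply: (ordE_geD S fieldE); last first.
    by apply/(ordE_geP S fieldE) => //; rewrite wvp.
  have [->|u0] := eqVneq u 0; first by rewrite (iota_alg0 E); apply: ordE_ge0 S _.
  have iu0 : iota u != 0 by rewrite iota0.
  move/(ordE_geP S fieldE _ iu0): hu => hu; apply/(ordE_geP S fieldE) => //.
  by move: hu; rewrite wx (ordE_iota S) //; lia.
have n0 := nrK_neq0 S fieldE ae0.
have bx0 := barE_neq0 S fieldE x0.
have vn0 : v * nrK eta != 0 by rewrite mulf_neq0.
(* Tr(eta bar x) = v Nr(eta), so this factor gives c eta bar x the trace k; the order of v then
   cancels against that of x. *)
pose c := k / (v * nrK eta).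
have c0 : c != 0 by rewrite mulf_neq0 ?invr_eq0.
have ic0 : iota c != 0 by rewrite iota0.
have ce0 : iota c * eta != 0 by rewrite (mulE_neq0 fieldE).
exists (iota c * eta * bar x); split; first by rewrite (mulE_neq0 fieldE).
- rewrite -mulrA (trKZ S).
  have -> : trK (eta * bar x) = v * nrK eta.
    apply: (iota_inj (E := E)); rewrite (trKE S) iota_algM (nrKE S) barM bK bar_eta.
    transitivity (- eta * (x - bar x)); first by ring.
    by rewrite -(trK_div_eta x) -/v; ring.
  by rewrite /c divfK.
- rewrite (ordEM S) // (ordEM S) // (ordE_bar S) wv (ordE_iota S) // /c.
  rewrite (ordM vK) ?invr_eq0 // (ordV vK) // (ordM vK) // -/(w eta).
  by move: (ord k) (ord v) (w eta); clear; lia.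
rewrite barM barM bK (bar_iota bar) bar_eta mulrN mulNr mulNr opprK.
set z := iota c * eta.
have uz : z \is a GRing.unit by apply: fieldE.
have ub : bar x \is a GRing.unit by apply: fieldE.
by clearbody z; rewrite invrM // mulrA mulrAC (mulrC z x) mulrK.
Qed.

End Ramified.

(** * Hermitian forms, reflections and lattices *)

(** Rank one case of Sylvester's identity: one block matrix is factored in two ways into block
    triangular ones, through its two Schur complements. *)
Lemma det_1_mul_col_row (R : comNzRingType) n (C : 'cV[R]_n) (r : 'rV[R]_n) :
  \det (1%:M + C *m r) = 1 + (r *m C) 0 0.
Proof.
have e1 : block_mx 1%:M r (- C) 1%:M =
    block_mx 1%:M 0 (- C) 1%:M *m block_mx (1%:M : 'M_1) r 0 (1%:M + C *m r).
  rewrite mulmx_block !mul1mx !mulmx1 ?mul0mx ?mulmx0 !addr0 mulNmx.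
  by rewrite addrCA addNr addr0.
have e2 : block_mx 1%:M r (- C) 1%:M =
    block_mx (1%:M + r *m C) r 0 1%:M *m block_mx (1%:M : 'M_1) 0 (- C) 1%:M.
  rewrite mulmx_block !mul1mx !mulmx1 ?mul0mx ?mulmx0 !add0r mulmxN.
  by rewrite addrK.
have := congr1 determinant e1; rewrite e2 !det_mulmx !det_lblock !det_ublock !det1.
by rewrite !mul1r !mulr1 det_mx11 !mxE eqxx => <-.
Qed.

Section LinearFunctions.

Variables (R : comNzRingType) (U V : vectType R).

Lemma v2r_lfun (f : 'Hom(U, V)) x : v2r (f x) = v2r x *m f2mx f.
Proof. by rewrite unlock /= r2vK. Qed.

Lemma linfunE (f : U -> V) : linear f -> linfun f =1 f.
Proof.
by move=> lf; exact: (lfunE (HB.pack f (GRing.isLinear.Build R U V _ f lf))).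
Qed.

Lemma row_f2mx (f : 'Hom(U, V)) i : row i (f2mx f) = v2r (f (r2v (delta_mx 0 i))).
Proof. by rewrite v2r_lfun r2vK -rowE. Qed.

Lemma r2v_sum (z : U) : z = \sum_i (v2r z) 0 i *: r2v (delta_mx 0 i).
Proof.
rewrite -[LHS]v2rK [in LHS](row_sum_delta (v2r z)) linear_sum /=.
by apply: eq_bigr => i _; rewrite linearZ.
Qed.

End LinearFunctions.

Lemma f2mx_comp (R : comNzRingType) (U V W : vectType R) (g : 'Hom(V, W)) (f : 'Hom(U, V)) :
  f2mx (g \o f)%VF = f2mx f *m f2mx g.
Proof.
apply/row_matrixP => i.
by rewrite row_f2mx comp_lfunE !v2r_lfun r2vK row_mul -rowE.
Qed.

Lemma f2mx_id (R : comNzRingType) (U : vectType R) : f2mx (\1%VF : 'End(U)) = 1%:M.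
Proof. by apply/row_matrixP => i; rewrite row_f2mx id_lfunE r2vK rowE mulmx1. Qed.

Section Forms.

Variables (K : fieldType) (ord : K -> int) (E : comUnitAlgType K).
Variable bar : {lrmorphism E -> E}.
Hypothesis S : quadratic_setting ord bar.

Local Notation iota := (iota_alg E).
Local Notation trK := (trK bar).
Local Notation nrK := (nrK bar).

Variable V : vectType E.

Record hermitian_form (Phi : V -> V -> E) : Prop := HermitianForm {
  hformDl : forall x y z, Phi (x + y) z = Phi x z + Phi y z;
  hformZl : forall c x y, Phi (c *: x) y = c * Phi x y;
  hformC : forall x y, Phi y x = bar (Phi x y) }.

Variable Phi : V -> V -> E.
Hypothesis hPhi : hermitian_form Phi.

Lemma hformDr x y z : Phi x (y + z) = Phi x y + Phi x z.
Proof. by rewrite hformC // hformDl // barD -!hformC. Qed.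

Lemma hformZr c x y : Phi x (c *: y) = bar c * Phi x y.
Proof. by rewrite hformC // hformZl // barM -hformC. Qed.

Lemma hform0l x : Phi 0 x = 0.
Proof. by rewrite -(scale0r (0 : V)) hformZl // mul0r. Qed.

Lemma hform0r x : Phi x 0 = 0.
Proof. by rewrite hformC // hform0l bar0. Qed.

Lemma hformNl x y : Phi (- x) y = - Phi x y.
Proof. by rewrite -scaleN1r hformZl // mulN1r. Qed.

Lemma hformNr x y : Phi x (- y) = - Phi x y.
Proof. by rewrite hformC // hformNl barN -hformC. Qed.

Lemma hformBl x y z : Phi (x - y) z = Phi x z - Phi y z.
Proof. by rewrite hformDl // hformNl. Qed.

Lemma hformBr x y z : Phi x (y - z) = Phi x y - Phi x z.
Proof. by rewrite hformDr hformNr. Qed.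

Lemma hform_suml (I : Type) (r : seq I) (P : pred I) (F : I -> V) y :
  Phi (\sum_(i <- r | P i) F i) y = \sum_(i <- r | P i) Phi (F i) y.
Proof.
by elim/big_rec2: _ => [|i a b _ <-]; [rewrite hform0l | rewrite hformDl].
Qed.

Lemma hform_sumr (I : Type) (r : seq I) (P : pred I) (F : I -> V) y :
  Phi y (\sum_(i <- r | P i) F i) = \sum_(i <- r | P i) Phi y (F i).
Proof.
by elim/big_rec2: _ => [|i a b _ <-]; [rewrite hform0r | rewrite hformDr].
Qed.

Definition normK (z : V) : K := xget 0 [set k | iota k = Phi z z].

Lemma normKE z : iota (normK z) = Phi z z.
Proof.
have [k kE] : exists k, Phi z z = iota k by apply: bar_fix S _ _; rewrite -hformC.
by have /= := @xgetPex _ 0 [set k | iota k = Phi z z] (ex_intro _ k (esym kE)).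
Qed.

Lemma normKD x y : normK (x + y) = normK x + normK y + trK (Phi x y).
Proof.
apply: (iota_inj (E := E)); rewrite !iota_algD !normKE (trKE S).
by rewrite hformDl // !hformDr (hformC hPhi x y); ring.
Qed.

Lemma normKZ c x : normK (c *: x) = nrK c * normK x.
Proof.
apply: (iota_inj (E := E)); rewrite iota_algM (nrKE S) !normKE.
by rewrite hformZl // hformZr; ring.
Qed.

Section Reflection.

Variables (z : V) (rho : E).
Hypothesis rhoE : rho + bar rho + rho * bar rho * Phi z z = 0.

(** [rhoE] makes this an isometry for r = [rho], with inverse given by [bar rho]. The choice rho = -
    1 / sg gives the reflections of trace Tr(sg) = Phi(z, z); rho = (u - 1) / Phi(z, z) with u of
    norm 1 multiplies z by u. *)
Definition reflection (r : E) (v : V) : V := v + (Phi v z * r) *: z.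

Lemma reflection_linear r : linear (reflection r).
Proof.
move=> c x y; rewrite /reflection hformDl // hformZl // scalerDr scalerA.
by rewrite mulrDl scalerDl mulrA addrACA.
Qed.

Definition reflection_lfun r : 'End(V) := linfun (reflection r).

Lemma reflection_lfunE r v : reflection_lfun r v = reflection r v.
Proof. exact/linfunE/reflection_linear. Qed.

Lemma reflection_cancel v : reflection rho (reflection (bar rho) v) = v.
Proof.
rewrite /reflection hformDl // hformZl // -addrA -scalerDl.
rewrite [X in X *: z](_ : _ = 0) ?scale0r ?addr0 //.
transitivity (Phi v z * (rho + bar rho + rho * bar rho * Phi z z)); first by ring.
by rewrite rhoE mulr0.
Qed.

Lemma reflection_isometry v u :
  Phi (reflection rho v) (reflection rho u) = Phi v u.
Proof.
rewrite /reflection !hformDl // !hformDr !hformZl // !hformZr barM -(hformC hPhi u z).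
transitivity (Phi v u + Phi v z * Phi z u * (rho + bar rho + rho * bar rho * Phi z z)).
  by ring.
by rewrite rhoE mulr0 addr0.
Qed.

Lemma det_reflection r : \det (f2mx (reflection_lfun r)) = 1 + r * Phi z z.
Proof.
have -> : f2mx (reflection_lfun r) =
    1%:M + (\col_i (Phi (r2v (delta_mx 0 i)) z * r)) *m v2r z.
  apply/row_matrixP => i; rewrite row_f2mx reflection_lfunE linearD linearZ /=.
  by rewrite r2vK linearD /= row1 row_mul; congr (_ + _); apply/rowP => j;
    rewrite !mxE big_ord1 !mxE.
rewrite det_1_mul_col_row mxE; congr (1 + _).
rewrite [in RHS](r2v_sum z) hform_suml mulr_sumr; apply: eq_bigr => i _.
by rewrite hformZl // !mxE -r2v_sum; ring.
Qed.

End Reflection.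

End Forms.

(** * Invertibility of injective matrices over E *)

Section Surjectivity.

Variables (K : fieldType) (ord : K -> int) (E : comUnitAlgType K).
Variable bar : {lrmorphism E -> E}.
Hypothesis S : quadratic_setting ord bar.

Local Notation iota := (iota_alg E).
Local Notation trK := (trK bar).
Local Notation nrK := (nrK bar).

Lemma injective_linear_surjective n (h : 'rV[K]_n -> 'rV[K]_n) :
  linear h -> injective h -> forall y, exists x, h x = y.
Proof.
move=> hl hi y.
pose hh : {linear 'rV[K]_n -> 'rV[K]_n} :=
  HB.pack h (GRing.isLinear.Build K _ _ _ h hl).
have A_unit : lin1_mx hh \in unitmx.
  rewrite -row_free_unit; apply: inj_row_free => v.
  rewrite mul_rV_lin1 => hv; apply: hi; rewrite [LHS]hv.
  exact: esym (linear0 hh).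
exists (y *m invmx (lin1_mx hh)).
by have := mul_rV_lin1 hh (y *m invmx (lin1_mx hh)); rewrite mulmxKV // => {2}->.
Qed.

(* E^n is identified with K^(2n) in order to count dimensions over a field. *)
Lemma injective_mulmx_unit n (G : 'M[E]_n) :
  (forall v : 'rV_n, v *m G = 0 -> v = 0) -> G \in unitmx.
Proof.
move=> Ginj; have [d ud dN] := skew_unit S.
have two0 := two_neq0 S.
have n0 : nrK d != 0 by rewrite -(nrK_unit S).
have d2 : iota (nrK d) = - (d * d) by rewrite (nrKE S) dN mulrN.
(* The coordinates of x in the K-basis 1, d, obtained from Tr(d) = 0 and d^2 = - Nr(d). *)
pose re x := trK x / 2; pose im x := - (trK (x * d) / (2 * nrK d)).
have trd : trK d = 0 by apply: (iota_inj (E := E)); rewrite (trKE S) dN subrr (iota_alg0 E).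
have xE x : x = iota (re x) + iota (im x) * d.
  have u2 : iota 2 * iota (nrK d) \is a GRing.unit.
    by rewrite -iota_algM; apply: (iota_neq0 E); rewrite mulf_neq0.
  apply: (mulIr u2); rewrite mulrDl (mulrAC _ d) -!iota_algM.
  have -> : re x * (2 * nrK d) = trK x * nrK d by rewrite /re; field.
  have -> : im x * (2 * nrK d) = - trK (x * d).
    by rewrite /im; field; apply/andP.
  rewrite !iota_algN !iota_algM d2 !(trKE S) barM dN (rmorph_nat (iota_alg E)).
  by ring.
have reE k l : re (iota k + iota l * d) = k.
  rewrite /re (trKD S) (trK_iota S) (trKZ S) trd mulr0 addr0 mulr2n.
  by field.
have imE k l : im (iota k + iota l * d) = l.
  rewrite /im mulrDl (trKD S) (trKZ S) trd mulr0 add0r -mulrA (trKZ S).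
  have -> : trK (d * d) = - (2 * nrK d).
    apply: (iota_inj (E := E)).
    by rewrite (trKE S) barM dN iota_algN iota_algM d2 rmorph_nat; ring.
  by field; apply/andP.
pose psi (u : 'rV[K]_(n + n)) : 'rV[E]_n :=
  \row_j (iota (lsubmx u 0 j) + iota (rsubmx u 0 j) * d).
pose phi (v : 'rV[E]_n) : 'rV[K]_(n + n) :=
  row_mx (\row_j re (v 0 j)) (\row_j im (v 0 j)).
have psiK : cancel psi phi.
  move=> u; rewrite -[RHS]hsubmxK; congr row_mx; apply/rowP => j.
    by rewrite mxE [psi u 0 j]mxE reE.
  by rewrite mxE [psi u 0 j]mxE imE.
have phiK : cancel phi psi.
  move=> v; apply/rowP => j; rewrite mxE row_mxKl row_mxKr !mxE.
  exact/esym/xE.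
have psi_lin k u v : psi (k *: u + v) = iota k *: psi u + psi v.
  by apply/rowP => j; rewrite !mxE !iota_algD !iota_algM; ring.
have phi_lin k u v : phi (iota k *: u + v) = k *: phi u + phi v.
  by apply: (can_inj psiK); rewrite psi_lin !phiK.
pose h u := phi (psi u *m G).
have h_lin : linear h.
  by move=> k u v; rewrite /h psi_lin mulmxDl -scalemxAl phi_lin.
have h_inj : injective h.
  move=> u v /(can_inj phiK) huv; apply: (can_inj psiK).
  by apply/eqP; rewrite -subr_eq0; apply/eqP/Ginj; rewrite mulmxBl huv subrr.
have surj y : exists v : 'rV_n, v *m G = y.
  have [u uE] := injective_linear_surjective h_lin h_inj (phi y).
  by exists (psi u); apply: (can_inj phiK).
pose B := \matrix_i sval (cid (surj (delta_mx 0 i))).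
have BG : B *m G = 1%:M.
  apply/row_matrixP => i; rewrite row_mul rowK row1.
  exact: svalP (cid (surj (delta_mx 0 i))).
by have [] := mulmx1_unit BG.
Qed.

End Surjectivity.

(** * Lattices, their automorphisms and integrality of determinants *)

Section Lattice.

Variables (K : fieldType) (ord : K -> int) (E : comUnitAlgType K).
Variable bar : {lrmorphism E -> E}.
Hypothesis S : quadratic_setting ord bar.

Let vK := setting_val S.
Let bK := barK S.

Local Notation iota := (iota_alg E).
Local Notation trK := (trK bar).
Local Notation nrK := (nrK bar).
Local Notation calO := (calO ord bar).

Variable V : vectType E.
Variable L : set V.
Hypothesis L_lattice : is_lattice ord bar L.

Lemma lattice0 : L 0.
Proof.
have [[n [g ->]] _] := L_lattice; exists (fun=> 0) => [i|]; first exact: calO0 S.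
by rewrite big1 // => i _; rewrite scale0r.
Qed.

Lemma latticeD x y : L x -> L y -> L (x + y).
Proof.
have [[n [g ->]] _] := L_lattice => -[b hb <-] [c hc <-].
exists (fun i => b i + c i) => [i|]; first exact: calOD S _ _ (hb i) (hc i).
by rewrite -big_split; apply: eq_bigr => i _; rewrite scalerDl.
Qed.

Lemma latticeZ c x : calO c -> L x -> L (c *: x).
Proof.
have [[n [g ->]] _] := L_lattice => hc [b hb <-].
exists (fun i => c * b i) => [i|]; first exact: calOM S _ _ hc (hb i).
by rewrite scaler_sumr; apply: eq_bigr => i _; rewrite scalerA.
Qed.

Lemma latticeN x : L x -> L (- x).
Proof.
by move=> hx; rewrite -scaleN1r; apply: latticeZ => //; apply: calON S _ (calO1 S).
Qed.

Lemma latticeB x y : L x -> L y -> L (x - y).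
Proof. by move=> hx hy; apply: latticeD => //; apply: latticeN. Qed.

Lemma lattice_sum (I : Type) (r : seq I) (P : pred I) (F : I -> V) :
  (forall i, P i -> L (F i)) -> L (\sum_(i <- r | P i) F i).
Proof. by move=> h; elim/big_ind: _ => //; [exact: lattice0 | exact: latticeD]. Qed.

Lemma lattice_absorb v : exists c, [/\ c != 0, ord_ge ord 0 c & L (iota c *: v)].
Proof.
have [_ [n [b [bL bspan]]]] := L_lattice; have [k [kE _]] := bspan v.
have [c [c0 cint hc]] := scale_calO_seq S [seq iota (k i) | i <- enum 'I_n].
exists c; split=> //; rewrite kE scaler_sumr; apply: lattice_sum => i _.
by rewrite scalerA; apply: latticeZ => //; apply/hc/map_f; rewrite mem_enum.
Qed.

Lemma lattice_absorb_seq (s : seq V) :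
  exists c, [/\ c != 0, ord_ge ord 0 c & forall v, v \in s -> L (iota c *: v)].
Proof.
elim: s => [|v s [c [c0 cint hc]]].
  by exists 1; split=> //; [exact: oner_neq0 | right; rewrite (ord_one vK)].
have [b [b0 bint hb]] := lattice_absorb v.
exists (b * c); split; rewrite ?mulf_neq0 //; first exact: ord_geMr.
move=> x; rewrite inE => /orP[/eqP ->|/hc hx].
  by rewrite iota_algM mulrC -scalerA; apply: latticeZ => //; apply: calO_iota S _ _.
by rewrite iota_algM -scalerA; apply: latticeZ => //; apply: calO_iota S _ _.
Qed.

Lemma coord_bounded : exists2 c, c != 0 &
  forall x j, L x -> calO (iota c * (v2r x) 0 j).
Proof.
have [[n [g LE]] _] := L_lattice.
have [c [c0 _ hc]] :=
  scale_calO_seq S [seq (v2r (g i)) 0 j | i <- enum 'I_n, j <- enum 'I_(dim V)].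
exists c => // x j; rewrite LE => -[b hb <-].
rewrite linear_sum summxE mulr_sumr; apply: calO_sum S _ _ _ _ _ => i _.
rewrite linearZ mxE mulrCA; apply: calOM S _ _ (hb i) _.
by apply/hc/allpairs_f; rewrite mem_enum.
Qed.

Variable Phi : V -> V -> E.
Hypothesis hPhi : hermitian_form bar Phi.
Hypothesis Phi_nondeg : nondegenerate_form Phi.

Lemma form_bounded : exists2 c, c != 0 &
  forall x y, L x -> L y -> calO (iota c * Phi x y).
Proof.
have [[n [g LE]] _] := L_lattice.
have [c [c0 _ hc]] :=
  scale_calO_seq S [seq Phi (g i) (g j) | i <- enum 'I_n, j <- enum 'I_n].
exists c => // x y; rewrite LE => -[a ha <-] [b hb <-].
rewrite (hform_suml hPhi) mulr_sumr; apply: calO_sum S _ _ _ _ _ => i _.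
rewrite (hform_sumr hPhi) mulr_sumr; apply: calO_sum S _ _ _ _ _ => j _.
rewrite (hformZl hPhi) (hformZr hPhi) !(mulrCA (iota c)).
apply: calOM S _ _ (ha i) _; apply: calOM S _ _ (calO_bar S (hb j)) _.
by apply/hc/allpairs_f; rewrite mem_enum.
Qed.

Lemma lattice_nondeg x : (forall y, L y -> Phi x y = 0) -> x = 0.
Proof.
move=> h; apply: Phi_nondeg => w; have [c [c0 _ hc]] := lattice_absorb w.
apply: (mulrI (iota_neq0 E c0)).
by rewrite mulr0 -[iota c](bar_iota bar) -(hformZr hPhi) h.
Qed.

Lemma lattice_aut_comp f g : lattice_aut Phi L f -> lattice_aut Phi L g ->
  lattice_aut Phi L (f \o g)%VF.
Proof.
move=> [[fbij fiso] fL] [[gbij giso] gL]; split; first split.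
- apply: (eq_bij (bij_comp fbij gbij)) => x.
  by rewrite comp_lfunE.
- by move=> x y; rewrite !comp_lfunE fiso giso.
rewrite -[RHS]fL -[in RHS]gL image_comp; apply: eq_imagel => x _.
by rewrite comp_lfunE.
Qed.

Lemma calE_one : calE Phi L 1.
Proof.
exists \1%VF; last by rewrite f2mx_id det1.
have idE x : (\1%VF : 'End(V)) x = x by exact: id_lfunE.
split; first split.
- by exists id => x; rewrite idE.
- by move=> x y; rewrite !idE.
by rewrite (eq_imagel (f' := id)) ?image_id // => x _.
Qed.

Lemma calEM x y : calE Phi L x -> calE Phi L y -> calE Phi L (x * y).
Proof.
move=> [f hf <-] [g hg <-]; exists (g \o f)%VF; first exact: lattice_aut_comp.
by rewrite f2mx_comp det_mulmx.
Qed.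

(** Take determinants in M G (bar M)^T = G. Nondegeneracy makes v |-> v G injective, hence G
    invertible even if E has zero divisors, and det G cancels. *)
Lemma isometry_det_norm (f : 'End(V)) :
  (forall x y, Phi (f x) (f y) = Phi x y) -> \det (f2mx f) * bar (\det (f2mx f)) = 1.
Proof.
move=> fiso; set M := f2mx f.
pose G := \matrix_(i, j) Phi (r2v (delta_mx 0 i)) (r2v (delta_mx 0 j)) : 'M[E]_(dim V).
have GE x y : Phi x y = (v2r x *m G *m (map_mx bar (v2r y))^T) 0 0.
  rewrite mxE [in LHS](r2v_sum y) (hform_sumr hPhi); apply: eq_bigr => j _.
  rewrite (hformZr hPhi) !mxE mulrC; congr (_ * _).
  rewrite [in LHS](r2v_sum x) (hform_suml hPhi); apply: eq_bigr => i _.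
  by rewrite (hformZl hPhi) !mxE.
have Gunit : G \in unitmx.
  apply: (injective_mulmx_unit S) => v vG; apply: (can_inj r2vK).
  rewrite linear0; apply: Phi_nondeg => y.
  by rewrite GE r2vK vG mul0mx mxE.
have MG : M *m G *m (map_mx bar M)^T = G.
  apply/matrixP => i j; have := fiso (r2v (delta_mx 0 i)) (r2v (delta_mx 0 j)).
  rewrite GE !v2r_lfun !r2vK -/M -!rowE map_row tr_row => h.
  transitivity (Phi (r2v (delta_mx 0 i)) (r2v (delta_mx 0 j))); last by rewrite mxE.
  by rewrite -h -row_mul [LHS]mxE [RHS]mxE; apply: eq_bigr => k _; rewrite [row _ _ _ _]mxE [col _ _ _ _]mxE.
have := congr1 determinant MG; rewrite !det_mulmx det_tr det_map_mx mulrAC => h.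
by apply: (mulIr (x := \det G)); rewrite ?mul1r // -unitmxE.
Qed.

(** In the coordinates of V an automorphism of L need not have an integral matrix, but its
    denominators are bounded uniformly over Aut(L), as L is squeezed between multiples of the
    standard lattice. So one constant k makes k times every determinant integral; applied to all
    powers of u, this bounds their traces, and [bounded_powers_calO] concludes. *)
Lemma calE_sub_calE0 : calE Phi L `<=` calE0 ord bar.
Proof.
move=> u uE; have u1 : u * bar u = 1.
  by case: uE => f [[_ fiso] _] <-; apply: isometry_det_norm.
split=> //; apply: (norm1_calO_units S u1).
have [b b0 hb] := coord_bounded.
have [c [c0 _ hc]] := lattice_absorb_seq [seq r2v (delta_mx 0 j) | j <- enum 'I_(dim V)].
have bounded x : calE Phi L x -> calO (iota ((b * c) ^+ dim V) * x).
  move=> [f [_ fL] <-]; rewrite iota_algX -detZ.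
  rewrite /determinant; apply: calO_sum S _ _ _ _ _ => s _.
  apply: calOM S _ _ _ _.
    by case: (odd_perm s); [apply: calON S _ _|]; apply: calO1 S.
  elim/big_ind: _ => [|y z|i _]; [exact: calO1 S | exact: calOM S y z |].
  have -> : (iota (b * c) *: f2mx f) i (s i) =
      iota b * (v2r (f (iota c *: r2v (delta_mx 0 i)))) 0 (s i).
    have vE : v2r (iota c *: r2v (delta_mx 0 i)) = iota c *: delta_mx 0 i.
      by rewrite linearZ /= r2vK.
    by rewrite v2r_lfun vE -scalemxAl -rowE !mxE iota_algM mulrA.
  apply: hb; rewrite -fL; exists (iota c *: r2v (delta_mx 0 i)) => //.
  by apply/hc/map_f; rewrite mem_enum.
have k0 : (b * c) ^+ dim V != 0 by rewrite expf_neq0 // mulf_neq0.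
set k := _ ^+ _ in k0 bounded.
apply: (bounded_powers_calO S (M := - ord k) u1) => n.
have un : calE Phi L (u ^+ n).
  elim: n => [|n IH]; first by rewrite expr0; apply: calE_one.
  by rewrite exprS; apply: calEM.
have /(calOP S)[+ _] := bounded _ un; rewrite (trKZ S) => h.
have -> : trK (u ^+ n) = k^-1 * (k * trK (u ^+ n)) by rewrite mulKf.
rewrite -[- ord k]addr0; apply: (ord_geM vK) => //.
by right; rewrite (ordV vK).
Qed.

Lemma reflection_aut z rho : L z ->
  rho + bar rho + rho * bar rho * Phi z z = 0 ->
  (forall y, L y -> calO (Phi y z * rho)) ->
  (forall y, L y -> calO (Phi y z * bar rho)) ->
  lattice_aut Phi L (reflection_lfun Phi z rho).
Proof.
move=> zL rhoE h1 h2.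
have rhoE' : bar rho + bar (bar rho) + bar rho * bar (bar rho) * Phi z z = 0.
  by rewrite bK -[RHS]rhoE; ring.
have K1 v := reflection_cancel hPhi rhoE v.
have K2 v : reflection Phi z (bar rho) (reflection Phi z rho v) = v.
  by have := reflection_cancel hPhi rhoE' v; rewrite bK.
have fE := reflection_lfunE hPhi z rho.
have refl_L r : (forall y, L y -> calO (Phi y z * r)) ->
    forall y, L y -> L (reflection Phi z r y).
  by move=> h y hy; apply: latticeD => //; apply: latticeZ => //; apply: h.
split; first split.
- by exists (reflection Phi z (bar rho)) => v; rewrite fE ?K1 ?K2.
- by move=> x y; rewrite !fE; exact: (reflection_isometry hPhi rhoE).
apply/seteqP; split=> [_ [x hx <-]|x hx]; first by rewrite fE; apply: refl_L.
by exists (reflection Phi z (bar rho) x); [apply: refl_L | rewrite fE K1].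
Qed.

(* The reflection with [rho = - 1 / sg]. *)
Lemma reflection_trace_aut z sg : L z -> sg \is a GRing.unit ->
  Phi z z = sg + bar sg ->
  (forall y, L y -> calO (Phi y z / sg)) ->
  (forall y, L y -> calO (Phi y z / bar sg)) ->
  exists f, [/\ lattice_aut Phi L f, forall v, f v = v - (Phi v z / sg) *: z
    & \det (f2mx f) = - (bar sg / sg)].
Proof.
move=> zL usg zz h1 h2; have ub : bar sg \is a GRing.unit by rewrite (bar_unit S).
have bE : bar (- sg^-1) = - (bar sg)^-1 by rewrite barN rmorphV.
have sE : sg^-1 * sg = 1 by rewrite mulVr.
have sE' : (bar sg)^-1 * bar sg = 1 by rewrite mulVr.
have rhoE : - sg^-1 + bar (- sg^-1) + - sg^-1 * bar (- sg^-1) * Phi z z = 0.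
  rewrite bE zz.
  transitivity (sg^-1 * ((bar sg)^-1 * bar sg - 1) + (bar sg)^-1 * (sg^-1 * sg - 1)).
    by ring.
  by rewrite sE sE' !subrr !mulr0 addr0.
exists (reflection_lfun Phi z (- sg^-1)); split.
- apply: reflection_aut => // y hy; first by rewrite mulrN; apply: calON S _ (h1 y hy).
  by rewrite bE mulrN; apply: calON S _ (h2 y hy).
- by move=> v; rewrite (reflection_lfunE hPhi) /reflection mulrN scaleNr.
rewrite (det_reflection hPhi) zz mulNr mulrDr sE opprD addrA subrr add0r.
by rewrite mulrC.
Qed.

End Lattice.

(** * Determinants obtained from reflections *)

Lemma bounded_int_min (T : Type) (P : T -> Prop) (f : T -> int) (b : int) :
  (forall x, P x -> b <= f x) -> (exists x, P x) ->
  exists2 x, P x & forall y, P y -> f x <= f y.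
Proof.
move=> fb [x0 Px0]; pose Q n := `[< exists2 x, P x & f x = b + n%:Z >].
have Qex : exists n, Q n.
  exists `|f x0 - b|%N; apply/asboolP; exists x0 => //.
  by have := fb _ Px0; lia.
case: (ex_minnP Qex) => n /asboolP[x Px fx] nmin; exists x => // y Py.
have := nmin `|f y - b|%N; rewrite fx => h.
have {}h : (n <= `|f y - b|)%N.
  by apply: h; apply/asboolP; exists y => //; have := fb _ Py; lia.
by have := fb _ Py; lia.
Qed.

Section LargeDeterminants.

Variables (K : fieldType) (ord : K -> int) (E : comUnitAlgType K).
Variable bar : {lrmorphism E -> E}.
Hypothesis S : quadratic_setting ord bar.

Let vK := setting_val S.

Local Notation iota := (iota_alg E).
Local Notation w := (ordE ord bar).
Local Notation wge := (ordE_ge ord bar).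
Local Notation trK := (trK bar).
Local Notation nrK := (nrK bar).
Local Notation calO := (calO ord bar).

Variables (V : vectType E) (L : set V) (Phi : V -> V -> E).
Hypothesis L_lattice : is_lattice ord bar L.
Hypothesis hPhi : hermitian_form bar Phi.
Hypothesis Phi_nondeg : nondegenerate_form Phi.

Local Notation normK := (normK Phi).

Lemma normK_bounded : exists b : int, forall z, L z -> normK z != 0 -> b <= ord (normK z).
Proof.
have [c c0 hc] := form_bounded S L_lattice hPhi.
exists (- ord c) => z zL z0; have := hc z z zL zL.
rewrite -(normKE S hPhi) -iota_algM => /(calO_iotaP S)/ord_geP.
by rewrite mulf_neq0 // (ordM vK) // => /(_ isT); lia.
Qed.

(** If all norms on L vanished, polarization would give Tr Phi(x, y) = 0. Replacing x by a multiple
    of d x, with d skew, then kills Phi(x, y) itself, since 2 d is invertible. *)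
Lemma normK_neq0 : (0 < dim V)%N -> exists2 z, L z & normK z != 0.
Proof.
move=> V0; apply: contrapT => H.
have n0 z : L z -> normK z = 0.
  by move=> zL; apply/eqP; apply: contraT => z0; case: H; exists z.
have tr0 x y : L x -> L y -> trK (Phi x y) = 0.
  move=> xL yL; have := normKD S hPhi x y; rewrite !n0 ?add0r //.
  exact: (latticeD S L_lattice).
have [d ud dN] := skew_unit S.
have [c [c0 _ hc]] := scale_calO S d.
have Phi0 x y : L x -> L y -> Phi x y = 0.
  move=> xL yL; set g := Phi x y.
  have bg : bar g = - g.
    by apply/eqP; rewrite -addr_eq0 addrC -(trKE S) tr0 // iota_alg0.
  have := tr0 _ _ (latticeZ S L_lattice hc xL) yL.
  rewrite (hformZl hPhi) -/g => /(congr1 iota).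
  rewrite (trKE S) iota_alg0 !barM (bar_iota bar) dN bg => h.
  have u : iota (c * 2) * d \is a GRing.unit.
    by rewrite unitrM ud iota_neq0 // mulf_neq0 //; apply: two_neq0 S.
  apply: (mulrI u); rewrite mulr0 -[RHS]h iota_algM (rmorph_nat (iota_alg E)); ring.
have v0 x : L x -> x = 0.
  move=> xL; apply: (lattice_nondeg S L_lattice hPhi Phi_nondeg) => y yL.
  exact: Phi0.
have [i] : exists i : 'I_(dim V), True by exists (Ordinal V0).
have [b [b0 _ hb]] := lattice_absorb S L_lattice (r2v (delta_mx 0 i)).
have := v0 _ hb; rewrite -linearZ => /(congr1 v2r); rewrite r2vK linear0.
move/rowP/(_ i); rewrite !mxE !eqxx mulr1 => ib0 _.
by move: (iota_neq0 E b0); rewrite ib0 unitr0.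
Qed.

Lemma normK_min : (0 < dim V)%N -> exists z, [/\ L z, normK z != 0 &
  forall y, L y -> ord_ge ord (ord (normK z)) (normK y)].
Proof.
move=> V0; have [b hb] := normK_bounded.
have [z zL z0] := normK_neq0 V0.
have [|y [yL y0] ymin] := @bounded_int_min _ (fun z => L z /\ normK z != 0)
  (fun z => ord (normK z)) b (fun z h => hb z h.1 h.2).
  by exists z.
exists y; split=> // x xL; have [->|x0] := eqVneq (normK x) 0; first by left.
by right; apply: ymin.
Qed.

Lemma calE0_sub_calE_unramified : (0 < dim V)%N ->
  codifferent ord bar `<=` calO -> calE0 ord bar `<=` calE Phi L.
Proof.
move=> V0 codiff u [[uO _] u1]; have [z [zL q0 zmin]] := normK_min V0.
set q := normK z in q0 zmin; have qE : iota q = Phi z z := normKE S hPhi z.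
have uq := iota_neq0 E q0.
(* The trace of c Phi(y, z) is a combination of norms by polarization, so minimality of q puts
   Phi(y, z) / q in the codifferent. *)
have Phi_int y : L y -> calO (Phi y z / iota q).
  move=> yL; apply: codiff => c hc; rewrite /Tr -(trKE S); apply/base_ringP.
  have -> : Phi y z / iota q * c = iota q^-1 * Phi (c *: y) z.
    by rewrite (hformZl hPhi) -(fmorphV (iota_alg E)); ring.
  have cyL : L (c *: y) := latticeZ S L_lattice hc yL.
  rewrite (trKZ S) -(subrr (ord q)) addrC; apply: (ord_geM vK).
    by right; rewrite (ordV vK).
  have -> : trK (Phi (c *: y) z) = normK (c *: y + z) - normK (c *: y) - normK z.
    by rewrite (normKD S hPhi); ring.
  apply: (ord_geB vK); last by apply: zmin.
  by apply: (ord_geB vK); apply: zmin => //; apply: (latticeD S L_lattice).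
pose rho := (u - 1) / iota q.
have qq : (iota q)^-1 * iota q = 1 by rewrite mulVr.
have bq : bar (iota q)^-1 = (iota q)^-1 by rewrite bar_inv // bar_iota.
have brho : bar rho = (bar u - 1) / iota q by rewrite barM barB bar1 bq.
have rhoE : rho + bar rho + rho * bar rho * Phi z z = 0.
  rewrite brho /rho -qE.
  transitivity ((u - 1 + (bar u - 1) + (u - 1) * (bar u - 1) * ((iota q)^-1 * iota q))
     * (iota q)^-1); first by ring.
  rewrite qq mulr1; transitivity ((u * bar u - 1) / iota q); first by ring.
  by rewrite u1 subrr mul0r.
have h v : calO v -> forall y, L y -> calO (Phi y z * ((v - 1) / iota q)).
  move=> hv y yL; rewrite mulrCA; apply: (calOM S); last exact: Phi_int.
  by apply: (calOD S) => //; apply: (calON S); apply: (calO1 S).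
exists (reflection_lfun Phi z rho).
  apply: (reflection_aut S L_lattice hPhi) => //; first exact: h.
  by rewrite brho; apply: h; apply: (calO_bar S).
by rewrite (det_reflection hPhi) -qE /rho -mulrA qq mulr1 addrC subrK.
Qed.

Section Ramified.

Hypothesis fieldE : is_field E.
Variable pi : E.
Hypothesis pi0 : pi != 0.
Hypothesis w_pi : w pi = 1.

Local Notation eta := (pi - bar pi).

Lemma reflection_ordE z sg : L z -> sg != 0 -> trK sg = normK z ->
  (forall y, L y -> wge (w sg) (Phi y z)) ->
  exists f, [/\ lattice_aut Phi L f, forall v, f v = v - (Phi v z / sg) *: z
    & \det (f2mx f) = - (bar sg / sg)].
Proof.
move=> zL sg0 sgE hz; apply: (reflection_trace_aut S L_lattice hPhi) => //.
- exact: fieldE.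
- by rewrite -(normKE S hPhi) -sgE (trKE S).
- move=> y yL; apply/(calO_ordE S fieldE); rewrite -(subrr (w sg)).
  apply: (ordE_geM S); first exact: hz.
  by apply/(ordE_geP S fieldE); rewrite ?invE_neq0 // (ordEV S).
move=> y yL; apply/(calO_ordE S fieldE); rewrite -(subrr (w sg)).
have b0 := barE_neq0 S fieldE sg0.
apply: (ordE_geM S); first exact: hz.
by apply/(ordE_geP S fieldE); rewrite ?invE_neq0 // (ordEV S) // (ordE_bar S).
Qed.

Lemma calE0_sub_calE_ramified z : L z -> normK z != 0 ->
  (forall y, L y -> wge (ord (normK z) *+ 2 - w eta + 1) (Phi y z)) ->
  calE0 ord bar `<=` calE Phi L.
Proof.
move=> zL q0 hz.
have odd x j : x != 0 -> w x = j *+ 2 + 1 -> calE Phi L (x / bar x).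
  move=> x0 wx; have [sg [sg0 sgt wsg <-]] := odd_reflection_det S fieldE pi0 w_pi x0 wx q0.
  have [|f [fL _ fdet]] := reflection_ordE zL sg0 sgt; first by rewrite wsg.
  by exists f.
move=> u [_ u1]; have [x ux ->] := hilbert90 S fieldE u1.
have x0 : x != 0 by rewrite -(field_neq0 fieldE).
have [j [wE|wE]] := int_parity (w x); last by apply: (odd x j).
have xpi0 : x * pi != 0 by rewrite (mulE_neq0 fieldE).
have pi'0 := invE_neq0 fieldE pi0.
(* An x of even order is the product of x pi and pi^-1, both of odd order, so u is a product of two
   reflection determinants. *)
have -> : x / bar x = (x * pi / bar (x * pi)) * (pi^-1 / bar pi^-1).
  have upi : pi \is a GRing.unit := fieldE pi0.
  have ubpi : bar pi \is a GRing.unit by rewrite (bar_unit S).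
  have ubx : bar x \is a GRing.unit by rewrite (bar_unit S).
  transitivity (x / bar x * (pi * pi^-1) * ((bar pi)^-1 * bar pi)).
    by rewrite divrr // mulVr // !mulr1.
  by rewrite bar_inv // invrK barM invrM //; ring.
apply: calEM.
  by apply: (odd _ j) => //; rewrite (ordEM S) // w_pi; lia.
by apply: (odd _ (-1)) => //; rewrite (ordEV S) // w_pi; lia.
Qed.

End Ramified.

End LargeDeterminants.

(** * Hyperbolic planes and hyperbolic families *)

Section Hyperbolic.

Variables (K : fieldType) (ord : K -> int) (E : comUnitAlgType K).
Variable bar : {lrmorphism E -> E}.
Hypothesis S : quadratic_setting ord bar.
Hypothesis fieldE : is_field E.

Let vK := setting_val S.
Let bK := barK S.

Local Notation iota := (iota_alg E).
Local Notation w := (ordE ord bar).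
Local Notation wge := (ordE_ge ord bar).
Local Notation trK := (trK bar).
Local Notation nrK := (nrK bar).
Local Notation calO := (calO ord bar).

Variable pi : E.
Hypothesis pi0 : pi != 0.
Hypothesis w_pi : w pi = 1.

Local Notation eta := (pi - bar pi).

Lemma unit_pi : pi \is a GRing.unit.
Proof. exact: fieldE. Qed.

Lemma pi_expz_unit s : pi ^ s \is a GRing.unit.
Proof. by rewrite unitrXz // unit_pi. Qed.

Lemma pi_expz_neq0 s : pi ^ s != 0.
Proof. by rewrite -(field_neq0 fieldE) pi_expz_unit. Qed.

Lemma ordE_pi_expz s : w (pi ^ s) = s.
Proof.
have nat_case (n : nat) : w (pi ^+ n) = n.
  elim: n => [|n IH]; first by rewrite expr0 (ordE_one S).
  have h : pi ^+ n != 0 by rewrite exprnP pi_expz_neq0.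
  by rewrite exprS (ordEM S) // w_pi IH; lia.
case: s => n; first by rewrite -exprnP nat_case.
have h : pi ^+ n.+1 != 0 by rewrite exprnP pi_expz_neq0.
by rewrite NegzE -exprnN (ordEV S) // nat_case.
Qed.

Lemma bar_pi_expz s : bar (pi ^ s) = bar pi ^ s.
Proof.
case: s => n; first exact: rmorphXn.
rewrite NegzE -!exprnN (bar_inv bar); first by congr (_^-1); apply: rmorphXn.
by rewrite unitrX // unit_pi.
Qed.

Lemma ordE_eta_ge0 : 0 <= w eta.
Proof.
apply/(ordE_geP S fieldE); first exact: (eta_neq0 S pi0 w_pi).
have h : wge 1 pi by apply/(ordE_geP S fieldE); rewrite ?w_pi.
apply: (@ordE_geW _ _ _ _ 1) => //; apply: (ordE_geB S fieldE) => //.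
exact: ordE_ge_bar.
Qed.

Variable V : vectType E.
Variable Phi : V -> V -> E.
Hypothesis hPhi : hermitian_form bar Phi.
Local Notation normK := (normK Phi).

(** With s = w(Phi x y), the traces of the multiples of Phi x y fill p^k for k the integer part of
    (s + w eta) / 2. By polarization they are combinations of norms, whose orders are at least (s +
    w eta) / 2; hence s + w eta is even. The same bound on norms makes the quadratic equation for an
    isotropic vector near x solvable. *)
Lemma hyperbolic_plane (M : set V) x y :
  (forall u v, M u -> M v -> M (u + v)) ->
  (forall c v, calO c -> M v -> M (c *: v)) ->
  M x -> M y -> Phi x y != 0 ->
  (forall u v, M u -> M v -> wge (w (Phi x y)) (Phi u v)) ->
  (forall z, M z -> normK z != 0 ->
     w (Phi x y) + w eta <= ord (normK z) *+ 2) ->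
  exists s e f, [/\ M e, M f & s = w (Phi x y)] /\
    [/\ exists t, s = w eta + t *+ 2, Phi e e = 0, Phi f f = 0
      & Phi e f = pi ^ s].
Proof.
move=> MD MZ Mx My g0 gmin star; set g := Phi x y in g0 gmin star *.
have ae0 := eta_neq0 S pi0 w_pi; have e_ge0 := ordE_eta_ge0.
have ug : g \is a GRing.unit := fieldE g0.
have g'0 := invE_neq0 fieldE g0.
have solve c : c != 0 ->
    [/\ iota c * (pi / eta) / g != 0,
       w (iota c * (pi / eta) / g) = ord c *+ 2 + 1 - w eta - w g
     & trK (iota c * (pi / eta) / g * g) = c].
  move=> c0; have [h1 h2] := ordE_solve S fieldE pi0 w_pi c0.
  split; first by rewrite (mulE_neq0 fieldE).
    by rewrite (ordEM S) // (ordEV S) // h2.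
  by rewrite divrK // (trK_solve S fieldE pi0 w_pi).
(* In the odd case mu is a unit with Tr(mu g) = c of order w eta + j, whereas polarization writes c
   through norms of order at least w eta + j + 1. *)
have [t tE] : exists t, w g = w eta + t *+ 2.
  have [j [jE|jE]] := int_parity (w g - w eta); first by exists j; lia.
  have [c [c0 cj _]] := ordE_surj_even S (w eta + j).
  have [mu0 wmu trmu] := solve c c0; set mu := _ / g in mu0 wmu trmu.
  have wmu0 : w mu = 0 by rewrite wmu cj; move: jE; clear; lia.
  have mu_int : calO mu by apply/(calO_ordE S fieldE)/(ordE_geP S fieldE); rewrite ?wmu0.
  have Mz : M (mu *: x + y) by apply: MD => //; apply: MZ.
  have small z : M z -> ord_ge ord (ord c + 1) (normK z).
    move=> zM; have [->|q0] := eqVneq (normK z) 0; first by left.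
    by right; move: (star _ zM q0) jE cj; clear; lia.
  have nmu : ord_ge ord 0 (nrK mu) by have /(calOP S)[] := mu_int.
  have cE : c = normK (mu *: x + y) - nrK mu * normK x - normK y.
    rewrite (normKD S hPhi) (normKZ S hPhi) (hformZl hPhi) -/g trmu; ring.
  have : ord_ge ord (ord c + 1) c.
    rewrite [X in ord_ge _ _ X]cE; apply: (ord_geB vK); last exact: small.
    by apply: (ord_geB vK); [apply: small | apply: ord_geMr => //; apply: small].
  by move/(ord_geP c0); lia.
have [c [c0 cn _]] := ordE_surj_even S (w eta + t).
have norm_ge z : M z -> ord_ge ord (ord c) (normK z).
  move=> zM; have [->|q0] := eqVneq (normK z) 0; first by left.
  by right; move: (star _ zM q0) tE cn; clear; lia.
have norm_div z : M z -> ord_ge ord 0 (normK z / c).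
  move=> zM; rewrite -(subrr (ord c)); apply: (ord_geM vK); first exact: norm_ge.
  by right; rewrite (ordV vK).
(* Here Tr(la g) = c and la has order 1. The norm of x + r bar(la) y is c times a quadratic
   polynomial in r with integral constant term, linear coefficient 1 and leading coefficient in
   p. *)
have [la0 wla trla] := solve c c0; set la := _ / g in la0 wla trla.
have {}wla : w la = 1 by rewrite wla cn tE; clear; lia.
have c_max : ord_ge ord 1 (nrK la * (normK y / c)).
  rewrite -[1]addr0; apply: (ord_geM vK); last exact: norm_div.
  by apply/ord_geP; rewrite ?(nrK_neq0 S) // -/(w la) wla.
have [r r_int rE] := quadratic_hensel vK (setting_complete S) (norm_div _ Mx) c_max.
have la_int : calO la by apply/(calO_ordE S fieldE)/(ordE_geP S fieldE); rewrite ?wla.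
pose nu := iota r * bar la.
have nu_int : calO nu.
  by apply: (calOM S); [apply: (calO_iota S) | apply: (calO_bar S)].
pose e := x + nu *: y.
have Me : M e by apply: MD => //; apply: MZ.
have e_iso : normK e = 0.
  rewrite (normKD S hPhi) (normKZ S hPhi) (hformZr hPhi) barM bK (bar_iota bar) -/g.
  rewrite -mulrA (trKZ S) trla (nrKM S) (nrK_iota S) (nrK_bar S).
  transitivity (c * (normK x / c + r + nrK la * (normK y / c) * r ^+ 2)); first by field.
  by rewrite rE mulr0.
have ee : Phi e e = 0 by rewrite -(normKE S hPhi) e_iso iota_alg0.
have [g1_0 wg1] : Phi e y != 0 /\ w (Phi e y) = w g.
  rewrite (hformDl hPhi) (hformZl hPhi) -/g -(normKE S hPhi).
  apply: (ordED_lt S fieldE g0 (n := w g + 1)); first by clear; lia.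
  rewrite -mulrA; apply: (@ordE_geW _ _ _ _ (0 + (1 + ord c *+ 2))); first by move: e_ge0 tE cn; clear; lia.
  apply: (ordE_geM S); first exact: (ordE_ge_iota S r_int).
  apply: (ordE_geM S); last exact: (ordE_ge_iota S (norm_ge _ My)).
  by apply/(ordE_ge_bar S)/(ordE_geP S fieldE); rewrite ?wla.
pose y1 := bar (pi ^ (w g) / Phi e y) *: y.
have ug1 : Phi e y \is a GRing.unit := fieldE g1_0.
have My1 : M y1.
  apply: MZ => //; apply: (calO_bar S); apply/(calO_ordE S fieldE).
  have g1'0 := invE_neq0 fieldE g1_0; have p0 := pi_expz_neq0 (w g).
  apply/(ordE_geP S fieldE); first by rewrite (mulE_neq0 fieldE).
  by rewrite (ordEM S) // (ordEV S) // ordE_pi_expz wg1 subrr.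
have ey1 : Phi e y1 = pi ^ (w g) by rewrite (hformZr hPhi) bK divrK.
(* Chosen so that Tr(mu pi^s) = - normK y1: adding mu e makes y1 isotropic without changing its
   product with the isotropic e. The bound on norms makes mu integral. *)
pose mu := iota (- normK y1) * (pi / eta) / pi ^ (w g).
have up := pi_expz_unit (w g); have p0 := pi_expz_neq0 (w g).
have mu_int : calO mu.
  have [q0|q0] := eqVneq (normK y1) 0.
    by rewrite /mu q0 oppr0 iota_alg0 !mul0r; apply: (calO0 S).
  have Nq0 : - normK y1 != 0 by rewrite oppr_eq0.
  have [h1 h2] := ordE_solve S fieldE pi0 w_pi Nq0.
  have p'0 := invE_neq0 fieldE p0.
  apply/(calO_ordE S fieldE)/(ordE_geP S fieldE); first by rewrite (mulE_neq0 fieldE).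
  rewrite (ordEM S) // (ordEV S) // h2 ordE_pi_expz (ordN vK).
  by move: (star _ My1 q0); clear; lia.
exists (w g), e, (y1 + mu *: e); split; first by split=> //; apply: MD => //; apply: MZ.
split=> //; first by exists t.
  rewrite -(normKE S hPhi) (normKD S hPhi) (normKZ S hPhi mu e) e_iso mulr0 addr0.
  have -> : trK (Phi y1 (mu *: e)) = trK (mu * pi ^ (w g)).
    by rewrite (hformZr hPhi) (hformC hPhi e y1) ey1 -barM (trK_bar S).
  by rewrite divrK // (trK_solve S fieldE pi0 w_pi) subrr iota_alg0.
by rewrite (hformDr hPhi) (hformZr hPhi mu e e) ee mulr0 addr0.
Qed.

(** [hyp_int_e] and [hyp_int_f] are what makes the planes orthogonal summands of L: the coefficients
    of the projection become integral. Indexing by [nat] with a bound lets a family grow without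
    changing its type. *)
Record hyperbolic_family (L : set V) (k : nat) (s : nat -> int) (e f : nat -> V) :
    Prop := HyperbolicFamily {
  hyp_e : forall i, (i < k)%N -> L (e i);
  hyp_f : forall i, (i < k)%N -> L (f i);
  hyp_ee : forall i j, (i < k)%N -> (j < k)%N -> Phi (e i) (e j) = 0;
  hyp_ff : forall i j, (i < k)%N -> (j < k)%N -> Phi (f i) (f j) = 0;
  hyp_ef : forall i j, (i < k)%N -> (j < k)%N ->
    Phi (e i) (f j) = if i == j then pi ^ s i else 0;
  hyp_int_e : forall i x, (i < k)%N -> L x -> wge (s i) (Phi x (e i));
  hyp_int_f : forall i x, (i < k)%N -> L x -> wge (s i) (Phi x (f i));
  hyp_parity : forall i, (i < k)%N -> exists t, s i = w eta + t *+ 2 }.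

Definition complete_family (k : nat) (e f : nat -> V) : Prop :=
  forall v, (forall i, (i < k)%N -> Phi v (e i) = 0 /\ Phi v (f i) = 0) -> v = 0.

Definition coef_e (s : nat -> int) (f : nat -> V) (v : V) i := Phi v (f i) / pi ^ s i.
Definition coef_f (s : nat -> int) (e : nat -> V) (v : V) i :=
  Phi v (e i) / bar (pi ^ s i).

Section Family.

Variables (L : set V) (k : nat) (s : nat -> int) (e f : nat -> V).
Hypothesis L_lattice : is_lattice ord bar L.
Hypothesis hF : hyperbolic_family L k s e f.

Lemma hyp_fe i j : (i < k)%N -> (j < k)%N ->
  Phi (f i) (e j) = if i == j then bar (pi ^ s i) else 0.
Proof.
move=> ik jk; rewrite (hformC hPhi) (hyp_ef hF) // eq_sym.
by case: eqP => [->//|_]; rewrite bar0.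
Qed.

(** The orthogonal projection to the span of the hyperbolic pairs. *)
Definition family_part v : V :=
  \sum_(i < k) (coef_e s f v i *: e i + coef_f s e v i *: f i).

Lemma form_family_part_e v j : (j < k)%N -> Phi (family_part v) (e j) = Phi v (e j).
Proof.
move=> jk; rewrite (hform_suml hPhi) (bigD1 (Ordinal jk)) //= big1 => [|i ij].
  rewrite (hformDl hPhi) !(hformZl hPhi) (hyp_ee hF) // hyp_fe // eqxx.
  by rewrite mulr0 add0r addr0 divrK // (bar_unit S) pi_expz_unit.
rewrite (hformDl hPhi) !(hformZl hPhi) (hyp_ee hF) // hyp_fe //.
rewrite ifN ?mulr0 ?addr0 //.
Qed.

Lemma form_family_part_f v j : (j < k)%N -> Phi (family_part v) (f j) = Phi v (f j).
Proof.
move=> jk; rewrite (hform_suml hPhi) (bigD1 (Ordinal jk)) //= big1 => [|i ij].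
  rewrite (hformDl hPhi) !(hformZl hPhi) (hyp_ff hF) // (hyp_ef hF) // eqxx.
  by rewrite mulr0 !addr0 divrK // pi_expz_unit.
rewrite (hformDl hPhi) !(hformZl hPhi) (hyp_ff hF) // (hyp_ef hF) //.
rewrite ifN ?mulr0 ?addr0 //.
Qed.

Lemma coef_e_int v i : (i < k)%N -> L v -> calO (coef_e s f v i).
Proof.
move=> ik vL; apply/(calO_ordE S fieldE); rewrite -(subrr (s i)).
apply: (ordE_geM S); first exact: (hyp_int_f hF).
have p0 := pi_expz_neq0 (s i).
by apply/(ordE_geP S fieldE); rewrite ?invE_neq0 // (ordEV S) // ordE_pi_expz.
Qed.

Lemma coef_f_int v i : (i < k)%N -> L v -> calO (coef_f s e v i).
Proof.
move=> ik vL; apply/(calO_ordE S fieldE); rewrite -(subrr (s i)).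
apply: (ordE_geM S); first exact: (hyp_int_e hF).
have p0 := barE_neq0 S fieldE (pi_expz_neq0 (s i)).
by apply/(ordE_geP S fieldE); rewrite ?invE_neq0 // (ordEV S) // (ordE_bar S) ordE_pi_expz.
Qed.

Lemma family_part_L v : L v -> L (family_part v).
Proof.
move=> vL; apply: (lattice_sum S L_lattice) => i _.
apply: (latticeD S L_lattice); apply: (latticeZ S L_lattice).
- exact: coef_e_int.
- exact: (hyp_e hF).
- exact: coef_f_int.
- exact: (hyp_f hF).
Qed.

Lemma family_part_complete v : complete_family k e f -> v = family_part v.
Proof.
move=> hc; apply/eqP; rewrite -subr_eq0; apply/eqP; apply: hc => i ik.
by rewrite !(hformBl hPhi) form_family_part_e // form_family_part_f // !subrr.
Qed.

Definition family_vec (i : 'I_(k + k)) : V :=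
  match split i with inl j => e j | inr j => f j end.

Definition family_coef (v : V) (i : 'I_(k + k)) : E :=
  match split i with inl j => coef_e s f v j | inr j => coef_f s e v j end.

Lemma family_coef_vec i j : family_coef (family_vec i) j = (i == j)%:R.
Proof.
rewrite /family_coef /family_vec -(splitK i) -(splitK j) !unsplitK.
rewrite (inj_eq (can_inj (@unsplitK _ _))) /coef_e /coef_f.
case: (split i) => {}i; case: (split j) => {}j.
- rewrite (hyp_ef hF) // (inj_eq (@inl_inj _ _)) -val_eqE /=.
  case: eqP => [->|_]; last by rewrite mul0r.
  by rewrite divrr ?pi_expz_unit.
- by rewrite (hyp_ee hF) // mul0r.
- by rewrite (hyp_ff hF) // mul0r.
rewrite hyp_fe // (inj_eq (@inr_inj _ _)) -val_eqE /=.
case: eqP => [->|_]; last by rewrite mul0r.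
by rewrite divrr // (bar_unit S) pi_expz_unit.
Qed.

Let A : 'M[E]_(k + k, dim V) := \matrix_i v2r (family_vec i).
Let B : 'M[E]_(dim V, k + k) := \matrix_(j, i) family_coef (r2v (delta_mx 0 j)) i.

Lemma row_family_coef v i : (v2r v *m B) 0 i = family_coef v i.
Proof.
have [b [c coefE]] : exists b c, forall u, family_coef u i = Phi u b * c.
  rewrite /family_coef /coef_e /coef_f; case: (split i) => j.
    by exists (f j), (pi ^ s j)^-1.
  by exists (e j), (bar (pi ^ s j))^-1.
rewrite mxE coefE [in RHS](r2v_sum v) (hform_suml hPhi) mulr_suml.
by apply: eq_bigr => j _; rewrite !mxE coefE (hformZl hPhi) mulrA.
Qed.

(** The vectors of the family and the coefficient functions form matrices A and B with A B = 1,
    which bounds the rank although E only carries a ring structure. *)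
Lemma family_size : (k.*2 <= dim V)%N.
Proof.
rewrite -addnn; apply: (mulmx1_min (A := A) (B := B)); apply/matrixP => i j.
transitivity ((row i A *m B) 0 j); first by rewrite -row_mul [RHS]mxE.
by rewrite rowK row_family_coef family_coef_vec mxE.
Qed.

Lemma complete_family_size : complete_family k e f -> dim V = k.*2.
Proof.
move=> hc; apply/eqP; rewrite eqn_leq family_size andbT -addnn.
apply: (mulmx1_min (A := B) (B := A)); apply/row_matrixP => j.
rewrite row_mul row1; set x := r2v (delta_mx 0 j).
have -> : row j B = v2r x *m B by rewrite r2vK -rowE.
rewrite -[RHS]r2vK -/x [in RHS](family_part_complete x hc) mulmx_sum_row.
rewrite big_split_ord /family_part big_split linearD !linear_sum /=.
congr (_ + _); apply: eq_bigr => i _; rewrite row_family_coef rowK linearZ /=.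
  rewrite /family_coef /family_vec.
  by rewrite -[lshift k i]/(unsplit (inl i : 'I_k + 'I_k)) unsplitK.
rewrite /family_coef /family_vec.
by rewrite -[rshift k i]/(unsplit (inr i : 'I_k + 'I_k)) unsplitK.
Qed.

End Family.

End Hyperbolic.

(** * Splitting off hyperbolic planes *)

Section Splitting.

Variables (K : fieldType) (ord : K -> int) (E : comUnitAlgType K).
Variable bar : {lrmorphism E -> E}.
Hypothesis S : quadratic_setting ord bar.
Hypothesis fieldE : is_field E.

Local Notation iota := (iota_alg E).
Local Notation w := (ordE ord bar).
Local Notation wge := (ordE_ge ord bar).
Local Notation trK := (trK bar).
Local Notation nrK := (nrK bar).
Local Notation calO := (calO ord bar).

Variable pi : E.
Hypothesis pi0 : pi != 0.
Hypothesis w_pi : w pi = 1.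

Local Notation eta := (pi - bar pi).

Variables (V : vectType E) (L : set V) (Phi : V -> V -> E).
Hypothesis L_lattice : is_lattice ord bar L.
Hypothesis hPhi : hermitian_form bar Phi.
Hypothesis Phi_nondeg : nondegenerate_form Phi.
Local Notation normK := (normK Phi).
Local Notation family := (hyperbolic_family ord bar pi Phi L).

Lemma ordE_ge_not n x : ~ wge n x -> x != 0 /\ w x < n.
Proof.
move=> h; have x0 : x != 0 by apply: contra_not_neq h => ->; apply: ordE_ge0 S n.
by split=> //; rewrite ltNge; apply/negP => h'; apply: h; apply/(ordE_geP S fieldE).
Qed.

Lemma form_orth_family_part k s e f x v :
  (forall i, (i < k)%N -> Phi x (e i) = 0 /\ Phi x (f i) = 0) ->
  Phi x (family_part bar pi Phi k s e f v) = 0.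
Proof.
move=> xorth; rewrite (hform_sumr hPhi) big1 // => i _.
have [h1 h2] := xorth i (ltn_ord i).
by rewrite (hformDr hPhi) !(hformZr hPhi) h1 h2 !mulr0 addr0.
Qed.

(** The new plane is found in M, the part of L orthogonal to the family. Projecting L to M leaves
    products with elements of M unchanged, which moves the hypothesis on norms from L to M and the
    integrality of the new pair from M back to L. *)
Lemma hyperbolic_extension k s e f :
  (forall z, L z -> normK z != 0 ->
    ~ (forall y, L y -> wge (ord (normK z) *+ 2 - w eta + 1) (Phi y z))) ->
  family k s e f -> ~ complete_family Phi k e f ->
  exists s' e' f', family k.+1 s' e' f'.
Proof.
move=> star hF ncomp.
pose orth x := forall i, (i < k)%N -> Phi x (e i) = 0 /\ Phi x (f i) = 0.
pose M := [set x | L x /\ orth x].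
pose part := family_part bar pi Phi k s e f.
have MD x y : M x -> M y -> M (x + y).
  move=> [xL xo] [yL yo]; split; first exact: (latticeD S L_lattice).
  move=> i ik; have [h1 h2] := xo i ik; have [h3 h4] := yo i ik.
  by rewrite !(hformDl hPhi) h1 h2 h3 h4 addr0.
have MZ c x : calO c -> M x -> M (c *: x).
  move=> hc [xL xo]; split; first exact: (latticeZ S L_lattice).
  by move=> i ik; have [h1 h2] := xo i ik; rewrite !(hformZl hPhi) h1 h2 mulr0.
have Mproj x : L x -> M (x - part x).
  move=> xL; split.
    apply: (latticeB S L_lattice) => //.
    exact: (family_part_L S fieldE pi0 w_pi L_lattice hF).
  move=> i ik; rewrite !(hformBl hPhi).
  rewrite (form_family_part_e S fieldE pi0 hPhi hF) //.
  by rewrite (form_family_part_f fieldE pi0 hPhi hF) // !subrr.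
have projr x y : M x -> Phi x (y - part y) = Phi x y.
  by move=> [_ xo]; rewrite (hformBr hPhi) (form_orth_family_part s y xo) subr0.
have projl x y : M x -> Phi (y - part y) x = Phi y x.
  by move=> Mx; rewrite (hformC hPhi x) projr // -(hformC hPhi).
have [x0 [y0 [Mx0 My0 g00]]] : exists x y, [/\ M x, M y & Phi x y != 0].
  move/existsNP: ncomp => [v /not_implyP[vo v0]].
  have [c [c0 _ hc]] := lattice_absorb S L_lattice v.
  have Mx : M (iota c *: v).
    split=> // i ik; have [h1 h2] := vo i ik.
    by rewrite !(hformZl hPhi) h1 h2 mulr0.
  have [y yL y0] : exists2 y, L y & Phi (iota c *: v) y != 0.
    apply: contrapT => H; apply: v0.
    have cv0 : iota c *: v = 0.
      apply: (lattice_nondeg S L_lattice hPhi Phi_nondeg) => y yL.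
      by apply/eqP; apply: contraT => h; case: H; exists y.
    have uc := iota_neq0 E c0.
    by rewrite -[v]scale1r -(mulVr uc) -scalerA cv0 scaler0.
  exists (iota c *: v), (y - part y); split=> //; first exact: Mproj.
  by rewrite projr.
have [b b0 hb] := form_bounded S L_lattice hPhi.
pose Q (p : V * V) := [/\ M p.1, M p.2 & Phi p.1 p.2 != 0].
have Q_bounded p : Q p -> - (ord b *+ 2) <= w (Phi p.1 p.2).
  case: p => u v [/= [uL _] [vL _] g0].
  have ib0 : iota b != 0 by rewrite (iota_eq0 E).
  move/(calO_ordE S fieldE): (hb u v uL vL) => /(ordE_geP S fieldE).
  rewrite (mulE_neq0 fieldE) // => /(_ isT).
  by rewrite (ordEM S) // (ordE_iota S) //; clear; lia.
have Q_ex : exists p, Q p by exists (x0, y0).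
have [[x y] /= [/= Mx My g0] xymin] := bounded_int_min Q_bounded Q_ex.
have gmin u v : M u -> M v -> wge (w (Phi x y)) (Phi u v).
  move=> Mu Mv; have [->|uv0] := eqVneq (Phi u v) 0; first exact: (ordE_ge0 S).
  by apply/(ordE_geP S fieldE) => //; apply: (xymin (u, v)); split.
have starM z : M z -> normK z != 0 -> w (Phi x y) + w eta <= ord (normK z) *+ 2.
  move=> Mz q0; have zL : L z by case: Mz.
  have /existsNP[u /not_implyP[uL /ordE_ge_not[uz0 uzw]]] := star z zL q0.
  have Mu := Mproj u uL.
  rewrite -(projl z u Mz) in uz0 uzw.
  have Qu : Q (u - part u, z) by [].
  by move: (xymin _ Qu) uzw => /=; clear; lia.
have [s1 [e1 [f1 [[Me1 Mf1 s1E] [par e1e1 f1f1 e1f1]]]]] :=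
  hyperbolic_plane S fieldE pi0 w_pi hPhi MD MZ Mx My g0 gmin starM.
have e1o i : (i < k)%N -> Phi e1 (e i) = 0 /\ Phi e1 (f i) = 0 by case: Me1 => _; apply.
have f1o i : (i < k)%N -> Phi f1 (e i) = 0 /\ Phi f1 (f i) = 0 by case: Mf1 => _; apply.
have sym0 u v : Phi u v = 0 -> Phi v u = 0.
  by move=> h; rewrite (hformC hPhi) h bar0.
pose ext T (g : nat -> T) t i := if (i < k)%N then g i else t.
have ext_lt T (g : nat -> T) t i : (i < k)%N -> ext T g t i = g i by rewrite /ext => ->.
have ext_k T (g : nat -> T) t : ext T g t k = t by rewrite /ext ltnn.
have case_k i : (i < k.+1)%N -> i = k \/ (i < k)%N.
  by rewrite ltnS leq_eqVlt => /orP[/eqP|]; [left | right].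
exists (ext int s s1), (ext V e e1), (ext V f f1).
split.
- by move=> i /case_k[->|ik]; rewrite ?ext_k ?ext_lt //; [case: Me1 | apply: hyp_e hF _ ik].
- by move=> i /case_k[->|ik]; rewrite ?ext_k ?ext_lt //; [case: Mf1 | apply: hyp_f hF _ ik].
- move=> i j /case_k[->|ik] /case_k[->|jk]; rewrite ?ext_k ?ext_lt //.
  + by case: (e1o j jk).
  + by apply: sym0; case: (e1o i ik).
  + exact: (hyp_ee hF).
- move=> i j /case_k[->|ik] /case_k[->|jk]; rewrite ?ext_k ?ext_lt //.
  + by case: (f1o j jk).
  + by apply: sym0; case: (f1o i ik).
  + exact: (hyp_ff hF).
- move=> i j /case_k[->|ik] /case_k[->|jk]; rewrite ?ext_k ?ext_lt //.
  + by rewrite eqxx.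
  + by rewrite gtn_eqF //; case: (e1o j jk).
  + by rewrite ltn_eqF //; apply: sym0; case: (f1o i ik).
  + exact: (hyp_ef hF).
- move=> i u /case_k[->|ik] uL; rewrite ?ext_k ?ext_lt //; last exact: (hyp_int_e hF).
  by rewrite s1E -(projl e1 u) //; apply: gmin => //; apply: Mproj.
- move=> i u /case_k[->|ik] uL; rewrite ?ext_k ?ext_lt //; last exact: (hyp_int_f hF).
  by rewrite s1E -(projl f1 u) //; apply: gmin => //; apply: Mproj.
by move=> i /case_k[->|ik]; rewrite ?ext_k ?ext_lt //; apply: (hyp_parity hF).
Qed.

Lemma hyperbolic_splitting :
  (forall z, L z -> normK z != 0 ->
    ~ (forall y, L y -> wge (ord (normK z) *+ 2 - w eta + 1) (Phi y z))) ->
  exists k s e f, family k s e f /\ complete_family Phi k e f.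
Proof.
move=> star; apply: contrapT => H.
have fam k : exists s e f, family k s e f.
  elim: k => [|k [s [e [f hF]]]].
    by exists (fun=> 0), (fun=> 0), (fun=> 0); split.
  apply: (hyperbolic_extension star hF) => hc; apply: H.
  by exists k, s, e, f.
have [s [e [f hF]]] := fam (dim V).+1.
have := family_size S fieldE pi0 hPhi hF.
by rewrite doubleS -addnn; lia.
Qed.

End Splitting.

(** * Determinants of automorphisms of a hyperbolic lattice *)

Section SmallDeterminants.

Variables (K : fieldType) (ord : K -> int) (E : comUnitAlgType K).
Variable bar : {lrmorphism E -> E}.
Hypothesis S : quadratic_setting ord bar.
Hypothesis fieldE : is_field E.

Let vK := setting_val S.
Let bK := barK S.

Local Notation iota := (iota_alg E).
Local Notation w := (ordE ord bar).
Local Notation wge := (ordE_ge ord bar).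
Local Notation trK := (trK bar).
Local Notation nrK := (nrK bar).
Local Notation calO := (calO ord bar).

Variable pi : E.
Hypothesis pi0 : pi != 0.
Hypothesis w_pi : w pi = 1.

Local Notation eta := (pi - bar pi).

Variables (V : vectType E) (L : set V) (Phi : V -> V -> E).
Hypothesis L_lattice : is_lattice ord bar L.
Hypothesis hPhi : hermitian_form bar Phi.
Local Notation normK := (normK Phi).

Variables (k : nat) (s : nat -> int) (e f : nat -> V).
Hypothesis hF : hyperbolic_family ord bar pi Phi L k s e f.

Lemma calE1_sub_calE : (0 < k)%N -> calE1 ord bar `<=` calE Phi L.
Proof.
move=> k0 x hx; have [t s0E] := hyp_parity hF k0.
have [sg [sg0 wsg <-]] := calE1_reflection_det S fieldE pi0 w_pi t hx.
rewrite -s0E in wsg; set p := pi ^ s 0%N.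
have p0 : p != 0 := pi_expz_neq0 fieldE pi0 _.
have up : p \is a GRing.unit := fieldE p0.
have wp : w p = s 0%N := ordE_pi_expz S fieldE pi0 w_pi _.
have p'0 := invE_neq0 fieldE p0.
have sp0 : sg / p != 0 by rewrite (mulE_neq0 fieldE).
(* The coefficient is chosen to give Phi(z, z) = Tr(bar(la) p) = Tr(sg), so that sg defines a
   reflection along z. *)
pose la := bar (sg / p); pose z := e 0%N + la *: f 0%N.
have la_int : calO la.
  apply/(calO_bar S)/(calO_ordE S fieldE)/(ordE_geP S fieldE) => //.
  by rewrite (ordEM S) // (ordEV S) // wp wsg subrr.
have eL := hyp_e hF k0; have fL := hyp_f hF k0.
have zL : L z.
  by apply: (latticeD S L_lattice) => //; apply: (latticeZ S L_lattice).
have norm0 v : Phi v v = 0 -> normK v = 0.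
  by move=> h; apply: (iota_inj (E := E)); rewrite (normKE S hPhi) h iota_alg0.
have zE : trK sg = normK z.
  rewrite (normKD S hPhi) (normKZ S hPhi) !norm0 ?(hyp_ee hF) ?(hyp_ff hF) //.
  rewrite mulr0 !add0r (hformZr hPhi) bK (hyp_ef hF) // eqxx -/p.
  by rewrite divrK.
have [|g [gL _ gdet]] := reflection_ordE S L_lattice hPhi fieldE zL sg0 zE; last by exists g.
move=> y yL; rewrite wsg (hformDr hPhi) (hformZr hPhi).
apply: (ordE_geD S fieldE); first exact: (hyp_int_e hF).
rewrite -[s 0%N]add0r; apply: (ordE_geM S); last exact: (hyp_int_f hF).
by apply/(ordE_ge_bar S)/(calO_ordE S fieldE).
Qed.

Hypothesis complete : complete_family Phi k e f.

(** [A] collects the pairs still to be fixed; an automorphism fixing all others acts on the sum of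
    the planes indexed by [A], which is [part_on A]. *)
Definition fixes_off (A : {set 'I_k}) (g : V -> V) : Prop :=
  forall i : 'I_k, i \notin A -> g (e i) = e i /\ g (f i) = f i.

Definition part_on (A : {set 'I_k}) : set V :=
  [set x | L x /\ forall i : 'I_k, i \notin A -> Phi x (e i) = 0 /\ Phi x (f i) = 0].

Lemma part_onD A x y : part_on A x -> part_on A y -> part_on A (x + y).
Proof.
move=> [xL xo] [yL yo]; split; first exact: (latticeD S L_lattice).
move=> i ik; have [h1 h2] := xo i ik; have [h3 h4] := yo i ik.
by rewrite !(hformDl hPhi) h1 h2 h3 h4 addr0.
Qed.

Lemma part_onZ A c x : calO c -> part_on A x -> part_on A (c *: x).
Proof.
move=> hc [xL xo]; split; first exact: (latticeZ S L_lattice).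
by move=> i ik; have [h1 h2] := xo i ik; rewrite !(hformZl hPhi) h1 h2 mulr0.
Qed.

Lemma part_onB A x y : part_on A x -> part_on A y -> part_on A (x - y).
Proof.
move=> hx hy; rewrite -scaleN1r; apply: part_onD => //; apply: part_onZ => //.
by apply: (calON S); apply: (calO1 S).
Qed.

Lemma part_on_image A (g : 'End(V)) x : fixes_off A g -> lattice_aut Phi L g ->
  part_on A x -> part_on A (g x).
Proof.
move=> gfix [[_ giso] gL] [xL xo]; split; first by rewrite -gL; exists x.
move=> i iA; have [h1 h2] := gfix i iA; have [h3 h4] := xo i iA.
by rewrite -[in Phi _ (e i)]h1 -[in Phi _ (f i)]h2 !giso.
Qed.

Lemma part_on_e (A : {set 'I_k}) (i : 'I_k) : i \in A -> part_on A (e i).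
Proof.
move=> iA; split; first exact: (hyp_e hF).
move=> j jA; rewrite (hyp_ee hF) // (hyp_ef hF) // ifN //.
by apply: contraNneq jA => /val_inj <-.
Qed.

Lemma part_on_f (A : {set 'I_k}) (i : 'I_k) : i \in A -> part_on A (f i).
Proof.
move=> iA; split; first exact: (hyp_f hF).
move=> j jA; rewrite (hyp_ff hF) // (hyp_fe hPhi hF) // ifN //.
by apply: contraNneq jA => /val_inj <-.
Qed.

(** * Fixing one pair of least exponent by reflections *)

Section Step.

Variables (A : {set 'I_k}) (i0 : 'I_k).
Hypothesis i0A : i0 \in A.
Hypothesis i0_min : forall j, j \in A -> s i0 <= s j.

Local Notation s0 := (s i0).
Local Notation e0 := (e i0).
Local Notation f0 := (f i0).
Local Notation LA := (part_on A).
Local Notation p := (pi ^ s i0).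

(** [s0] is the least order of Phi between L and [part_on A]. A reflection exchanging isotropic x
    and x' has sg = - Phi(x, x'), so it preserves L as soon as this product is sharp. *)
Definition sharp (g : E) : Prop := g != 0 /\ w g = s0.

Lemma part_on_coef z (j : 'I_k) : LA z -> j \notin A ->
  coef_e pi Phi s f z j = 0 /\ coef_f bar pi Phi s e z j = 0.
Proof.
move=> [_ zo] /zo[h1 h2]; rewrite /coef_e /coef_f h1 h2.
by rewrite !mul0r.
Qed.

Lemma part_on_form_ge x z : L x -> LA z -> wge s0 (Phi x z).
Proof.
move=> xL zA; have zL : L z by case: zA.
rewrite (family_part_complete S fieldE pi0 hPhi hF z complete) (hform_sumr hPhi).
elim/big_ind: _ => [|u v|j _]; [exact: (ordE_ge0 S) | exact: (ordE_geD S fieldE) |].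
rewrite (hformDr hPhi) !(hformZr hPhi).
have [jA|jA] := boolP (j \in A); last first.
  have [-> ->] := part_on_coef zA jA.
  by rewrite bar0 !mul0r addr0; apply: (ordE_ge0 S).
have sj := i0_min jA.
apply: (@ordE_geW _ _ _ _ (0 + s j)); first by rewrite add0r.
have ce := coef_e_int S fieldE pi0 w_pi hF (ltn_ord j) zL.
have cf := coef_f_int S fieldE pi0 w_pi hF (ltn_ord j) zL.
apply: (ordE_geD S fieldE); apply: (ordE_geM S).
- by apply/(ordE_ge_bar S)/(calO_ordE S fieldE).
- exact: (hyp_int_e hF).
- by apply/(ordE_ge_bar S)/(calO_ordE S fieldE).
- exact: (hyp_int_f hF).
Qed.

(** In coordinates the norm is a sum of traces of elements of order at least s0 = w eta + 2 t, and
    the trace maps these into p^(w eta + t). For s0 of the other parity the bound on traces would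
    fall short by one half. *)
Lemma part_on_norm_ge z : LA z -> normK z != 0 -> s0 + w eta <= ord (normK z) *+ 2.
Proof.
move=> zA; have zL : L z by case: zA.
have [t s0E] := hyp_parity hF (ltn_ord i0).
pose a := coef_e pi Phi s f z; pose b := coef_f bar pi Phi s e z.
have nE : normK z = \sum_(j < k) trK (a j * bar (b j) * pi ^ s j).
  apply: (iota_inj (E := E)); rewrite (normKE S hPhi) rmorph_sum.
  rewrite [X in Phi X _](family_part_complete S fieldE pi0 hPhi hF z complete).
  rewrite (hform_suml hPhi); apply: eq_bigr => j _.
  rewrite [RHS](trKE S) (hformDl hPhi) !(hformZl hPhi).
  rewrite (barM bar (a j * bar (b j))) (barM bar (a j)) bK.
  have up := pi_expz_unit fieldE pi0 (s j).
  have ub : bar (pi ^ s j) \is a GRing.unit by rewrite (bar_unit S).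
  have -> : Phi (e j) z = bar (b j) * pi ^ s j.
    rewrite (hformC hPhi z) -[X in _ * X]bK -barM; congr (bar _).
    by rewrite /b /coef_f divrK.
  have -> : Phi (f j) z = bar (a j) * bar (pi ^ s j).
    by rewrite (hformC hPhi z) -barM /a /coef_e divrK.
  by rewrite -/(a j) -/(b j); ring.
have : ord_ge ord (w eta + t) (normK z).
  rewrite nE; apply: (ord_ge_sum vK) => j _.
  have [jA|jA] := boolP (j \in A); last first.
    have [h1 _] := part_on_coef zA jA.
    by rewrite /a h1 !mul0r (trK0 S); left.
  have sj := i0_min jA.
  apply: (trK_ge S fieldE pi0 w_pi).
  apply: (@ordE_geW _ _ _ _ (0 + 0 + s j)); first by move: sj s0E; clear; lia.
  have p0 := pi_expz_neq0 fieldE pi0 (s j).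
  apply: (ordE_geM S); last first.
    by apply/(ordE_geP S fieldE); rewrite ?(ordE_pi_expz S fieldE pi0 w_pi).
  apply: (ordE_geM S).
    exact/(calO_ordE S fieldE)/(coef_e_int S fieldE pi0 w_pi hF).
  exact/(ordE_ge_bar S)/(calO_ordE S fieldE)/(coef_f_int S fieldE pi0 w_pi hF).
move=> h q0; move/(ord_geP q0): h; move: s0E; clear; lia.
Qed.

Lemma not_sharp x z : L x -> LA z -> ~ sharp (Phi x z) -> wge (s0 + 1) (Phi x z).
Proof.
move=> xL zA h; have hg := part_on_form_ge xL zA.
have [->|g0] := eqVneq (Phi x z) 0; first exact: (ordE_ge0 S).
move/(ordE_geP S fieldE _ g0): hg => hg; apply/(ordE_geP S fieldE) => //.
suff : w (Phi x z) <> s0 by move: hg; clear; lia.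
by move=> wg; apply: h.
Qed.

Lemma sharpD x y : sharp x -> wge (s0 + 1) y -> sharp (x + y).
Proof.
move=> [x0 wx] hy; have [|h1 h2] := ordED_lt S fieldE x0 _ hy.
  by rewrite wx; clear; lia.
by split; rewrite // h2.
Qed.

Lemma sharp_bar x : sharp x -> sharp (bar x).
Proof.
by move=> [x0 wx]; split; [apply: (barE_neq0 S fieldE) | rewrite (ordE_bar S)].
Qed.

Lemma sharp_p : sharp p.
Proof.
by split; [apply: (pi_expz_neq0 fieldE pi0) | apply: (ordE_pi_expz S fieldE pi0 w_pi)].
Qed.

Lemma form_e0_f0 : Phi e0 f0 = p.
Proof. by rewrite (hyp_ef hF) // eqxx. Qed.

Lemma form_f0_e0 : Phi f0 e0 = bar p.
Proof. by rewrite (hformC hPhi e0) form_e0_f0. Qed.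

Lemma form_e0_e0 : Phi e0 e0 = 0. Proof. exact: (hyp_ee hF). Qed.
Lemma form_f0_f0 : Phi f0 f0 = 0. Proof. exact: (hyp_ff hF). Qed.

Definition good_move (t : 'End(V)) : Prop :=
  [/\ lattice_aut Phi L t, fixes_off A t & calE1 ord bar (\det (f2mx t))].

Lemma good_move_comp t1 t2 : good_move t1 -> good_move t2 ->
  good_move (t1 \o t2)%VF.
Proof.
move=> [a1 b1 c1] [a2 b2 c2]; split; first exact: lattice_aut_comp.
  move=> i iA; have [h1 h2] := b1 i iA; have [h3 h4] := b2 i iA.
  by rewrite !comp_lfunE h3 h4 h1 h2.
by rewrite f2mx_comp det_mulmx; apply: (calE1M S fieldE).
Qed.

(* The reflection in the direction [x - x'] exchanges the two isotropic vectors. *)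
Lemma move_isotropic x x' : LA x -> LA x' -> Phi x x = 0 -> Phi x' x' = 0 ->
  sharp (Phi x x') -> exists t, [/\ good_move t, t x = x' &
    forall y, Phi y x = Phi y x' -> t y = y].
Proof.
move=> xA x'A xx x'x' [g0 wg]; pose z := x - x'; pose sg := - Phi x x'.
have zA : LA z by exact: part_onB.
have zL : L z by case: zA.
have sg0 : sg != 0 by rewrite oppr_eq0.
have wsg : w sg = s0 by rewrite (ordEN S).
have sgE : trK sg = normK z.
  apply: (iota_inj (E := E)); rewrite (trKE S) (normKE S hPhi) /sg barN.
  rewrite -(hformC hPhi) (hformBl hPhi) !(hformBr hPhi) xx x'x'; ring.
have [|t [tL tE tdet]] := reflection_ordE S L_lattice hPhi fieldE zL sg0 sgE.
  by move=> y yL; rewrite wsg; apply: part_on_form_ge.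
have [j s0E] := hyp_parity hF (ltn_ord i0).
have fix_orth y : Phi y z = 0 -> t y = y.
  by move=> h; rewrite tE h mul0r scale0r subr0.
exists t; split.
- split=> //; last first.
    by rewrite tdet; apply: (reflection_det_calE1 S fieldE pi0 w_pi sg0 (j := j)); rewrite wsg.
  move=> i iA; have [h1 h2] := zA.2 i iA.
  by split; apply: fix_orth; rewrite (hformC hPhi z) ?h1 ?h2 bar0.
- have usg : sg \is a GRing.unit := fieldE sg0.
  rewrite tE (hformBr hPhi) xx sub0r -/sg divrr // scale1r.
  by rewrite /z opprB addrC subrK.
by move=> y h; apply: fix_orth; rewrite (hformBr hPhi) h subrr.
Qed.

(** For q orthogonal to e0 and f0 this makes q + f0 + al e0 isotropic. That al is integral comes
    from [part_on_norm_ge]. *)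
Lemma isotropic_correction q : LA q ->
  exists2 al, calO al & trK (al * p) = - normK q.
Proof.
move=> qA; have up := pi_expz_unit fieldE pi0 s0.
exists (iota (- normK q) * (pi / eta) / p); last first.
  by rewrite divrK // (trK_solve S fieldE pi0 w_pi).
have [q0|q0] := eqVneq (normK q) 0.
  by rewrite q0 oppr0 iota_alg0 !mul0r; apply: (calO0 S).
have Nq0 : - normK q != 0 by rewrite oppr_eq0.
have [h1 h2] := ordE_solve S fieldE pi0 w_pi Nq0.
have p0 := pi_expz_neq0 fieldE pi0 s0.
have p'0 := invE_neq0 fieldE p0.
apply/(calO_ordE S fieldE)/(ordE_geP S fieldE); first by rewrite (mulE_neq0 fieldE).
rewrite (ordEM S) // (ordEV S) // h2 (ordE_pi_expz S fieldE pi0 w_pi) (ordN vK).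
by move: (part_on_norm_ge qA q0); clear; lia.
Qed.

Lemma norm_f0_e0 al : normK (f0 + al *: e0) = trK (al * p).
Proof.
have norm0 v : Phi v v = 0 -> normK v = 0.
  by move=> h; apply: (iota_inj (E := E)); rewrite (normKE S hPhi) h iota_alg0.
rewrite (normKD S hPhi) (normKZ S hPhi) !norm0 ?form_e0_e0 ?form_f0_f0 //.
by rewrite mulr0 !add0r (hformZr hPhi) form_f0_e0 -barM (trK_bar S).
Qed.

(** If Phi(x, e0) is not sharp, x reaches e0 through an isotropic v having sharp products with both.
    Either v = f0 works, or Phi(x, e0) and Phi(x, f0) are both small; then the component q of y
    orthogonal to e0 and f0 keeps a sharp product with x, and v is q + f0 corrected along e0. *)
Lemma move_to_e0 x y : LA x -> LA y -> Phi x x = 0 -> Phi x y = p ->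
  exists2 t, good_move t & t x = e0.
Proof.
move=> xA yA xx xy; have xL : L x by case: xA.
have e0A := part_on_e i0A; have f0A := part_on_f i0A.
have [d|nd] := pselect (sharp (Phi x e0)).
  by have [t [t1 t2 _]] := move_isotropic xA e0A xx form_e0_e0 d; exists t.
suff [v [vA vv xv ve]] : exists v,
    [/\ LA v, Phi v v = 0, sharp (Phi x v) & sharp (Phi v e0)].
  have [t1 [g1 h1 _]] := move_isotropic xA vA xx vv xv.
  have [t2 [g2 h2 _]] := move_isotropic vA e0A vv form_e0_e0 ve.
  exists (t2 \o t1)%VF; first exact: good_move_comp.
  by rewrite comp_lfunE h1 h2.
have [d|nd'] := pselect (sharp (Phi x f0)).
  exists f0; split=> //; first exact: form_f0_f0.
  by rewrite form_f0_e0; apply/sharp_bar/sharp_p.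
have xe_small := not_sharp xL e0A nd; have xf_small := not_sharp xL f0A nd'.
have yL : L y by case: yA.
pose m := coef_e pi Phi s f y i0; pose n := coef_f bar pi Phi s e y i0.
have m_int : calO m := coef_e_int S fieldE pi0 w_pi hF (ltn_ord i0) yL.
have n_int : calO n := coef_f_int S fieldE pi0 w_pi hF (ltn_ord i0) yL.
have up := pi_expz_unit fieldE pi0 s0.
have ubp : bar p \is a GRing.unit by rewrite (bar_unit S).
pose q := y - (m *: e0 + n *: f0).
have qA : LA q by apply: part_onB => //; apply: part_onD; apply: part_onZ.
have qe : Phi q e0 = 0.
  rewrite (hformBl hPhi) (hformDl hPhi) !(hformZl hPhi) form_e0_e0 form_f0_e0.
  by rewrite mulr0 add0r /n /coef_f divrK // subrr.
have qf : Phi q f0 = 0.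
  rewrite (hformBl hPhi) (hformDl hPhi) !(hformZl hPhi) form_f0_f0 form_e0_f0.
  by rewrite mulr0 addr0 /m /coef_e divrK // subrr.
have small_mul c g : calO c -> wge (s0 + 1) g -> wge (s0 + 1) (bar c * g).
  move=> /(calO_ordE S fieldE) hc hg; rewrite -[s0 + 1]add0r.
  by apply: (ordE_geM S) => //; apply: ordE_ge_bar.
have xq : sharp (Phi x q).
  rewrite (hformBr hPhi) (hformDr hPhi) !(hformZr hPhi) xy.
  apply: sharpD; first exact: sharp_p.
  by apply: (ordE_geN S); apply: (ordE_geD S fieldE); apply: small_mul.
have [al al_int alE] := isotropic_correction qA.
exists (q + (f0 + al *: e0)); split.
- by do 2?[apply: part_onD => //]; apply: part_onZ.
- rewrite -(normKE S hPhi) (normKD S hPhi) norm_f0_e0 alE subrr add0r.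
  by rewrite (hformDr hPhi) (hformZr hPhi) qe qf mulr0 addr0 (trK0 S) iota_alg0.
- rewrite (hformDr hPhi); apply: sharpD => //.
  rewrite (hformDr hPhi) (hformZr hPhi).
  by apply: (ordE_geD S fieldE) => //; apply: small_mul.
rewrite (hformDl hPhi) qe add0r (hformDl hPhi) (hformZl hPhi) form_e0_e0.
by rewrite mulr0 addr0 form_f0_e0; apply/sharp_bar/sharp_p.
Qed.

(** A reflection exchanging two vectors fixes e0 when both have the same product with e0. If Phi(y,
    f0) is not sharp, the detour is v = f0 + be e0 with be p skew, hence v isotropic, and of order
    s0; skew elements of this order exist because s0 and w eta have the same parity. *)
Lemma move_to_f0 y : LA y -> Phi y y = 0 -> Phi e0 y = p ->
  exists t, [/\ good_move t, t e0 = e0 & t y = f0].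
Proof.
move=> yA yy ey; have yL : L y by case: yA.
have e0A := part_on_e i0A; have f0A := part_on_f i0A.
have [d|nd] := pselect (sharp (Phi y f0)).
  have [t [t1 t2 t3]] := move_isotropic yA f0A yy form_f0_f0 d.
  by exists t; split=> //; apply: t3; rewrite ey form_e0_f0.
have yf_small := not_sharp yL f0A nd.
have [j s0E] := hyp_parity hF (ltn_ord i0).
have [c [c0 _ cw]] := ordE_surj_even S j.
have ic0 : iota c != 0 by rewrite (iota_eq0 E).
have eta0 := eta_neq0 S pi0 w_pi.
have ce0 : iota c * eta != 0 by rewrite (mulE_neq0 fieldE).
have wce : w (iota c * eta) = s0 by rewrite (ordEM S) // cw s0E addrC.
have p0 := pi_expz_neq0 fieldE pi0 s0; have p'0 := invE_neq0 fieldE p0.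
have up := pi_expz_unit fieldE pi0 s0.
pose be := iota c * eta / p.
have bep : be * p = iota c * eta by rewrite divrK.
have be_sharp : sharp (be * p) by rewrite bep.
have be_int : calO be.
  apply/(calO_ordE S fieldE)/(ordE_geP S fieldE); first by rewrite (mulE_neq0 fieldE).
  by rewrite (ordEM S) // (ordEV S) // wce (ordE_pi_expz S fieldE pi0 w_pi) subrr.
pose v := f0 + be *: e0.
have vA : LA v by apply: part_onD => //; apply: part_onZ.
have vv : Phi v v = 0.
  rewrite -(normKE S hPhi) norm_f0_e0 bep (trKE S) barM (bar_iota bar).
  by rewrite (bar_eta S) mulrN subrr.
have yv : sharp (Phi y v).
  rewrite (hformDr hPhi) (hformZr hPhi) addrC; apply: sharpD => //.
  by rewrite (hformC hPhi e0) ey -barM; apply: sharp_bar.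
have vf : sharp (Phi v f0).
  by rewrite (hformDl hPhi) (hformZl hPhi) form_f0_f0 form_e0_f0 add0r.
have ev : Phi e0 v = p.
  by rewrite (hformDr hPhi) (hformZr hPhi) form_e0_e0 form_e0_f0 mulr0 addr0.
have [t1 [g1 h1 k1]] := move_isotropic yA vA yy vv yv.
have [t2 [g2 h2 k2]] := move_isotropic vA f0A vv form_f0_f0 vf.
exists (t2 \o t1)%VF; split; first exact: good_move_comp.
  by rewrite comp_lfunE k1 ?ey ?ev // k2 // ev form_e0_f0.
by rewrite comp_lfunE h1 h2.
Qed.

Lemma fix_one_pair (g : 'End(V)) : lattice_aut Phi L g -> fixes_off A g ->
  exists2 t, good_move t & fixes_off (A :\ i0) (t \o g)%VF.
Proof.
move=> gL gfix; have giso := gL.1.2.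
have xA := part_on_image gfix gL (part_on_e i0A).
have yA := part_on_image gfix gL (part_on_f i0A).
have [|| t1 g1 t1x] := move_to_e0 xA yA.
- by rewrite giso form_e0_e0.
- by rewrite giso form_e0_f0.
have [t1L t1fix _] := g1; have t1iso := t1L.1.2.
have y1A := part_on_image t1fix t1L yA.
have [|| t2 [g2 t2e t2y]] := move_to_f0 y1A.
- by rewrite t1iso giso form_f0_f0.
- by rewrite -[X in Phi X _]t1x t1iso giso form_e0_f0.
exists (t2 \o t1)%VF; first exact: good_move_comp.
have [_ t2fix _] := g2.
move=> i; rewrite !inE negb_and negbK !comp_lfunE => /orP[/eqP ->|iA].
  by rewrite t1x t2e t2y.
have [h1 h2] := gfix i iA; have [h3 h4] := t1fix i iA.
by rewrite h1 h2 h3 h4; apply: t2fix.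
Qed.

End Step.

Lemma calE1_unit x : calE1 ord bar x -> x \is a GRing.unit.
Proof.
move=> [u /(calO_unitsP S fieldE)[u0 _] <-].
have bu0 := barE_neq0 S fieldE u0.
by rewrite unitrM unitrV !(field_neq0 fieldE) u0.
Qed.

Lemma aut_det_calE1 (A : {set 'I_k}) (g : 'End(V)) : lattice_aut Phi L g -> fixes_off A g ->
  calE1 ord bar (\det (f2mx g)).
Proof.
have [n] := ubnP #|A|; elim: n => // n IH in A g *; rewrite ltnS => cA gL gfix.
have [A0|[j jA]] := set_0Vmem A.
  have -> : g = \1%VF.
    apply/lfunP => v; rewrite id_lfunE; apply/eqP; rewrite -subr_eq0; apply/eqP.
    apply: complete => i ik; have [|h1 h2] := gfix (Ordinal ik); first by rewrite A0 inE.
    have giso := gL.1.2; rewrite /= in h1 h2.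
    by rewrite !(hformBl hPhi) -{1}h1 -{1}h2 !giso !subrr.
  by rewrite f2mx_id det1; apply: (calE1_one S fieldE).
case: (arg_minP (fun i : 'I_k => s i) jA) => i0 i0A i0_min.
have [t [tL tfix tdet] hfix] := fix_one_pair i0A i0_min gL gfix.
have := IH (A :\ i0) (t \o g)%VF; rewrite f2mx_comp det_mulmx => h.
have {}h : calE1 ord bar (\det (f2mx g) * \det (f2mx t)).
  apply: h => //; last exact: lattice_aut_comp.
  by move: cA; rewrite (cardsD1 i0 A) (i0A : i0 \in A).
have -> : \det (f2mx g) = \det (f2mx g) * \det (f2mx t) * (\det (f2mx t))^-1.
  by rewrite mulrK // calE1_unit.
by apply: (calE1M S fieldE) => //; apply: (calE1V S fieldE).
Qed.

Lemma calE_sub_calE1 : calE Phi L `<=` calE1 ord bar.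
Proof.
move=> _ [g gL <-]; apply: (aut_det_calE1 (A := [set: 'I_k])%SET) => // i.
by rewrite inE.
Qed.

End SmallDeterminants.

(** * Comparison with the definitions of the statement *)

Section SumOfH.

Variables (K : fieldType) (ord : K -> int) (E : comUnitAlgType K).
Variable bar : {lrmorphism E -> E}.
Hypothesis S : quadratic_setting ord bar.
Hypothesis fieldE : is_field E.

Let bK := barK S.

Local Notation w := (ordE ord bar).
Local Notation wge := (ordE_ge ord bar).
Local Notation calO := (calO ord bar).

Variable pi : E.
Hypothesis pi0 : pi != 0.
Hypothesis w_pi : w pi = 1.

Local Notation eta := (pi - bar pi).

Variable e : nat.
Hypothesis w_eta : w eta = e%:Z.

Variables (V : vectType E) (L : set V) (Phi : V -> V -> E).
Hypothesis L_lattice : is_lattice ord bar L.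
Hypothesis hPhi : hermitian_form bar Phi.
Local Notation family := (hyperbolic_family ord bar pi Phi L).

Lemma H_formE s (x y : 'rV[E]_2) : H_form bar pi s x y =
  x 0 0 * pi ^ s * bar (y 0 1) + x 0 1 * bar (pi ^ s) * bar (y 0 0).
Proof.
have l0 : lift 0 0 = 1 :> 'I_2 by apply: val_inj.
rewrite /H_form /gram_form !big_ord_recl !big_ord0 l0 !mxE /=.
by rewrite !mulr0 !mul0r (bar_pi_expz bar fieldE pi0) !addr0 add0r.
Qed.

Lemma parity_mod2 (s : int) :
  (s = e%:Z %[mod 2])%Z <-> exists t, s = w eta + t *+ 2.
Proof.
rewrite w_eta; split=> [/eqP|[t ->]].
  by rewrite eqz_mod_dvd => /dvdzP[t tE]; exists t; move: tE; clear; lia.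
apply/eqP; rewrite eqz_mod_dvd; apply/dvdzP; exists t; clear; lia.
Qed.

Lemma sum_of_H_family : sum_of_H ord bar pi e Phi L ->
  exists k s ee ff, family k s ee ff /\ complete_family Phi k ee ff.
Proof.
move=> [_ [s [s_par [g [[h gK hK] giso gL]]]]].
set n := (dim V)./2 in s s_par g giso gL h gK hK *.
pose std (i : nat) (c : 'I_2) : {ffun 'I_n -> 'rV[E]_2} :=
  [ffun j : 'I_n => if (j : nat) == i then delta_mx 0 c else 0].
(* Extends s from ['I_n] to [nat]; the default 0 only occurs beyond the range of the family. *)
pose t i := oapp s 0 (insub i : option 'I_n).
have tE i (ik : (i < n)%N) : t i = s (Ordinal ik) by rewrite /t insubT.
have H0 s0 x : H_form bar pi s0 x 0 = 0.
  by rewrite H_formE !mxE bar0 !mulr0 addr0.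
have PhiE x i c (ik : (i < n)%N) :
    Phi x (h (std i c)) = H_form bar pi (t i) (g x (Ordinal ik)) (delta_mx 0 c).
  rewrite -giso hK /perp_form (bigD1 (Ordinal ik)) //= big1 => [|j ij].
    by rewrite addr0 ffunE eqxx (tE _ ik).
  by rewrite ffunE ifN ?H0 //; move: ij; rewrite -val_eqE.
have Phi0 x i (ik : (i < n)%N) :
    Phi x (h (std i 0)) = g x (Ordinal ik) 0 1 * bar (pi ^ t i).
  by rewrite (PhiE x i 0 ik) H_formE !mxE /= bar0 bar1 mulr0 add0r mulr1.
have Phi1 x i (ik : (i < n)%N) :
    Phi x (h (std i 1)) = g x (Ordinal ik) 0 0 * pi ^ t i.
  by rewrite (PhiE x i 1 ik) H_formE !mxE /= bar0 bar1 mulr0 addr0 mulr1.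
have std_L i c : L (h (std i c)).
  have : perp_lattice (fun=> H_lattice ord bar) (std i c).
    move=> j k; rewrite ffunE; case: ifP => _; rewrite !mxE; last exact: (calO0 S).
    by case: (_ && _); [exact: (calO1 S) | exact: (calO0 S)].
  by rewrite -gL => -[x xL <-]; rewrite gK.
have coord_int x i j : L x -> wge 0 (g x i 0 j).
  move=> xL; have : perp_lattice (fun=> H_lattice ord bar) (g x) by rewrite -gL; exists x.
  by move=> /(_ i j) /(calO_ordE S fieldE).
have wt i : wge (t i) (pi ^ t i).
  apply/(ordE_geP S fieldE); first exact: (pi_expz_neq0 fieldE pi0).
  by rewrite (ordE_pi_expz S fieldE pi0 w_pi).
exists n, t, (fun i => h (std i 0)), (fun i => h (std i 1)); split; last first.
  move=> v hv; rewrite -(gK v) -[RHS]gK linear0; congr (h _).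
  apply/ffunP => i; rewrite ffunE; apply/rowP => j; rewrite [RHS]mxE.
  have [h0 h1] := hv i (ltn_ord i).
  have up := pi_expz_unit fieldE pi0 (t i).
  have ub : bar (pi ^ t i) \is a GRing.unit by rewrite (bar_unit S).
  have iE : i = Ordinal (ltn_ord i) by apply: val_inj.
  have c1 : g v i 0 1 = 0.
    by apply: (mulIr ub); rewrite mul0r -[RHS]h0 (Phi0 v i (ltn_ord i)) -iE.
  have c0 : g v i 0 0 = 0.
    by apply: (mulIr up); rewrite mul0r -[RHS]h1 (Phi1 v i (ltn_ord i)) -iE.
  case: j => [[|[|m]] jlt] //.
    by rewrite -[RHS]c0; congr (g v i _ _); apply: val_inj.
  by rewrite -[RHS]c1; congr (g v i _ _); apply: val_inj.
split.
- by move=> i ik; apply: std_L.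
- by move=> i ik; apply: std_L.
- move=> i j ik jk; rewrite (Phi0 _ j jk) hK ffunE /=.
  by case: eqP => _; rewrite !mxE /= mul0r.
- move=> i j ik jk; rewrite (Phi1 _ j jk) hK ffunE /=.
  by case: eqP => _; rewrite !mxE /= mul0r.
- move=> i j ik jk; rewrite (Phi1 _ j jk) hK ffunE /= eq_sym.
  by case: eqP => [->|_]; rewrite !mxE /= ?mul0r ?mul1r.
- move=> i x ik xL; rewrite (Phi0 _ i ik) -[t i]add0r; apply: (ordE_geM S).
    exact: coord_int.
  by apply: (ordE_ge_bar S); rewrite add0r.
- move=> i x ik xL; rewrite (Phi1 _ i ik) -[t i]add0r; apply: (ordE_geM S).
    exact: coord_int.
  by rewrite add0r.
by move=> i ik; rewrite (tE _ ik); apply/parity_mod2.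
Qed.

Lemma family_sum_of_H k s ee ff : family k s ee ff -> complete_family Phi k ee ff ->
  sum_of_H ord bar pi e Phi L.
Proof.
move=> hF hc; have dimE := complete_family_size S fieldE pi0 hPhi hF hc.
split; first by rewrite dimE odd_double.
have kE : k = (dim V)./2 by rewrite dimE doubleK.
subst k; set n := (dim V)./2 in hF hc *.
exists (fun i : 'I_n => s i); split.
  by move=> i; apply/parity_mod2; apply: (hyp_parity hF).
pose ce := coef_e pi Phi s ff; pose cf := coef_f bar pi Phi s ee.
pose g (v : V) : {ffun 'I_n -> 'rV[E]_2} :=
  [ffun i : 'I_n => \row_c (if c == 0 then ce v i else cf v i)].
have g_lin : linear g.
  move=> c u v; apply/ffunP => i; rewrite !ffunE; apply/rowP => j; rewrite !mxE.
  by case: ifP => _; rewrite /ce /cf /coef_e /coef_f (hformDl hPhi) (hformZl hPhi);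
    rewrite mulrDl mulrA.
have g0 v i : g v i 0 0 = ce v i by rewrite ffunE mxE.
have g1 v i : g v i 0 1 = cf v i by rewrite ffunE mxE.
pose h (u : {ffun 'I_n -> 'rV[E]_2}) : V :=
  \sum_(i < n) (u i 0 0 *: ee i + u i 0 1 *: ff i).
have gE := linfunE g_lin.
have gK : cancel (linfun g) h.
  move=> v; rewrite gE [RHS](family_part_complete S fieldE pi0 hPhi hF v hc).
  by apply: eq_bigr => i _; rewrite g0 g1.
have up i := pi_expz_unit fieldE pi0 (s i).
have ub i : bar (pi ^ s i) \is a GRing.unit by rewrite (bar_unit S).
have hK : cancel h (linfun g).
  move=> u; rewrite gE; apply/ffunP => i; apply/rowP => c.
  have c0 : ce (h u) i = u i 0 0.
    rewrite /ce /coef_e (hform_suml hPhi) (bigD1 i) //= big1 => [|j ij].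
      rewrite (hformDl hPhi) !(hformZl hPhi) (hyp_ff hF) // (hyp_ef hF) // eqxx.
      by rewrite mulr0 !addr0 mulrK.
    rewrite (hformDl hPhi) !(hformZl hPhi) (hyp_ff hF) // (hyp_ef hF) //.
    by rewrite ifN ?mulr0 ?addr0.
  have c1 : cf (h u) i = u i 0 1.
    rewrite /cf /coef_f (hform_suml hPhi) (bigD1 i) //= big1 => [|j ij].
      rewrite (hformDl hPhi) !(hformZl hPhi) (hyp_ee hF) // (hyp_fe hPhi hF) // eqxx.
      by rewrite mulr0 add0r addr0 mulrK.
    rewrite (hformDl hPhi) !(hformZl hPhi) (hyp_ee hF) // (hyp_fe hPhi hF) //.
    by rewrite ifN ?mulr0 ?addr0.
  rewrite ffunE mxE c0 c1; case: c => [[|[|m]] lt] //=; congr (u i _ _);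
    exact: val_inj.
exists (linfun g); split.
- by exists h.
- move=> x y; rewrite !gE /perp_form.
  rewrite [in RHS](family_part_complete S fieldE pi0 hPhi hF x hc) (hform_suml hPhi).
  apply: eq_bigr => i _; rewrite H_formE !g0 !g1 (hformDl hPhi) !(hformZl hPhi).
  rewrite (hformC hPhi y (ee i)) (hformC hPhi y (ff i)) -!/(ce _ _) -!/(cf _ _).
  have -> : Phi y (ee i) = cf y i * bar (pi ^ s i) by rewrite /cf /coef_f divrK.
  have -> : Phi y (ff i) = ce y i * pi ^ s i by rewrite /ce /coef_e divrK.
  by rewrite !barM bK; ring.
apply/seteqP; split=> [_ [x xL <-] i j|u hu].
  rewrite gE ffunE mxE; case: ifP => _.
    exact: (coef_e_int S fieldE pi0 w_pi hF).
  exact: (coef_f_int S fieldE pi0 w_pi hF).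
exists (h u); last exact: hK.
apply: (lattice_sum S L_lattice) => i _.
apply: (latticeD S L_lattice); apply: (latticeZ S L_lattice).
- exact: hu.
- exact: (hyp_e hF).
- exact: hu.
- exact: (hyp_f hF).
Qed.

End SumOfH.

(** * The algebra K[X]/(X^2 - a) *)

Section Instance.

Variables (K : fieldType) (ord : K -> int) (a : K).
Local Notation E := (quad_alg a).

Lemma quad_poly_monic : 'X^2 - a%:P \is monic.
Proof. by rewrite monicXnsubC. Qed.

Lemma quad_poly_size : size ('X^2 - a%:P) = 3%N.
Proof. by rewrite size_XnsubC. Qed.

(** Quotients of polynomials are taken modulo [mk_monic], which substitutes a default for unsuitable
    moduli; here it changes nothing. *)
Lemma quad_mk_monic : mk_monic ('X^2 - a%:P) = 'X^2 - a%:P.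
Proof. by rewrite /mk_monic quad_poly_size quad_poly_monic. Qed.

Local Notation d := ('qX : E).

Lemma quad_sqr : d * d = iota_alg E a.
Proof.
rewrite -in_qpolyM -expr2.
transitivity (in_qpoly ('X^2 - a%:P) (('X^2 - a%:P) + a%:P)); first by rewrite subrK.
rewrite in_qpolyD.
have -> : in_qpoly ('X^2 - a%:P) ('X^2 - a%:P) = 0.
  by apply: val_inj; rewrite /= quad_mk_monic Pdiv.RingMonic.rmodpp // quad_poly_monic.
rewrite add0r -[a%:P]alg_polyC in_qpolyZ.
by congr (_ *: _); apply: in_qpoly1.
Qed.

Lemma quad_coords (x : E) : x = iota_alg E x`_0 + iota_alg E x`_1 * d.
Proof.
have dE : (d : {poly K}) = 'X by apply: qpolyXE; rewrite ?quad_poly_size ?quad_poly_monic.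
have -> : iota_alg E x`_1 * d = x`_1 *: d by exact: mulr_algl.
apply: val_inj; apply/polyP => i.
rewrite -[val (_ + _)]/(x`_0 *: 1%:P + x`_1 *: (d : {poly K})) dE.
rewrite coefD !coefZ coef1 coefX.
case: i => [|[|i]]; rewrite /= ?mulr1 ?mulr0 ?addr0 ?add0r //.
by rewrite nth_default // (leq_trans (size_npoly x)) // quad_mk_monic quad_poly_size.
Qed.

Lemma quad_coords_inj u v u' v' :
  iota_alg E u + iota_alg E v * d = iota_alg E u' + iota_alg E v' * d ->
  u = u' /\ v = v'.
Proof.
have dE : (d : {poly K}) = 'X by apply: qpolyXE; rewrite ?quad_poly_size ?quad_poly_monic.
have e x : iota_alg E x * d = x *: d by exact: mulr_algl.
rewrite !e => /(congr1 val) vh.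
have h : u *: 1%:P + v *: 'X = u' *: 1%:P + v' *: 'X :> {poly K} by rewrite -dE.
have := congr1 (fun q : {poly K} => q`_0) h; have := congr1 (fun q : {poly K} => q`_1) h.
rewrite !coefD !coefZ !coef1 !coefX /= !mulr1 !mulr0 !addr0 !add0r.
by move=> -> ->.
Qed.

Hypothesis K_char : 2%N \notin [pchar K].
Hypothesis ord_val : surjective_discrete_valuation ord.
Hypothesis K_complete : valuation_complete ord.
Hypothesis K_residue : finite_set (residue_field ord).
Hypothesis E_etale : separable_poly ('X^2 - a%:P).
Variable bar : {lrmorphism E -> E}.
Hypothesis bar_conj : is_conjugation bar.

Lemma quad_a_neq0 : a != 0.
Proof.
move: E_etale; rewrite separable_poly.unlock => /coprimep_root h; apply/eqP => a0.
have /h : root ('X^2 - a%:P) 0 by rewrite /root !hornerE a0 expr0n /= subr0.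
by rewrite derivB derivXn derivC !hornerE /= oppr0 eqxx.
Qed.

Lemma quad_two_neq0 : (2 : K) != 0.
Proof. by apply: contraNneq K_char => h; rewrite inE /= h eqxx. Qed.

(** Write bar d = r + s d and compare coordinates in (bar d)^2 = a: r^2 + s^2 a = a and 2 r s = 0.
    Injectivity of bar excludes s = 0, so r = 0 and s is 1 or -1; s = 1 would put d into the fixed
    ring K. *)
Lemma quad_skew : bar d = - d.
Proof.
have a0 := quad_a_neq0; have two0 := quad_two_neq0.
set r := (bar d)`_0; set s := (bar d)`_1.
have bE : bar d = iota_alg E r + iota_alg E s * d := quad_coords _.
have b2 : bar d * bar d = iota_alg E a by rewrite -barM quad_sqr bar_iota.
have [h1 h2] : r * r + s * s * a = a /\ r * s * 2 = 0.
  apply: quad_coords_inj; rewrite iota_alg0 mul0r addr0 -b2 bE.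
  rewrite iota_algD !iota_algM -quad_sqr (rmorph_nat (iota_alg E)); ring.
have d_notK k : d <> iota_alg E k.
  move=> dk; have [_ /eqP] : 0 = k /\ 1 = 0 :> K.
    apply: quad_coords_inj.
    by rewrite iota_alg0 iota_alg1 add0r mul1r mul0r addr0.
  by rewrite oner_eq0.
have s0 : s != 0.
  apply/eqP => s0; apply: (d_notK r); apply: (bij_inj bar_conj.1).
  by rewrite bE s0 iota_alg0 mul0r addr0 bar_iota.
have r0 : r = 0.
  move/eqP: h2; rewrite !mulf_eq0 (negPf s0) (negPf two0) !orbF.
  by move/eqP.
have : (s - 1) * (s + 1) = 0.
  apply: (mulIf a0); rewrite mul0r.
  transitivity (r * r + s * s * a - a); first by rewrite r0; ring.
  by rewrite h1 subrr.
move/eqP; rewrite mulf_eq0 subr_eq0 addr_eq0 => /orP[] /eqP s1.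
  have : bar d = d by rewrite bE r0 s1 iota_alg0 iota_alg1 add0r mul1r.
  by move/(bar_conj.2 d).1 => [k dk]; case: (d_notK k).
by rewrite bE r0 s1 iota_alg0 add0r iota_algN iota_alg1 mulN1r.
Qed.

Lemma quad_alg_setting : quadratic_setting ord bar.
Proof.
split; [exact: quad_two_neq0 | by [] | by [] | by [] | | |].
- move=> x; rewrite (quad_coords x) barD barM !(bar_iota bar) quad_skew.
  by rewrite barD barM !(bar_iota bar) barN quad_skew opprK.
- by move=> x /(bar_conj.2 x).1[k ->]; exists k.
exists d; last exact: quad_skew.
have : d * d \is a GRing.unit.
  by rewrite quad_sqr; apply: iota_neq0; apply: quad_a_neq0.
by rewrite unitrM => /andP[].
Qed.

End Instance.

Lemma hermitian_form_of (K : fieldType) (E : comUnitAlgType K)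
    (bar : {lrmorphism E -> E}) (V : vectType E)
    (Phi : {hermitian V for false & bar}) : hermitian_form bar Phi.
Proof.
split=> [x y z|c x y|x y]; first exact: linearDl.
  exact: linearZl_LR.
by rewrite hermitian_subproof expr0 mul1r.
Qed.

Theorem theorem3p7
    (K : fieldType) (ord : K -> int)
    (K_char : 2%N \notin [pchar K])
    (ord_val : surjective_discrete_valuation ord)
    (K_complete : valuation_complete ord)
    (K_residue : finite_set (residue_field ord))
    (a : K) (E_etale : separable_poly ('X^2 - a%:P))
    (bar : {lrmorphism quad_alg a -> quad_alg a})
    (bar_conj : is_conjugation bar)
    (P : set (quad_alg a)) (P_def : is_frakP ord bar P)
    (e : nat) (e_def : different ord bar = ideal_pow ord bar P e)
    (pi : quad_alg a)
    (pi_prime : ramified ord bar P -> is_prime_element ord bar P pi)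
    (V : vectType (quad_alg a)) (V_neq0 : (0 < dim V)%N)
    (Phi : {hermitian V for false & bar})
    (Phi_nondeg : nondegenerate_form Phi)
    (L : set V) (L_lattice : is_lattice ord bar L) :
  (ramified ord bar P /\ sum_of_H ord bar pi e Phi L ->
     calE Phi L = calE1 ord bar) /\
  (~ (ramified ord bar P /\ sum_of_H ord bar pi e Phi L) ->
     calE Phi L = calE0 ord bar).
Proof.
have S := quad_alg_setting K_char ord_val K_complete K_residue E_etale bar_conj.
have hPhi := hermitian_form_of Phi.
have pi_facts : is_field (quad_alg a) -> ramified ord bar P ->
    [/\ pi != 0, ordE ord bar pi = 1 & ordE ord bar (pi - bar pi) = e%:Z].
  move=> fE ramP; have Pmax := P_def.2 (field_not_split fE).
  have PE := frakP_ordE S fE Pmax.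
  have [x x0 wx] := (ramifiedP S fE P_def).1 ramP.
  have piP := pi_prime ramP.
  have : P x by rewrite PE; apply/(ordE_geP S fE) => //; rewrite wx.
  (* An element x of order 1 is pi times an integral y, while pi itself lies in P, so pi has order
     exactly 1. *)
  rewrite piP => -[y /(calO_ordE S fE) hy xE].
  have pi0 : pi != 0 by apply: contra_neq x0 => pi0; rewrite -xE pi0 mul0r.
  have y0 : y != 0 by apply: contra_neq x0 => y0; rewrite -xE y0 mulr0.
  have w_pi : ordE ord bar pi = 1.
    have Ppi : P pi by rewrite piP; exists 1; [apply: (calO1 S) | rewrite mulr1].
    rewrite PE in Ppi; move/(ordE_geP S fE _ pi0): Ppi => h1.
    move/(ordE_geP S fE _ y0): hy => h2.
    move: wx; rewrite -xE (ordEM S fE) //; move: h1 h2; clear; lia.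
  by split=> //; apply: (different_exponent S fE pi0 w_pi Pmax).
split=> [[ramP hH]|H].
  have fE := ramP.1; have [pi0 w_pi w_eta] := pi_facts fE ramP.
  have [k [s [ee [ff [hF hc]]]]] := sum_of_H_family S fE pi0 w_pi w_eta hH.
  have k0 : (0 < k)%N.
    by move: V_neq0; rewrite (complete_family_size S fE pi0 hPhi hF hc) double_gt0.
  apply/seteqP; split.
    exact: (calE_sub_calE1 S fE pi0 w_pi L_lattice hPhi hF hc).
  exact: (calE1_sub_calE S fE pi0 w_pi L_lattice hPhi hF k0).
apply/seteqP; split; first exact: (calE_sub_calE0 S L_lattice hPhi Phi_nondeg).
have [fE|nfE] := pselect (is_field (quad_alg a)); last first.
  apply: (calE0_sub_calE_unramified S L_lattice hPhi Phi_nondeg V_neq0) => x.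
  exact: (codifferent_split S nfE).
have [even|ram] := ordE_even_or_ramified S fE.
  apply: (calE0_sub_calE_unramified S L_lattice hPhi Phi_nondeg V_neq0) => x.
  exact: (codifferent_inert S fE even).
have ramP := (ramifiedP S fE P_def).2 ram.
have [pi0 w_pi w_eta] := pi_facts fE ramP.
(* If no z admits the reflections of odd type, L is a sum of planes with exponents of the parity of
   e, which the hypothesis [H] excludes. *)
have [star|nstar] := pselect (forall z, L z -> normK Phi z != 0 ->
    ~ (forall y, L y -> ordE_ge ord bar
        (ord (normK Phi z) *+ 2 - ordE ord bar (pi - bar pi) + 1) (Phi y z))).
  case: H; split=> //.
  have [k [s [ee [ff [hF hc]]]]] :=
    hyperbolic_splitting S fE pi0 w_pi L_lattice hPhi Phi_nondeg star.
  exact: (family_sum_of_H S fE pi0 w_pi w_eta L_lattice hPhi hF hc).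
move/existsNP: nstar => [z /not_implyP[zL /not_implyP[q0 /contrapT hz]]].
exact: (calE0_sub_calE_ramified S L_lattice hPhi fE pi0 w_pi zL q0 hz).
Qed.
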